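(* Let $\Omega\subset\mathbb{R}^d$ be a bounded domain with smooth boundary $\partial\Omega$, let $T>0$ and $\Omega_T:=\Omega\times(0,T)$. Assume: (HF) $f=(f_1,\dots,f_d)\in (C^2(\mathbb{R}))^d$ and $f'=(f_1',\dots,f_d')\in (L^\infty(\mathbb{R}))^d$; (HB) for $1\le i,j\le d$, $B_{ij}\in C^2(\mathbb{R})\cap L^\infty(\mathbb{R})$, and there exists $\theta>0$ such that $\sum_{i,j=1}^d B_{ij}(s)\xi_i\xi_j\ge\theta|\xi|^2$ for all $s\in\mathbb{R}$ and all $\xi\in\mathbb{R}^d$. Let $u_0\in L^\infty(\Omega)$ and let $u\in W(0,T)$ be the unique weak solution of $$u_t+\nabla\cdot f(u)=\sum_{i,j=1}^d\big(B_{ij}(u)u_{x_j}\big)_{x_i}\ \text{ in }\Omega_T,\qquad u=0\ \text{ on }\partial\Omega\times(0,T),\qquad u(x,0)=u_0(x)\ \text{ for }x\in\Omega.$$ Then $\|u(\cdot,t)\|_{L^\infty(\Omega)}\le\|u_0\|_{L^\infty(\Omega)}$ for almost every $t\in(0,T)$.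
   Context: $W(0,T):=\{u\in L^2(0,T;H^1_0(\Omega)) : u_t\in L^2(0,T;H^{-1}(\Omega))\}$. A function $u\in W(0,T)$ is a weak solution of the initial boundary value problem if for almost every $0\le t\le T$ and for all $v\in H^1_0(\Omega)$ $$\langle u_t,v\rangle+\sum_{i=1}^d\sum_{j=1}^d\int_\Omega B_{ij}(u)\frac{\partial u}{\partial x_j}\frac{\partial v}{\partial x_i}\,dx+\sum_{i=1}^d\int_\Omega f_i'(u)\frac{\partial u}{\partial x_i}\,v\,dx=0,$$ and $u(\cdot,0)=u_0$, where $\langle\cdot,\cdot\rangle$ is the duality pairing between $H^{-1}(\Omega)$ and $H^1_0(\Omega)$, and $u(\cdot,0)$ is understood through the standard embedding $W(0,T)\subset C([0,T];L^2(\Omega))$. *)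

(* Defs.v *)
From HB Require Import structures.
From mathcomp Require Import all_boot all_order all_algebra.
From mathcomp Require Import all_classical all_reals all_analysis.
Set Implicit Arguments. Unset Strict Implicit. Unset Printing Implicit Defensive.
Import Order.TTheory GRing.Theory Num.Theory.
Import numFieldNormedType.Exports.
Local Open Scope classical_set_scope.
Local Open Scope ring_scope.

(* The Borel sigma-algebra of R^n, generated by the coordinates. *)
Fact rV_display : measure_display. Proof. exact: default_measure_display. Qed.

Section measurable_rV.
Context {R : realType} (n : nat).

Definition rV_coord (i : 'I_n) (x : 'rV[R]_n) : measurableTypeR R := x ord0 i.

Let rV_set0 : g_sigma_preimage rV_coord set0.
Proof. exact: sigma_algebra0. Qed.

Let rV_setC A : g_sigma_preimage rV_coord A -> g_sigma_preimage rV_coord (~` A).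
Proof. exact: sigma_algebraC. Qed.

Let rV_bigcup (F : _^nat) : (forall i, g_sigma_preimage rV_coord (F i)) ->
  g_sigma_preimage rV_coord (\bigcup_i (F i)).
Proof. exact: sigma_algebra_bigcup. Qed.

HB.instance Definition _ := @isMeasurable.Build rV_display
  'rV[R]_n (g_sigma_preimage rV_coord) rV_set0 rV_setC rV_bigcup.

Lemma measurable_rV_coord i : measurable_fun setT (rV_coord i).
Proof.
move=> _ Y mY; rewrite setTI; apply: sub_sigma_algebra => /=.
rewrite -bigcup_seq/=; exists i => /=; first by rewrite mem_index_enum.
by exists Y => //; rewrite setTI.
Qed.

Lemma measurable_fun_rVP d (T : measurableType d) (f : T -> 'rV[R]_n) :
  measurable_fun setT f <-> forall i, measurable_fun setT (rV_coord i \o f).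
Proof.
split=> [mf i|mf]; first exact: measurableT_comp (@measurable_rV_coord i) mf.
apply: (@iffRL _ (g_sigma_preimage (fun i => rV_coord i \o f) `<=` measurable)).
  rewrite g_sigma_preimage_comp; split=> [mf' A [/= C preC <-]|prefS].
    exact: mf'.
  by move=> _ A mA; apply: prefS; exists A.
apply: smallest_sub; first exact: sigma_algebra_measurable.
rewrite -bigcup_seq/= => A [i /= _] [B mB <-].
by apply: mf.
Qed.

End measurable_rV.

Section rV_cons.
Context {R : realType} (n : nat).

Definition rV_cons (x : measurableTypeR R * 'rV[R]_n) : 'rV[R]_n.+1 :=
  \row_j oapp (x.2 ord0) x.1 (unlift ord0 j).

Definition rV_uncons (x : 'rV[R]_n.+1) : measurableTypeR R * 'rV[R]_n :=
  (x ord0 ord0, \row_j x ord0 (lift ord0 j)).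

Lemma rV_consK : cancel rV_cons rV_uncons.
Proof.
move=> [a v]; rewrite /rV_uncons /rV_cons mxE unlift_none /=; congr pair.
by apply/rowP => j; rewrite !mxE liftK.
Qed.

Lemma measurable_rV_cons : measurable_fun setT rV_cons.
Proof.
apply/measurable_fun_rVP => i; have [j|] := unliftP ord0 i => ->.
  rewrite (_ : _ \o _ = rV_coord j \o snd); last first.
    by apply/funext => x; rewrite /rV_coord /= mxE liftK.
  exact: measurableT_comp (measurable_rV_coord j) measurable_snd.
rewrite (_ : _ \o _ = fst) //.
by apply/funext => x; rewrite /rV_coord /= mxE unlift_none.
Qed.

Lemma measurable_rV_uncons : measurable_fun setT rV_uncons.
Proof.
apply/measurable_fun_pairP; split.
  exact: (@measurable_rV_coord R n.+1 ord0).
apply/measurable_fun_rVP => i.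
rewrite (_ : _ \o _ = rV_coord (lift ord0 i)); last first.
  by apply/funext => x; rewrite /rV_coord /= mxE.
exact: measurable_rV_coord.
Qed.

Variable mu : {sigma_finite_measure set 'rV[R]_n -> \bar R}.

Definition lebesgue_rV_cons : set 'rV[R]_n.+1 -> \bar R :=
  pushforward (lebesgue_measure \x mu)%E rV_cons.

Let lebesgue_rV_cons0 : lebesgue_rV_cons set0 = 0%E.
Proof. by rewrite /lebesgue_rV_cons /pushforward preimage_set0 measure0. Qed.

Let lebesgue_rV_cons_ge0 A : (0 <= lebesgue_rV_cons A)%E.
Proof. exact: (measure_ge0 (lebesgue_measure \x mu)%E). Qed.

Let lebesgue_rV_cons_sigma_additive : semi_sigma_additive lebesgue_rV_cons.
Proof.
move=> F mF tF mUF; rewrite /lebesgue_rV_cons /pushforward preimage_bigcup.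
apply: measure_semi_sigma_additive.
- by move=> k; rewrite -[X in measurable X]setTI; exact: measurable_rV_cons.
- apply/trivIsetP => /= i j _ _ ij; rewrite -preimage_setI.
  by move/trivIsetP : tF => /(_ _ _ _ _ ij) ->//; rewrite preimage_set0.
- rewrite -preimage_bigcup -[X in measurable X]setTI.
  exact: measurable_rV_cons.
Qed.

HB.instance Definition _ := isMeasure.Build _ _ _ lebesgue_rV_cons
  lebesgue_rV_cons0 lebesgue_rV_cons_ge0 lebesgue_rV_cons_sigma_additive.

Let lebesgue_rV_cons_sigma_finite : sigma_finite setT lebesgue_rV_cons.
Proof.
have /sigma_finiteP[F [TF ndF Foo]] := sigma_finiteT (@lebesgue_measure R).
have /sigma_finiteP[G [TG ndG Goo]] := sigma_finiteT mu.
exists (fun k => rV_uncons @^-1` (F k `*` G k)).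
  rewrite -preimage_bigcup -[LHS](@preimage_setT _ _ rV_uncons); congr preimage.
  rewrite -setXTT TF TG predeqE => -[x y]; split.
    move=> [/= [m _ Fmx] [k _ Gky]]; exists (maxn m k) => //; split.
    - by move: x Fmx; exact/subsetPset/ndF/leq_maxl.
    - by move: y Gky; exact/subsetPset/ndG/leq_maxr.
  by move=> [m _ []/= ? ?]; split; exists m.
move=> k; have [mF Fkoo] := Foo k; have [mG Gkoo] := Goo k; split.
  rewrite -[X in measurable X]setTI; apply: measurable_rV_uncons => //.
  exact: measurableX.
rewrite /lebesgue_rV_cons /pushforward -comp_preimage.
rewrite (_ : _ \o _ = id); last by apply/funext => x /=; rewrite rV_consK.
by rewrite preimage_id product_measure1E// lte_mul_pinfty// ge0_fin_numE.
Qed.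

HB.instance Definition _ := Measure_isSigmaFinite.Build _ _ _ lebesgue_rV_cons
  lebesgue_rV_cons_sigma_finite.

End rV_cons.

(* Lebesgue measure on Borel sets, as an iterated product measure. *)
Fixpoint lebesgue_rV {R : realType} (n : nat) :
    {sigma_finite_measure set 'rV[R]_n -> \bar R} :=
  match n with
  | 0 => @dirac _ 'rV[R]_0 0 R
  | n'.+1 => lebesgue_rV_cons (lebesgue_rV n')
  end.

Lemma lebesgue_rV_box (R : realType) n (A : 'I_n -> set (measurableTypeR R)) :
  (forall i, measurable (A i)) ->
  lebesgue_rV n [set x | forall i, A i (x ord0 i)] =
    (\prod_(i < n) lebesgue_measure (A i))%E.
Proof.
elim: n A => [|n IHn] A mA.
  rewrite big_ord0 /= diracE mem_set//.
  by case.
rewrite big_ord_recl -(IHn (fun i => A (lift ord0 i)))//.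
rewrite /= /lebesgue_rV_cons /pushforward -product_measure1E//.
  congr (_ _); apply/seteqP; split => [[a v]|[a v] [/= Aa Av] i] /=.
    move=> H; split => /=.
      by have := H ord0; rewrite mxE unlift_none.
    by move=> i; have := H (lift ord0 i); rewrite mxE liftK.
  by rewrite mxE; have [j|] := unliftP ord0 i => ->.
rewrite [X in measurable X](_ : _ =
  \big[setI/setT]_(i < n) (rV_coord i @^-1` A (lift ord0 i))).
  apply: bigsetI_measurable => i _.
  by rewrite -[X in measurable X]setTI; exact: measurable_rV_coord.
apply/seteqP; split => x; rewrite -bigcap_seq/= => H i.
  by move=> _; exact: H.
by have := H i (mem_index_enum i).
Qed.

Section function_spaces.
Context {R : realType} {d : nat}.
Local Notation E := 'rV[R]_d.
Local Notation leb := (lebesgue_rV d : {measure set E -> \bar R}).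

Definition partial (i : 'I_d) (g : E -> R) : E -> R :=
  fun x => 'D_(delta_mx 0 i) g x.

Definition smooth (g : E -> R) : Prop := forall s : seq 'I_d,
  continuous (foldr partial g s) /\
  forall i x, derivable (foldr partial g s) x (delta_mx 0 i).

Definition domain (Omega : set E) : Prop :=
  [/\ Omega !=set0, open Omega & connected Omega].

(* Near each boundary point, up to the choice of the distinguished coordinate
   i and of its orientation b, Omega is the open set above the graph of a
   smooth function of the other coordinates. *)
Definition smooth_boundary (Omega : set E) : Prop :=
  forall x0, (closure Omega `\` Omega°) x0 ->
  exists (i : 'I_d) (b : bool) (gamma : E -> R),
    [/\ smooth gamma,
        forall x y : E, (forall j, j != i -> x 0 j = y 0 j) ->
          gamma x = gamma y &
        \forall x \near x0,
          Omega x <-> 0 < (-1) ^+ b * (x 0 i - gamma x)].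

Variable Omega : set E.

Definition test_function (phi : E -> R) : Prop :=
  [/\ smooth phi, compact (closure [set x | phi x != 0])
    & closure [set x | phi x != 0] `<=` Omega].

(* Functions on Omega are represented by functions on the whole space, whose
   values outside Omega are irrelevant. *)
Definition Lp (p : \bar R) : set (E -> R) :=
  [set v | (v \_ Omega) \in Lfun leb p].

Definition normL (p : \bar R) (v : E -> R) : \bar R :=
  ('N[leb]_p[EFin \o (v \_ Omega)])%E.

Definition is_weak_partial (i : 'I_d) (v g : E -> R) : Prop :=
  forall phi, test_function phi ->
    \int[leb]_(x in Omega) (v x * partial i phi x) =
    - \int[leb]_(x in Omega) (g x * phi x).

(* A representative of the L^2 weak derivative, unique almost everywhere. *)
Definition weak_partial (i : 'I_d) (v : E -> R) : E -> R :=
  xget (fun=> 0) [set g | Lp 2%:E g /\ is_weak_partial i v g].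

Definition H1 : set (E -> R) := [set v | Lp 2%:E v /\
  forall i, exists g, Lp 2%:E g /\ is_weak_partial i v g].

Definition normH1 (v : E -> R) : \bar R :=
  ((normL 2%:E v `^ 2 + \sum_(i < d) normL 2%:E (weak_partial i v) `^ 2)
     `^ 2^-1)%E.

Definition H10 : set (E -> R) := [set v | H1 v /\
  exists phi : nat -> E -> R, (forall n, test_function (phi n)) /\
    normH1 (phi n - v) @[n --> \oo] --> 0%E].

(* Elements of H^-1 are represented by functions whose values outside H10
   are irrelevant; a linear form of finite norm vanishes on the elements of
   H10 that are zero almost everywhere on Omega. *)
Definition normHm1 (l : (E -> R) -> R) : \bar R :=
  ereal_sup [set `|l v|%:E | v in [set v | H10 v /\ (normH1 v <= 1)%E]].

Definition Hm1 : set ((E -> R) -> R) := [set l |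
  (forall (a : R) v w, H10 v -> H10 w -> l (a *: v + w) = a * l v + l w) /\
  (normHm1 l < +oo)%E].

Definition L2_Hm1 (v : E -> R) : (E -> R) -> R :=
  fun w => \int[leb]_(x in Omega) (v x * w x).

End function_spaces.

(* Bochner theory for functions I -> X, where X is a subspace of V seminormed
   by N. *)
Section bochner.
Context {R : realType} {V : lmodType R}.
Variables (X : set V) (N : V -> \bar R) (I : set R).
Local Notation leb1 := (@lebesgue_measure R).

Definition bochner_simple (s : R -> V) : Prop :=
  [/\ finite_set (s @` I), s @` I `<=` X
    & forall v, measurable (I `&` s @^-1` [set v] : set (measurableTypeR R))].

Definition simple_integral (s : R -> V) : V :=
  \sum_(v \in s @` I) (fine (leb1 (I `&` s @^-1` [set v])) *: v).

Definition simple_approx (u : R -> V) (s : nat -> R -> V) : Prop :=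
  (forall n, bochner_simple (s n)) /\
  \forall t \ae leb1, I t -> N (s n t - u t) @[n --> \oo] --> 0%E.

Definition bochner_L2 (u : R -> V) : Prop :=
  [/\ \forall t \ae leb1, I t -> X (u t),
      exists s, simple_approx u s
    & (\int[leb1]_(t in I) (N (u t) `^ 2) < +oo)%E].

Definition is_bochner_integral (u : R -> V) (J : V) : Prop :=
  X J /\ exists s, [/\ simple_approx u s,
    (\int[leb1]_(t in I) N (s n t - u t))%E @[n --> \oo] --> 0%E
  & N (simple_integral (s n) - J) @[n --> \oo] --> 0%E].

End bochner.

Section weak_solutions.
Context {R : realType} {d : nat}.
Local Notation E := 'rV[R]_d.
Local Notation leb := (lebesgue_rV d : {measure set E -> \bar R}).
Local Notation leb1 := (@lebesgue_measure R).
Variables (Omega : set E) (T : R).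
Local Notation I := (`]0, T[%classic : set R).

Definition time_test_function (phi : R -> R) : Prop :=
  [/\ forall n x, derivable phi^`(n)%classic x 1,
      compact (closure [set t | phi t != 0])
    & closure [set t | phi t != 0] `<=` I].

(* The second conjunct is the identity
   \int_0^T phi'(t) u(t) dt = - \int_0^T phi(t) ut(t) dt in H^-1, where u(t)
   is embedded in H^-1 through the inner product of L^2. *)
Definition time_derivative (u : R -> E -> R) (ut : R -> (E -> R) -> R) : Prop :=
  bochner_L2 (Hm1 Omega) (normHm1 Omega) I ut /\
  forall phi, time_test_function phi -> exists J,
    is_bochner_integral (Hm1 Omega) (normHm1 Omega) I
      (fun t => phi^`()%classic t *: L2_Hm1 Omega (u t)) J /\
    is_bochner_integral (Hm1 Omega) (normHm1 Omega) I
      (fun t => phi t *: ut t) (- J).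

Definition W : set (R -> E -> R) := [set u |
  bochner_L2 (H10 Omega) (normH1 Omega) I u /\ exists ut, time_derivative u ut].

(* The representative U of u in C([0, T]; L^2) takes the value u0 at 0. *)
Definition initial_value (u : R -> E -> R) (u0 : E -> R) : Prop :=
  exists U : R -> E -> R,
    [/\ forall t, `[0, T]%classic t -> Lp Omega 2%:E (U t),
        forall t0, `[0, T]%classic t0 ->
          normL Omega 2%:E (U t - U t0)
            @[t --> within `[0, T]%classic (nbhs t0)] --> 0%E,
        \forall t \ae leb1, I t -> u t = U t %[ae leb in Omega]
      & U 0 = u0 %[ae leb in Omega]].

Definition weak_solution (f : 'I_d -> R -> R) (B : 'I_d -> 'I_d -> R -> R)
    (u0 : E -> R) (u : R -> E -> R) : Prop :=
  [/\ W u,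
      exists ut, time_derivative u ut /\
        \forall t \ae leb1, I t -> forall v, H10 Omega v ->
          ut t v
          + \sum_(i < d) \sum_(j < d) \int[leb]_(x in Omega)
              (B i j (u t x) * weak_partial Omega j (u t) x
               * weak_partial Omega i v x)
          + \sum_(i < d) \int[leb]_(x in Omega)
              ((f i)^`()%classic (u t x) * weak_partial Omega i (u t) x * v x) = 0
    & initial_value u u0].

End weak_solutions.

Definition C2 {R : realType} (g : R -> R) : Prop :=
  [/\ forall x, derivable g x 1, forall x, derivable g^`()%classic x 1
    & continuous g^`(2)%classic].

(* Main.v *)
(* Let M be the L^oo norm of u_0 and let G = cost be convex and smooth, vanishing
   exactly on [-M, M], with g = G' bounded and g' >= 0. Testing the weak
   formulation at time t with v = g(u(t)) makes the diffusion term nonnegative by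
   ellipticity, and kills the convection term, which is the integral of a
   divergence; hence <u_t(t), v> <= 0. By convexity, for s < t,
     int G(u(t)) - int G(u(s)) <= (u(t) - u(s), v) = int_s^t <u_t(r), v> dr,
   so that the backward difference quotients of psi(t) = int G(u(t)) have a
   nonpositive upper limit at almost every t, and are dominated from above by those
   of an absolutely continuous function plus an integrable one. A Fatou argument
   then shows that psi is nonincreasing. As psi(0) = 0 and psi >= 0, psi vanishes,
   that is |u(t)| <= M. This avoids the chain rule d/dt int G(u) = <u_t, g(u)>. *)
Require Import Defs.
From HB Require Import structures.
From mathcomp Require Import finmap all_boot all_order all_algebra.
From mathcomp Require Import all_classical all_reals all_analysis.
From mathcomp Require Import measurable_realfun ess_sup_inf ring lra.
Set Implicit Arguments. Unset Strict Implicit. Unset Printing Implicit Defensive.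
Import Order.TTheory GRing.Theory Num.Theory.
Import numFieldNormedType.Exports.
Local Open Scope classical_set_scope.
Local Open Scope ring_scope.

(** * Smooth functions of one variable and along directions *)

(** The test function v = g(u(t)) depends on t, so t cannot be taken to be a Lebesgue point of r ->
    <u_t(r), v>: the exceptional null set would vary with v. Strong measurability of u_t repairs
    this. Its simple approximations take countably many values y, and almost every t is a Lebesgue
    point of (a majorant of) every ||u_t - y||^2 at once. At such a t, with y close to u_t(t), the
    splitting <u_t(r), v> = <u_t(r) - y, v> + <y - u_t(t), v> + <u_t(t), v> leaves two small terms
    and a nonpositive one. The domination comes from Young's inequality <u_t(r), v> <= (||u_t(r)||^2
    + ||v||^2) / 2: the first term enters a primitive, and the second depends on t alone and is
    integrable because g' is bounded. The norms of u(t) and of u_t(t) - y are not known to be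
    measurable in t, so each squared norm is replaced by a measurable majorant, at most 4 times
    larger. Continuity of psi and its value at 0 rest on the representative of u in C([0, T];
    L^2). *)

Section directional.
Context {R : realType} {V : normedModType R}.
Implicit Types (g : V -> R) (x v : V).

Lemma derive_lineE g x v : 'D_v g x = 'D_1 (fun h : R => g (h *: v + x)) 0.
Proof.
rewrite /derive; set g1 := fun h => h^-1 *: _; set g2 := fun h => h^-1 *: _.
suff -> : g1 = g2 by [].
by rewrite funeqE /g1 /g2 => h /=; rewrite addr0 scale0r add0r [_%:A]mulr1.
Qed.

(** Only the derivative of [g] along [v] is assumed, not differentiability; restricting to the line
    through [x] directed by [v] reduces the claim to one variable. *)
Lemma is_derive_comp1 (h : R -> R) g x v :
  derivable h (g x) 1 -> derivable g x v ->
  is_derive x v (h \o g) (h^`()%classic (g x) * 'D_v g x).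
Proof.
move=> dh dg; pose p t := g (t *: v + x).
have p0 : p 0 = g x by rewrite /p scale0r add0r.
have dp : derivable p 0 1 := (derivable1P _ _ _).1 dg.
have dhp : derivable (h \o p) 0 1.
  apply/derivable1_diffP.
  apply: differentiable_comp; first exact: (derivable1_diffP p 0).1.
  by move: dh; rewrite -p0 => /derivable1_diffP.
have E : 'D_1 (h \o p) 0 = h^`()%classic (g x) * 'D_v g x.
  rewrite -derive1E derive1_comp ?p0; [|exact: dp|exact: dh].
  by rewrite derive_lineE -derive1E.
by apply: DeriveDef; [exact/derivable1P|rewrite derive_lineE].
Qed.

End directional.

Section Ck.
Context {R : realType} {V : normedModType R} {I : Type} (e : I -> V).
Implicit Types (g : V -> R) (x : V).

(** All derivatives along [e] of order at most n are continuous and derivable once more. Finite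
    orders are tracked because the product and chain rules are proved by induction on n. *)
Fixpoint Ck (n : nat) g : Prop :=
  [/\ continuous g, forall i x, derivable g x (e i)
    & if n is m.+1 then forall i, Ck m (fun x => 'D_(e i) g x) else True].

Definition Coo g := forall n, Ck n g.

Lemma CkS n g : Ck n.+1 g -> Ck n g.
Proof.
elim: n g => [g [? ? _]|n IH g [cg dg Dg]]; first by split.
by split => // i; apply: IH; exact: Dg.
Qed.

Lemma Ck_succ n g : Ck n.+1 g -> forall i, Ck n (fun x => 'D_(e i) g x).
Proof. by case. Qed.

Lemma Ck_continuous n g : Ck n g -> continuous g.
Proof. by case: n => [|n] []. Qed.

Lemma Ck_derivable n g : Ck n g -> forall i x, derivable g x (e i).
Proof. by case: n => [|n] []. Qed.

Lemma Coo_derive i g : Coo g -> Coo (fun x => 'D_(e i) g x).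
Proof. by move=> Cg n; have [_ _] := Cg n.+1; exact. Qed.

Lemma CooP g : Coo g <-> forall s : seq I,
  let h := foldr (fun i h x => 'D_(e i) h x) g s in
  continuous h /\ forall i x, derivable h x (e i).
Proof.
split.
  (* [Ck] peels off the derivative applied first, which is the last entry of the list. *)
  move=> Cg s; elim/last_ind: s g Cg => [g Cg|s i IH g Cg] /=.
    by have [] := Cg 0%N.
  by rewrite foldr_rcons; apply: IH; exact: Coo_derive.
move=> Hg n; elim: n g Hg => [|n IH] g Hg; have [cg dg] := Hg [::] => //.
split => // i; apply: IH => s.
by have := Hg (rcons s i); rewrite foldr_rcons.
Qed.

Lemma Ck_cst n (a : R) : Ck n (cst a).
Proof.
elim: n a => [|n IH] a; split => //; try by move=> ?; exact: cst_continuous.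
move=> i; rewrite (_ : (fun _ => _) = cst 0)//.
by apply/funext => x; rewrite derive_cst.
Qed.

Lemma CkD n g h : Ck n g -> Ck n h -> Ck n (g \+ h).
Proof.
elim: n g h => [|n IH] g h Cg Ch; have [cg dg _] := Cg; have [ch dh _] := Ch.
  by split; [move=> x; exact: cvgD (cg x) (ch x)|move=> i x; exact: derivableD|exact: Logic.I].
split; [by move=> x; exact: cvgD (cg x) (ch x)|by move=> i x; exact: derivableD|].
move=> i; rewrite (_ : (fun _ => _) =
  (fun x => 'D_(e i) g x) \+ (fun x => 'D_(e i) h x)).
  by apply: IH; exact: Ck_succ.
by apply/funext => x; rewrite deriveD.
Qed.

Lemma CkM n g h : Ck n g -> Ck n h -> Ck n (g \* h).
Proof.
elim: n g h => [|n IH] g h Cg Ch.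
  move: Cg Ch => [cg dg Dg] [ch dh Dh].
  by split; [move=> x; exact: cvgM (cg x) (ch x)|move=> i x; exact: derivableM|exact: Logic.I].
have [cg dg Dg] := Cg; have [ch dh Dh] := Ch.
split; [by move=> x; exact: cvgM (cg x) (ch x)|by move=> i x; exact: derivableM|].
move=> i; rewrite (_ : (fun _ => _) =
  (g \* (fun x => 'D_(e i) h x)) \+ (h \* (fun x => 'D_(e i) g x))).
  by apply: CkD; apply: IH; [exact: CkS|exact: Ck_succ|exact: CkS|exact: Ck_succ].
by apply/funext => x; rewrite deriveM.
Qed.

Lemma CkZ n (a : R) g : Ck n g -> Ck n (fun x => a * g x).
Proof. exact: CkM (Ck_cst n a). Qed.

Lemma CkN n g : Ck n g -> Ck n (\- g).
Proof.
move=> /(CkZ (-1)); rewrite (_ : (fun _ => _) = \- g)//.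
by apply/funext => x; rewrite mulN1r.
Qed.

Lemma Ck_prod n (J : Type) (s : seq J) (F : J -> V -> R) :
  (forall j, Ck n (F j)) -> Ck n (fun x => \prod_(j <- s) F j x).
Proof.
move=> CF; elim: s => [|j s IH].
  rewrite (_ : (fun _ => _) = cst 1); first exact: Ck_cst.
  by apply/funext => x; rewrite big_nil.
rewrite (_ : (fun _ => _) = F j \* (fun x => \prod_(j <- s) F j x)).
  exact: CkM.
by apply/funext => x; rewrite big_cons.
Qed.

End Ck.

Section Ck_R.
Context {R : realType}.
Implicit Types (f g : R -> R).

Definition Coo1 f := Coo (fun _ : unit => 1 : R^o) f.

Lemma derivable_continuous f : (forall x, derivable f x 1) -> continuous f.
Proof. by move=> df x; exact/differentiable_continuous/derivable1_diffP. Qed.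

Lemma Coo1_derive f : Coo1 f -> Coo1 f^`()%classic.
Proof.
move=> /(Coo_derive tt); rewrite (_ : (fun _ => _) = f^`()%classic); first exact.
by apply/funext => x; rewrite derive1E.
Qed.

Lemma Coo1_derivable f (x : R) : Coo1 f -> derivable f x 1.
Proof. by move=> Cf; have /(_ tt x) := Ck_derivable (Cf 0%N). Qed.

Lemma Coo1_continuous f : Coo1 f -> continuous f.
Proof. by move=> Cf; have := Ck_continuous (Cf 0%N). Qed.

Lemma Coo1_derive1n f : Coo1 f -> forall n x, derivable f^`(n)%classic x 1.
Proof.
move=> Cf n; elim: n f Cf => [|n IH] f Cf x; first exact: Coo1_derivable.
by rewrite derive1Sn; apply: IH; exact: Coo1_derive.
Qed.

(** A coinduction principle: a class of derivable functions that is stable under differentiation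
    contains only smooth functions. *)
Lemma Coo1_class (P : (R -> R) -> Prop) :
  (forall f, P f -> (forall x, derivable f x 1) /\ P f^`()%classic) ->
  forall f, P f -> Coo1 f.
Proof.
move=> HP f Pf n; elim: n f Pf => [|n IH] f /HP[df Pf'].
  by split => //; exact: derivable_continuous.
split => //; first exact: derivable_continuous.
move=> i; rewrite (_ : (fun _ => _) = f^`()%classic); first exact: IH.
by apply/funext => x; rewrite derive1E.
Qed.

Lemma Coo1_primitive f (F : R -> R) : Coo1 f ->
  (forall x : R, is_derive x 1 F (f x)) -> Coo1 F.
Proof.
move=> Cf dF n.
have H : forall x : R, derivable F x 1 by move=> x; have [] := dF x.
case: n => [|n]; split => //; try exact: derivable_continuous.
move=> i; rewrite (_ : (fun _ => _) = f)//.
by apply/funext => x; have [] := dF x.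
Qed.

Lemma Coo1_affine (a b : R) : Coo1 (fun x => a * x + b).
Proof.
apply: (@Coo1_primitive (cst a)) => [n|x]; first exact: Ck_cst.
rewrite (_ : (fun _ => _) = (a \*: (@idfun R)) \+ cst b)//.
apply: is_derive_eq; by rewrite addr0 [LHS]mulr1.
Qed.

Lemma Ck_comp {V : normedModType R} {I : Type} (e : I -> V) n h (g : V -> R) :
  Coo1 h -> Ck e n g -> Ck e n (h \o g).
Proof.
elim: n h g => [|n IH] h g Ch Cg; have [cg dg Dg] := Cg.
  split; last exact: Logic.I.
  - by move=> x; apply: continuous_comp; [exact: cg|exact: Coo1_continuous].
  - move=> i x.
    by have [] := is_derive_comp1 (Coo1_derivable Ch) (dg i x).
split.
- by move=> x; apply: continuous_comp; [exact: cg|exact: Coo1_continuous].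
- move=> i x.
  by have [] := is_derive_comp1 (Coo1_derivable Ch) (dg i x).
- move=> i; rewrite (_ : (fun _ => _) =
    (h^`()%classic \o g) \* (fun x => 'D_(e i) g x)).
    by apply: CkM; [apply: IH; [exact: Coo1_derive|exact: CkS]|exact: Ck_succ].
  apply/funext => x.
  by have [_ ->] := is_derive_comp1 (Coo1_derivable Ch) (dg i x).
Qed.

End Ck_R.

(* [flat c Q] is [Q(1/x) exp(-c/x)] on the positive half line; this class is
   closed under differentiation. *)
Section flat.
Context {R : realType}.
Implicit Types (c x : R) (Q : {poly R}).

Definition flat c Q x : R := if 0 < x then Q.[x^-1] * expR (- (c / x)) else 0.

(** Each factor y of the polynomial is paid for by half of the exponential, through e^z >= 1 + z;
    the other half is left to the induction hypothesis. *)
Lemma poly_expR_bounded c Q : 0 < c ->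
  exists2 C, 0 < C & forall y, 0 <= y -> `|Q.[y]| * expR (- (c * y)) <= C.
Proof.
move: c; elim/poly_ind: Q => [|Q a IH] c c0.
  by exists 1 => // y y0; rewrite horner0 normr0 mul0r.
have c20 : 0 < c / 2 by rewrite divr_gt0.
have [C C0 HC] := IH _ c20.
exists (C * (2 / c) + `|a|).
  by rewrite ltr_pwDl// mulr_gt0// divr_gt0.
move=> y y0; rewrite hornerMXaddC.
apply: (@le_trans _ _ ((`|Q.[y]| * y + `|a|) * expR (- (c * y)))).
  rewrite ler_wpM2r ?expR_ge0//.
  by rewrite (le_trans (ler_normD _ _))// normrM (ger0_norm y0).
rewrite mulrDl lerD//; last first.
  by rewrite ler_piMr// expR_le1 oppr_le0 mulr_ge0// ltW.
rewrite (_ : - (c * y) = - (c / 2 * y) + - (c / 2 * y)); last by field.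
rewrite expRD mulrACA ler_pM ?HC ?mulr_ge0 ?expR_ge0//.
rewrite expRN ler_pdivrMr ?expR_gt0//.
apply: (@le_trans _ _ (2 / c * (1 + c / 2 * y))).
  rewrite mulrDr mulr1 [X in _ + X](_ : _ = y); last by field; rewrite gt_eqF.
  by rewrite lerDr divr_ge0// ltW.
by rewrite ler_wpM2l ?expR_ge1Dx// divr_ge0// ltW.
Qed.

Lemma flat_bounded c Q : 0 < c ->
  exists2 C, 0 < C & forall x, `|flat c Q x| <= C.
Proof.
move=> c0; have [C C0 HC] := poly_expR_bounded Q c0.
exists C => // x; rewrite /flat; case: ifPn => x0; last by rewrite normr0 ltW.
by rewrite normrM (ger0_norm (expR_ge0 _)) HC// invr_ge0 ltW.
Qed.

Lemma flat0 c Q x : x <= 0 -> flat c Q x = 0.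
Proof. by rewrite /flat ltNge => ->. Qed.

Lemma is_derive_flat c Q x : 0 < c ->
  is_derive x 1 (flat c Q) (flat c ('X^2 * (c *: Q - Q^`())) x).
Proof.
move=> c0; have [x0|x0|->] := ltgtP x 0.
- rewrite flat0 ?ltW//.
  apply: (@near_eq_is_derive _ R^o R^o (cst 0)).
  have := lt_nbhsl x0; apply: filterS => y y0.
  by rewrite flat0// ltW.
- apply: (@near_eq_is_derive _ R^o R^o
    (fun y : R => Q.[y^-1] * expR (- (c / y)))).
    have := lt_nbhsr x0; apply: filterS => y y0.
    by rewrite /flat y0.
  have xn0 : x != 0 by rewrite gt_eqF.
  have dV : is_derive x 1 (@GRing.inv R) (- x ^- 2).
    split; first exact: derivableV.
    rewrite deriveV// derive_id.
    by rewrite [LHS]mulr1.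
  have dQ : is_derive x 1 (fun y : R => Q.[y^-1]) (Q^`().[x^-1] * (- x ^- 2)).
    have := @is_derive1_comp _ (horner Q) (@GRing.inv R) x _ _ _ dV.
    by apply.
  have dE : is_derive x 1 (fun y : R => expR (- (c / y)))
      (expR (- (c / x)) * (c * x ^- 2)).
    have d1 : is_derive x 1 (fun y : R => - (c / y)) (c * x ^- 2).
      rewrite (_ : (fun _ => _) = (- c) \*: (@GRing.inv R)).
        by apply: is_derive_eq; rewrite /= scaleNr scalerN opprK.
      by apply/funext => y /=; rewrite -mulNr.
    have := @is_derive1_comp _ (@expR R) (fun y : R => - (c / y)) x _ _ _ d1.
    by apply.
  rewrite (_ : (fun _ => _) = (fun y => Q.[y^-1]) * (fun y : R => expR (- (c / y))))//.
  apply: is_derive_eq => /=.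
  rewrite /flat x0 !hornerE /=.
  rewrite -exprVn -[_ *: (_ * _)]/(_ * _) -[_ *: (_ * _)]/(_ * _).
  by ring.
- rewrite flat0//.
  (* Boundedness for the polynomial ['X^2 * Q] says that [flat c Q h] is at most C h^2, so the
     derivative at 0 is 0. *)
  have [C C0 HC] := flat_bounded ('X^2 * Q) c0.
  have HF h : `|flat c Q h| <= C * h ^+ 2.
    have [h0|h0] := ltP 0 h; last by rewrite flat0// normr0 mulr_ge0 ?sqr_ge0// ltW.
    rewrite -ler_pdivrMr ?exprn_gt0//.
    suff -> : `|flat c Q h| / h ^+ 2 = `|flat c ('X^2 * Q) h| by [].
    rewrite /flat h0 hornerM hornerXn -mulrA [RHS]normrM mulrC; congr (_ * _).
    by rewrite ger0_norm ?exprn_ge0 ?invr_ge0 ?ltW// exprVn.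
  have cv : h^-1 *: (flat c Q (h + 0) - flat c Q 0) @[h --> 0^'] --> (0 : R).
    apply/cvgrPdist_le => eps eps0; near=> h.
    rewrite sub0r normrN addr0 (flat0 _ _ (lexx 0)) subr0 normrZ.
    apply: (@le_trans _ _ (C * `|h|)).
      have h0 : h != 0 by near: h; exact: nbhs_dnbhs_neq.
      rewrite normfV mulrC ler_pdivrMr ?normr_gt0// -mulrA -expr2 real_normK//.
      exact: num_real.
    rewrite -ler_pdivlMl// mulrC.
    near: h; apply: dnbhs0_le; exact: divr_gt0.
  apply: DeriveDef.
    apply/cvg_ex; exists 0.
    rewrite (_ : (fun _ => _) = (fun h => h^-1 *: (flat c Q (h + 0) - flat c Q 0)))//.
    by apply/funext => h; rewrite [_%:A]mulr1.
  apply/cvg_lim => //.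
  rewrite (_ : (fun _ => _) = (fun h => h^-1 *: (flat c Q (h + 0) - flat c Q 0)))//.
  by apply/funext => h; rewrite [_%:A]mulr1.
Unshelve. all: by end_near. Qed.

Lemma Coo1_flat c Q : 0 < c -> Coo1 (flat c Q).
Proof.
move=> c0; apply: (@Coo1_class _ (fun f => exists Q, f = flat c Q)); last by exists Q.
move=> _ [P ->]; split.
  by move=> x; have [] := is_derive_flat P x c0.
exists ('X^2 * (c *: P - P^`())); apply/funext => x.
by rewrite derive1E; have [] := is_derive_flat P x c0.
Qed.

End flat.

(* The convex [cost] vanishes exactly on [-M, M]. It is smooth, unlike
   [(|s| - M)^+ ^ 2], so that compositions with test functions are test functions. *)
Section cost.
Context {R : realType} (M : R).
Implicit Types (s a b : R).

(** The derivative of [cost], since x exp(-1/x) has derivative (1 + 1/x) exp(-1/x). The factor x in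
    front of the exponential makes [cost] grow linearly, which is why [excess] is bounded. *)
Definition excess s : R :=
  flat 1 (1 + 'X) (s - M) - flat 1 (1 + 'X) (- s - M).

Definition cost s : R :=
  (s - M) * flat 1 1 (s - M) + (- s - M) * flat 1 1 (- s - M).

Lemma is_derive_Mflat s : is_derive s 1 (fun x => x * flat 1 1 x)
  (flat 1 (1 + 'X) s).
Proof.
have d1 := is_derive_flat 1 s (@ltr01 R).
rewrite (_ : (fun _ => _) = (@idfun R) * (flat 1 1))//.
apply: is_derive_eq; rewrite /flat; case: ifPn => [s0|_]; last first.
  by rewrite -[_ *: _]/(_ * _) -[X in _ + X]/(_ * _) mulr0 mul0r addr0.
rewrite -[_ *: _]/(_ * _) -[X in _ + X]/(_ * _) !hornerE /=.
rewrite -polyC1 derivC hornerC.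
by field; rewrite gt_eqF.
Qed.

Lemma is_derive_affine (k c s : R) : is_derive s 1 (fun x : R => k * x + c) k.
Proof.
rewrite (_ : (fun _ => _) = (k \*: (@idfun R)) \+ cst c)//.
by apply: is_derive_eq; rewrite addr0 [LHS]mulr1.
Qed.

Lemma is_derive_affine_comp (f : R -> R) (k c s df : R) :
  is_derive (k * s + c) 1 f df -> is_derive s 1 (fun x => f (k * x + c)) (k * df).
Proof.
move=> d1.
have := @is_derive1_comp _ f (fun x : R => k * x + c) s _ _ d1 (is_derive_affine k c s).
by rewrite mulrC.
Qed.

Lemma costE : cost = (fun x => (fun y => y * flat 1 1 y) (1 * x + - M)) +
  (fun x => (fun y => y * flat 1 1 y) (-1 * x + - M)).
Proof. by apply/funext => s; rewrite /cost fctE !mul1r !mulN1r. Qed.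

Lemma excessE : excess = (fun x => flat 1 (1 + 'X) (1 * x + - M)) -
  (fun x => flat 1 (1 + 'X) (-1 * x + - M)).
Proof. by apply/funext => s; rewrite /excess !fctE !mul1r !mulN1r. Qed.

Lemma is_derive_cost s : is_derive s 1 cost (excess s).
Proof.
rewrite costE.
have d1 := is_derive_affine_comp (is_derive_Mflat (1 * s + - M)).
have d2 := is_derive_affine_comp (is_derive_Mflat (-1 * s + - M)).
apply: is_derive_eq.
by rewrite /excess !mul1r !mulN1r.
Qed.

Definition dexcess s : R := let Q := 'X^2 * (1 *: (1 + 'X) - (1 + 'X)^`()) in
  flat 1 Q (s - M) + flat 1 Q (- s - M).

Lemma is_derive_excess s : is_derive s 1 excess (dexcess s).
Proof.
rewrite excessE.
have d1 := is_derive_affine_comp (is_derive_flat (1 + 'X) (1 * s + - M) (@ltr01 R)).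
have d2 := is_derive_affine_comp (is_derive_flat (1 + 'X) (-1 * s + - M) (@ltr01 R)).
apply: is_derive_eq.
by rewrite !mulN1r !mul1r opprK.
Qed.

(** The derivative of 1 + X cancels the constant term, so the polynomial is X^3, which is
    nonnegative at 1/x for x > 0. *)
Lemma dexcess_ge0 s : 0 <= dexcess s.
Proof.
rewrite /dexcess; set Q := 'X^2 * _.
have HQ x : 0 <= flat 1 Q x.
  rewrite /flat; case: ifPn => // x0; rewrite mulr_ge0 ?expR_ge0// /Q.
  rewrite -polyC1 derivD derivC derivX hornerM hornerXn hornerD hornerN hornerZ.
  rewrite !hornerD !hornerC !hornerX mul1r add0r addrC addKr.
  by rewrite mulr_ge0 ?sqr_ge0// invr_ge0 ltW.
by rewrite addr_ge0.
Qed.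

Lemma dexcess_bounded : exists2 C, 0 < C & forall s, `|dexcess s| <= C.
Proof.
rewrite /dexcess; set Q := 'X^2 * _.
have [C C0 HC] := flat_bounded Q (@ltr01 R).
by exists (C + C) => [|s]; rewrite ?addr_gt0// (le_trans (ler_normD _ _))// lerD.
Qed.

Lemma excess_bounded : exists2 C, 0 < C & forall s, `|excess s| <= C.
Proof.
have [C C0 HC] := @flat_bounded R 1 (1 + 'X) ltr01.
by exists (C + C) => [|s]; rewrite ?addr_gt0// (le_trans (ler_normB _ _))// lerD.
Qed.

Lemma Coo1_excess : Coo1 excess.
Proof.
have H k : Coo1 (fun x : R => flat 1 (1 + 'X) (k * x + - M)).
  by move=> n; exact: Ck_comp (Coo1_flat _ ltr01) (Coo1_affine k (- M) n).
rewrite excessE => n; apply: CkD; first exact: H.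
exact/CkN/H.
Qed.

Lemma excess_derive1 : excess^`()%classic = dexcess.
Proof.
by apply/funext => s; rewrite derive1E; have [_ ->] := is_derive_excess s.
Qed.

Lemma continuous_dexcess : continuous dexcess.
Proof.
by rewrite -excess_derive1; exact/Coo1_continuous/Coo1_derive/Coo1_excess.
Qed.

Lemma continuous_cost : continuous cost.
Proof.
by apply: derivable_continuous => s; have [] := is_derive_cost s.
Qed.

Lemma cost_MVT a b : a <= b ->
  exists2 c, c \in `[a, b] & cost b - cost a = excess c * (b - a).
Proof.
move=> ab; apply: MVT_segment => //; first by move=> ? _; exact: is_derive_cost.
exact/continuous_subspaceT/continuous_cost.
Qed.

Lemma excess_nd : {homo excess : a b / a <= b}.
Proof.
move=> a b ab; rewrite -subr_ge0.
have [] := @MVT_segment _ excess dexcess a b ab.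
- by move=> ? _; exact: is_derive_excess.
- exact/continuous_subspaceT/Coo1_continuous/Coo1_excess.
- by move=> c _ ->; rewrite mulr_ge0 ?dexcess_ge0// subr_ge0.
Qed.

Lemma cost_convex a b : cost b - cost a <= excess b * (b - a).
Proof.
have [ab|/ltW ba] := leP a b.
  have [c + ->] := cost_MVT ab; rewrite in_itv/= => /andP[_ cb].
  by rewrite ler_wpM2r ?subr_ge0// excess_nd.
have [c + E] := cost_MVT ba; rewrite in_itv/= => /andP[bc _].
rewrite -lerN2 opprB E -mulrN opprB ler_wpM2r ?subr_ge0//.
exact: excess_nd.
Qed.

Lemma cost_lipschitz : exists2 C, 0 < C &
  forall a b, `|cost a - cost b| <= C * `|a - b|.
Proof.
have [C C0 HC] := excess_bounded; exists C => // a b.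
wlog ba : a b / b <= a.
  move=> H; have [ba|/ltW ab] := leP b a; first exact: H.
  by rewrite distrC (distrC a); exact: H.
have [c _ ->] := cost_MVT ba.
by rewrite normrM ler_wpM2r.
Qed.

Lemma Mflat_ge0 s : 0 <= s * flat 1 1 s.
Proof.
have [x0|x0] := leP s 0; first by rewrite flat0// mulr0.
by rewrite mulr_ge0 ?(ltW x0)// /flat x0 mulr_ge0 ?expR_ge0// hornerE.
Qed.

Lemma cost_ge0 s : 0 <= cost s.
Proof.
by rewrite addr_ge0 ?Mflat_ge0.
Qed.

Lemma cost0 s : `|s| <= M -> cost s = 0.
Proof.
rewrite ler_norml => /andP[sM Ms].
rewrite /cost !flat0 ?mulr0 ?addr0 ?subr_le0//.
by rewrite lerNl.
Qed.

Lemma excess0 s : `|s| <= M -> excess s = 0.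
Proof.
rewrite ler_norml => /andP[sM Ms].
rewrite /excess !flat0 ?subrr ?subr_le0//.
by rewrite lerNl.
Qed.

Lemma cost_eq0 s : cost s = 0 -> `|s| <= M.
Proof.
have H0 (x : R) : x * flat 1 1 x = 0 -> x <= 0.
  apply: contra_eqT; rewrite -ltNge => x0.
  rewrite gt_eqF// mulr_gt0// /flat x0.
  by rewrite hornerE mul1r expR_gt0.
move=> /eqP; rewrite paddr_eq0 ?Mflat_ge0// => /andP[/eqP/H0 h1 /eqP/H0 h2].
by rewrite ler_norml; apply/andP; split; lra.
Qed.

End cost.

(** * Borel sets and continuous functions on R^d *)

Section measure_rV.
Context {R : realType} {d : nat}.
Local Notation E := 'rV[R]_d.
Local Notation leb := (lebesgue_rV d : {measure set E -> \bar R}).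

Definition rbox (a b : E) : set E := [set x | forall i, x 0 i \in `]a 0 i, b 0 i[].

Lemma rV_prodset_measurable (A : 'I_d -> set (measurableTypeR R)) :
  (forall i, measurable (A i)) ->
  measurable [set x : E | forall i, A i (x 0 i)].
Proof.
move=> mA; rewrite [X in measurable X](_ : _ =
  \big[setI/setT]_(i < d) (rV_coord i @^-1` A i)).
  apply: bigsetI_measurable => i _.
  by rewrite -[X in measurable X]setTI; exact: measurable_rV_coord.
apply/seteqP; split => x; rewrite -bigcap_seq/= => H i.
  by move=> _; exact: H.
by have := H i (mem_index_enum i).
Qed.

Lemma rbox_measurable (a b : E) : measurable (rbox a b).
Proof.
by apply: (rV_prodset_measurable (A := fun i => `]a 0 i, b 0 i[%classic)) => i.
Qed.

Lemma rV_ball_nearP (P : E -> Prop) (x : E) :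
  (\forall y \near x, P y) <->
  exists2 r : R, 0 < r & forall y : E, (forall i, `|x 0 i - y 0 i| < r) -> P y.
Proof.
split=> [/nbhs_ballP[r /= r0 H]|[r r0 H]].
  exists r => // y xy; apply: H; split => // i j.
  by rewrite ord1; exact: xy.
apply/nbhs_ballP; exists r => //= y [_ xy]; apply: H => i.
exact: xy.
Qed.

Definition qbox (p : 'rV[rat]_d * nat) : set E :=
  rbox (\row_i (ratr (p.1 0 i) - p.2.+1%:R^-1)) (\row_i (ratr (p.1 0 i) + p.2.+1%:R^-1)).

(** The closed box is kept inside [O] as well, because it contains the support of the bump functions
    used in the fundamental lemma. *)
Lemma open_qbox (O : set E) (x : E) (e : R) : 0 < e ->
  (forall y : E, (forall i, `|x 0 i - y 0 i| < e) -> O y) ->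
  exists p, qbox p x /\ forall y : E, (forall i, y 0 i \in
    `[ratr (p.1 0 i) - p.2.+1%:R^-1, ratr (p.1 0 i) + p.2.+1%:R^-1]) -> O y.
Proof.
move=> e0 H.
have [n _ Hn] := (near_infty_natSinv_lt (PosNum (divr_gt0 e0 (@ltr0Sn R 1)))).
have {Hn} hn : n.+1%:R^-1 < e / 2 by exact: Hn (leqnn n).
have n0 : 0 < n.+1%:R^-1 :> R by rewrite invr_gt0.
have /choice[q Hq] : forall i : 'I_d, exists q : rat,
    ratr q \in `](x 0 i - n.+1%:R^-1), (x 0 i + n.+1%:R^-1)[.
  by move=> i; apply: rat_in_itvoo; rewrite ltrD2l (lt_trans _ n0)// oppr_lt0.
exists (\row_i q i, n); split=> /=.
  move=> i; have := Hq i; rewrite !mxE !in_itv/= => /andP[h1 h2].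
  by rewrite ltrBlDr h2/= -ltrBlDr.
move=> y Hy; apply: H => i; have := Hq i; have := Hy i.
rewrite !mxE !in_itv/= => /andP[h1 h2] /andP[h3 h4].
move: hn h1 h2 h3 h4; move: (n.+1%:R^-1 : R) => c *.
by rewrite ltr_norml; apply/andP; split; lra.
Qed.

(** The sigma-algebra is generated by the coordinates; an open set belongs to it as the union of the
    countably many rational boxes that it contains. *)
Lemma open_measurable_rV (O : set E) : open O -> measurable O.
Proof.
move=> oO.
pose F (k : nat) : set E := if unpickle k is Some p then
  (if `[<qbox p `<=` O>] then qbox p else set0) else set0.
have -> : O = \bigcup_k F k.
  apply/seteqP; split => [x Ox|x [k _]]; last first.
    by rewrite /F; case: unpickle => // p; case: asboolP => // pO /pO.
  have /rV_ball_nearP[e e0 He] : \forall y \near x, O y by exact: open_nbhs_nbhs.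
  have [p [px pO]] := open_qbox e0 He.
  exists (pickle p) => //; rewrite /F pickleK; case: asboolP => // -[].
  move=> y yp; apply: pO => i; have := yp i; rewrite !mxE.
  exact: subset_itv_oo_cc.
apply: bigcupT_measurable => k; rewrite /F; case: unpickle => // p.
by case: asboolP => // _; exact: rbox_measurable.
Qed.

Lemma continuous_measurable_rV (f : E -> R) :
  continuous f -> measurable_fun setT f.
Proof.
move=> /continuousP cf; apply: (measurability _ (measurable_realfun.RGenOpens.measurableE R)).
move=> _ [_ [a [b ->] <-]]; rewrite setTI; apply: open_measurable_rV.
exact/cf/interval_open.
Qed.

Definition cube (K : R) : set E := [set x | forall i, x 0 i \in `[-K, K]].

Lemma cube_measurable K : measurable (cube K).
Proof.
exact: (rV_prodset_measurable (A := fun i => `[-K, K]%classic)).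
Qed.

Lemma cube_lty K : (leb (cube K) < +oo)%E.
Proof.
have -> : leb (cube K) = (\prod_(i < d) lebesgue_measure [set` `[-K, K]%R])%E.
  exact: (@lebesgue_rV_box _ _ (fun i => [set` `[-K, K]%R])).
have [r r0 ->] : exists2 r : R, 0 <= r & lebesgue_measure [set` `[-K, K]%R] = r%:E.
  rewrite lebesgue_measure_itv/=; case: ifPn => [|_]; last by exists 0.
  by rewrite lte_fin => KK; exists (K - - K) => //; rewrite subr_ge0 ltW.
by rewrite prodEFin ltry.
Qed.

Lemma cube_compact K : compact (cube K).
Proof.
apply: (rV_compact (A := fun i => `[-K, K]%classic)) => i.
exact: segment_compact.
Qed.

Lemma bounded_sub_cube (O : set E) : bounded_set O -> exists2 K, 0 < K & O `<=` cube K.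
Proof.
move=> [K [_ /(_ (`|K| + 1)) HK]]; exists (`|K| + 1); first by rewrite ltr_pwDr.
move=> x Ox i; have := HK _ x Ox => /(_ _)/= H.
rewrite in_itv/= -ler_norml.
apply: (le_trans _ (H _)); last by rewrite (le_lt_trans (ler_norm _))// ltrDl.
by rewrite [leRHS]mx_normrE; exact: (le_bigmax _ (fun ij => `|x ij.1 ij.2|) (0, i)).
Qed.

Lemma bounded_lty (O : set E) : measurable O -> bounded_set O -> (leb O < +oo)%E.
Proof.
move=> mO /bounded_sub_cube[K _ OK]; apply: le_lt_trans (cube_lty K).
by apply: le_measure => //; rewrite inE//; exact: cube_measurable.
Qed.

End measure_rV.

(** * Integrals of partial derivatives of compactly supported functions *)

Section divergence.
Context {R : realType}.

Lemma derive_near0 {V : normedModType R} (f : V -> R) x v :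
  (\near x, f x = 0) -> 'D_v f x = 0.
Proof.
move=> f0; rewrite -[RHS](derive_cst (0 : R^o) x v).
by apply: near_eq_derive; exact: f0.
Qed.

Lemma notin_cube_near {d} (K : R) (x : 'rV[R]_d) :
  ~ cube K x -> \forall y \near x, ~ cube K y.
Proof.
move=> /existsNP[i /negP]; rewrite in_itv/= -ler_norml -ltNge => xi.
apply/rV_ball_nearP; exists (`|x 0 i| - K); first by rewrite subr_gt0.
move=> y /(_ i) xy /(_ i); rewrite in_itv/= -ler_norml leNgt => /negP; apply.
have := ler_normD (x 0 i - y 0 i) (y 0 i); rewrite subrK.
by move: (`|x 0 i|) (`|y 0 i|) (`|x 0 i - y 0 i|) xy => *; lra.
Qed.

(** Regularity is asked in the direction i only, a condition inherited by slices when one coordinate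
    is frozen in the induction on the dimension. *)
Definition C1c {d} (i : 'I_d) (f : 'rV[R]_d -> R) :=
  [/\ continuous f, continuous (partial i f),
      forall x, derivable f x (delta_mx 0 i)
    & exists2 K, 0 < K & forall x, ~ cube K x -> f x = 0].

Lemma C1c_partial0 {d} (i : 'I_d) (f : 'rV[R]_d -> R) K :
  (forall x, ~ cube K x -> f x = 0) -> forall x, ~ cube K x -> partial i f x = 0.
Proof.
move=> f0 x xK; apply: derive_near0.
by have := notin_cube_near xK; apply: filterS => y /f0.
Qed.

Lemma continuous_cube_bounded {d} (g : 'rV[R]_d -> R) K : continuous g ->
  exists2 C, 0 < C & forall x, cube K x -> `|g x| <= C.
Proof.
move=> cg.
have : compact (g @` cube K).
  by apply: continuous_compact; [exact: continuous_subspaceT|exact: cube_compact].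
move=> /compact_bounded[C [_ /(_ (`|C| + 1))]] H.
exists (`|C| + 1); first by rewrite ltr_pwDr.
move=> x xK; apply: H; last by exists x.
by rewrite (le_lt_trans (ler_norm _))// ltrDl.
Qed.

Lemma integrable_cube_supp {d} (g : 'rV[R]_d -> R) K : continuous g ->
  (forall x, ~ cube K x -> g x = 0) ->
  (lebesgue_rV d : {measure set _ -> \bar R}).-integrable setT (EFin \o g).
Proof.
move=> cg g0; have [C C0 HC] := continuous_cube_bounded K cg.
have -> : (EFin \o g) = (EFin \o g) \_ (cube K).
  apply/funext => x; rewrite patchE; case: ifPn => // /negP xK /=.
  by rewrite g0// => xK'; apply: xK; rewrite inE.
apply/(integrable_mkcond _ (cube_measurable K)).
apply: measurable_bounded_integrable.
- exact: cube_measurable.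
- exact: cube_lty.
- by apply: measurable_funS (continuous_measurable_rV cg) => //; exact: measurableT.
- exists C; split; first exact: num_real.
  by move=> y Cy x xK /=; rewrite (le_trans (HC x xK))// ltW.
Qed.

Lemma rV_cons0 {d} (p : R * 'rV[R]_d) : rV_cons p 0 ord0 = p.1.
Proof. by rewrite mxE unlift_none. Qed.

Lemma rV_consS {d} (p : R * 'rV[R]_d) i : rV_cons p 0 (lift ord0 i) = p.2 0 i.
Proof. by rewrite mxE liftK. Qed.

Lemma rV_cons_shift0 {d} (x h : R) (y : 'rV[R]_d) :
  rV_cons (h + x, y) = h *: delta_mx 0 ord0 + rV_cons (x, y).
Proof.
apply/rowP => j; rewrite mxE [in RHS]mxE [in RHS]mxE [in RHS]mxE [X in _ = _ + X]mxE.
case: (unliftP ord0 j) => [k ->|->].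
  by rewrite /= mulr0 add0r.
by rewrite /= mulr1.
Qed.

Lemma rV_cons_shift {d} (x h : R) (y : 'rV[R]_d) i :
  rV_cons (x, h *: delta_mx 0 i + y) =
  h *: delta_mx 0 (lift ord0 i) + rV_cons (x, y).
Proof.
apply/rowP => j; rewrite [in RHS]mxE [in RHS]mxE [X in _ = _ * X + _]mxE.
case: (unliftP ord0 j) => [k ->|->].
  by rewrite !rV_consS !mxE /= (inj_eq (@lift_inj _ _)).
by rewrite !rV_cons0 /= mulr0 add0r.
Qed.

Lemma continuous_rV_cons2 {d} (x : R) (y : 'rV[R]_d) :
  {for y, continuous (fun y : 'rV[R]_d => rV_cons (x, y))}.
Proof.
move=> A /nbhs_ballP[e e0 eA]; apply: (iffRL (rV_ball_nearP _ _)); exists e => //.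
move=> z yz; apply: eA; split => // i j; rewrite ord1.
case: (unliftP ord0 j) => [k ->|->]; first by rewrite !rV_consS; exact: yz.
by rewrite !rV_cons0; exact: ballxx.
Qed.

Lemma continuous_rV_cons1 {d} (y : 'rV[R]_d) (x : R) :
  {for x, continuous (fun x : R => rV_cons (x, y))}.
Proof.
move=> A /nbhs_ballP[e e0 eA]; apply/nbhs_ballP; exists e => //.
move=> z xz; apply: eA; split => // i j; rewrite ord1.
case: (unliftP ord0 j) => [k ->|->]; first by rewrite !rV_consS; exact: ballxx.
by rewrite !rV_cons0.
Qed.

Lemma cube_rV_cons {d} (x : R) (y : 'rV[R]_d) K :
  cube K (rV_cons (x, y)) <-> x \in `[-K, K] /\ cube K y.
Proof.
split=> [H|[xK yK] i].
  split; first by have := H ord0; rewrite rV_cons0.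
  by move=> i; have := H (lift ord0 i); rewrite rV_consS.
by case: (unliftP ord0 i) => [k ->|->]; rewrite ?rV_cons0 ?rV_consS.
Qed.

Lemma partial_rV_cons {d} (f : 'rV[R]_d.+1 -> R) x y i :
  partial (lift ord0 i) f (rV_cons (x, y)) =
  partial i (fun z => f (rV_cons (x, z))) y.
Proof.
rewrite /partial [RHS]derive_lineE derive_lineE; congr (@derive _ R^o R^o _ 0 1).
by apply/funext => h; rewrite rV_cons_shift.
Qed.

Lemma C1c_rV_cons {d} (f : 'rV[R]_d.+1 -> R) x i :
  C1c (lift ord0 i) f -> C1c i (fun z => f (rV_cons (x, z))).
Proof.
move=> [cf cDf df [K K0 f0]]; split.
- by move=> y; apply: (continuous_comp (continuous_rV_cons2 (y := y))); exact: cf.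
- rewrite (_ : partial _ _ = fun y => partial (lift ord0 i) f (rV_cons (x, y))).
    by move=> y; apply: (continuous_comp (continuous_rV_cons2 (y := y))); exact: cDf.
  by apply/funext => y; rewrite partial_rV_cons.
- move=> y; apply/derivable1P.
  have /derivable1P := df (rV_cons (x, y)).
  by under eq_fun do rewrite -rV_cons_shift.
- by exists K => // y yK; apply: f0 => /cube_rV_cons[].
Qed.

Lemma integral_derive_compact (p : R -> R) K : 0 < K ->
  (forall x, derivable p x 1) -> continuous p^`()%classic ->
  (forall x, x \notin `[-K, K] -> p x = 0) ->
  (\int[lebesgue_measure]_x (p^`()%classic x)%:E = 0)%E.
Proof.
(* [p] is known to vanish only off [-K, K], so the endpoints of integration are moved outside that
   interval. *)
move=> K0 dp cp p0; pose L := K + 1.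
have KL : K < L by rewrite ltrDl.
have p'0 x : x \notin `[-L, L] -> p^`()%classic x = 0.
  move=> xL; rewrite derive1E; apply: derive_near0.
  have xL' : L < `|x| by move: xL; rewrite in_itv/= -ler_norml -ltNge.
  apply/nbhs_ballP; exists (`|x| - K); first by rewrite /= subr_gt0 (lt_trans KL).
  move=> z xz; apply: p0; rewrite in_itv/= -ler_norml -ltNge.
  have := ler_normD (x - z) z; rewrite subrK.
  by move: xz; rewrite /ball/=; move: (`|x|) (`|z|) (`|x - z|) => *; lra.
rewrite (_ : (fun _ => _) = (EFin \o p^`()%classic) \_ `[-L, L]); last first.
  apply/funext => x; rewrite patchE; case: ifPn => // /negP xL /=; rewrite p'0//.
  by apply/negP => xL'; apply: xL; rewrite inE.
rewrite -integral_mkcond (@continuous_FTC2 _ _ p).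
- rewrite !p0 ?subee// in_itv/= -ler_norml ?normrN gtr0_norm ?(lt_trans K0)//.
    by rewrite -ltNge.
  by rewrite -ltNge.
- by rewrite /L; lra.
- exact: continuous_subspaceT.
- have cvp := derivable_continuous dp.
  split; first by move=> *; exact: dp.
  + by apply: cvg_at_right_filter; exact: cvp.
  + by apply: cvg_at_left_filter; exact: cvp.
- by [].
Unshelve. all: by end_near. Qed.

Lemma integral_lebesgue_rVS_pushforward {d} (g : 'rV[R]_d.+1 -> \bar R) :
  (\int[lebesgue_rV d.+1]_x g x = \int[pushforward (lebesgue_measure \x
    lebesgue_rV d)%E (@rV_cons R d)]_x g x)%E.
Proof.
by apply: eq_measure_integral; [exact: measurable_rV_cons|move=> ? A mA _].
Qed.

Lemma integrable_lebesgue_rVS {d} (g : 'rV[R]_d.+1 -> \bar R) :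
  (lebesgue_rV d.+1).-integrable setT g ->
  (lebesgue_measure \x lebesgue_rV d)%E.-integrable setT (g \o @rV_cons R d).
Proof.
move=> /integrableP[mg gi]; apply/integrableP; split.
  exact: measurableT_comp mg (@measurable_rV_cons _ _).
move: gi; rewrite integral_lebesgue_rVS_pushforward.
rewrite ge0_integral_pushforward//; first exact: measurable_rV_cons.
exact: measurableT_comp.
Qed.

Lemma integral_lebesgue_rVS {d} (g : 'rV[R]_d.+1 -> \bar R) :
  (lebesgue_rV d.+1).-integrable setT g ->
  (\int[lebesgue_rV d.+1]_x g x =
   \int[lebesgue_measure \x lebesgue_rV d]_z (g \o @rV_cons R d) z)%E.
Proof.
move=> ig; have := integrable_lebesgue_rVS ig; case/integrableP : ig => mg _ ig.
rewrite integral_lebesgue_rVS_pushforward integral_pushforward//.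
exact: measurable_rV_cons.
Qed.

(** Fubini isolates the first coordinate. If i is that coordinate, the inner integral vanishes by
    the fundamental theorem of calculus; otherwise the slices fall under the induction
    hypothesis. *)
Lemma integral_partial0 {d} (i : 'I_d) (f : 'rV[R]_d -> R) : C1c i f ->
  (\int[lebesgue_rV d]_x (partial i f x)%:E = 0)%E.
Proof.
elim: d i f => [[]//|d IH] i f Cf.
have [cf cDf df [K K0 f0]] := Cf.
have Df0 := C1c_partial0 i f0.
have iD := integrable_cube_supp cDf Df0.
have mD : measurable_fun [set: 'rV[R]_d.+1] (fun x => (partial i f x)%:E).
  by apply/measurable_EFinP; exact: continuous_measurable_rV.
have iP := integrable_lebesgue_rVS iD.
transitivity (\int[lebesgue_measure \x lebesgue_rV d]_z
    ((EFin \o partial i f) \o @rV_cons R d) z)%E.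
  exact: (integral_lebesgue_rVS iD).
move: Cf iP; have [j ->|->] := unliftP ord0 i => Cf iP.
  rewrite -integral12_prod_meas1//; apply: integral0_eq => x _.
  rewrite /fubini_F /= -[RHS](IH j (fun z => f (rV_cons (x, z)))).
    by apply: eq_integral => y _; rewrite partial_rV_cons.
  exact: C1c_rV_cons.
rewrite -integral21_prod_meas1//; apply: integral0_eq => y _.
rewrite /fubini_G /=.
have pE x : partial ord0 f (rV_cons (x, y)) =
    (fun x => f (rV_cons (x, y)))^`()%classic x.
  rewrite derive1E /partial derive_lineE [RHS]derive_lineE; congr (@derive _ R^o R^o _ 0 1).
  by apply/funext => h; rewrite -rV_cons_shift0 [h%:A]mulr1.
under eq_integral do rewrite pE.
apply: (@integral_derive_compact _ K) => //.
- move=> x; apply/derivable1P.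
  have [_ _ d0 _] := Cf; have /derivable1P := d0 (rV_cons (x, y)).
  rewrite (_ : (fun h : R => f (h *: _ + _)) =
    (fun h : R => f (rV_cons (h%:A + x, y))))//.
  apply/funext => h.
  by rewrite -rV_cons_shift0 [h%:A]mulr1.
- have -> : (fun x => f (rV_cons (x, y)))^`()%classic = fun x => partial ord0 f (rV_cons (x, y)).
    by apply/funext => x; rewrite pE.
  have [_ cD0 _ _] := Cf.
  by move=> x; apply: (continuous_comp (continuous_rV_cons1 (x := x))); exact: cD0.
- by move=> x /negP xK; apply: f0 => /cube_rV_cons[/xK].
Qed.

End divergence.

(** * Test functions and the fundamental lemma *)

Section test_functions.
Context {R : realType} {d : nat} (Omega : set 'rV[R]_d).
Local Notation E := 'rV[R]_d.
Local Notation leb := (lebesgue_rV d : {measure set E -> \bar R}).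
Implicit Types (phi psi : E -> R).

Local Notation unit_vec := (fun i : 'I_d => delta_mx 0 i : E).

Lemma smoothP (g : E -> R) : smooth g <-> Coo unit_vec g.
Proof. by split => [H|H]; [apply/CooP|apply/(CooP unit_vec g)]. Qed.

Lemma test_functionN0 phi x : phi x != 0 -> closure [set x | phi x != 0] x.
Proof. by move=> px; apply: subset_closure. Qed.

Lemma test_function_cube phi : test_function Omega phi ->
  exists2 K, 0 < K & forall x, ~ cube K x -> phi x = 0.
Proof.
move=> [_ /compact_bounded/bounded_sub_cube[K K0 HK] _]; exists K => // x xK.
apply/eqP; apply: contra_notT xK => px; apply: HK; exact: test_functionN0.
Qed.

Lemma test_function_out phi x : test_function Omega phi -> ~ Omega x -> phi x = 0.
Proof.
move=> [_ _ sO] xO; apply/eqP; apply: contra_notT xO => px; apply: sO.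
exact: test_functionN0.
Qed.

Lemma test_function_partial_out phi i x :
  test_function Omega phi -> ~ Omega x -> partial i phi x = 0.
Proof.
move=> [_ _ sO] xO; apply: derive_near0.
have : open (~` closure [set x | phi x != 0]).
  exact/closed_openC/closed_closure.
rewrite openE => /(_ x) H.
have : (~` closure [set x | phi x != 0]) x by move=> /sO.
move/H; apply: filterS => y yO; apply/eqP; apply: contra_notT yO.
exact: test_functionN0.
Qed.

Lemma test_function_sub phi psi : test_function Omega phi -> smooth psi ->
  (forall x, phi x = 0 -> psi x = 0) -> test_function Omega psi.
Proof.
move=> [sphi cphi Ophi] spsi H.
have sub : closure [set x | psi x != 0] `<=` closure [set x | phi x != 0].
  by apply: closure_subset => x; apply: contra_neq => /H.
split => //; last exact: subset_trans Ophi.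
by apply: subclosed_compact cphi sub; exact: closed_closure.
Qed.

Lemma test_functionM phi psi : test_function Omega phi -> smooth psi ->
  test_function Omega (phi \* psi).
Proof.
move=> tphi spsi; apply: (test_function_sub tphi); last first.
  by move=> x /= ->; rewrite mul0r.
case: tphi => /smoothP sphi _ _; apply/smoothP => n.
by apply: CkM; [exact: sphi|move/smoothP : spsi; exact].
Qed.

Lemma test_function_comp phi (h : R -> R) : test_function Omega phi ->
  Coo1 h -> h 0 = 0 -> test_function Omega (h \o phi).
Proof.
move=> tphi Ch h0; apply: (test_function_sub tphi); last by move=> x /= ->.
case: tphi => /smoothP sphi _ _; apply/smoothP => n.
by apply: Ck_comp => //; exact: sphi.
Qed.

Lemma test_function_continuous phi : test_function Omega phi -> continuous phi.
Proof. by move=> [/smoothP /(_ 0%N) /Ck_continuous]. Qed.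

Lemma test_function_derivable phi : test_function Omega phi ->
  forall i x, derivable phi x (delta_mx 0 i).
Proof. by move=> [/smoothP /(_ 0%N) /Ck_derivable]. Qed.

Lemma test_function_continuous_partial phi i :
  test_function Omega phi -> continuous (partial i phi).
Proof.
by move=> [/smoothP /(_ 1%N) /Ck_succ /(_ i) /Ck_continuous].
Qed.

Lemma test_function_C1c phi i : test_function Omega phi -> C1c i phi.
Proof.
move=> tphi; split.
- exact: test_function_continuous.
- exact: test_function_continuous_partial.
- exact: test_function_derivable.
- exact: test_function_cube.
Qed.

Lemma test_function_bounded phi : test_function Omega phi ->
  exists2 C, 0 < C & forall x, `|phi x| <= C.
Proof.
move=> tphi; have [K K0 HK] := test_function_cube tphi.
have [C C0 HC] := continuous_cube_bounded K (test_function_continuous tphi).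
exists C => // x; have [/HC//|/HK->] := pselect (cube K x).
by rewrite normr0 ltW.
Qed.

Lemma test_function_partial_bounded phi i : test_function Omega phi ->
  exists2 C, 0 < C & forall x, `|partial i phi x| <= C.
Proof.
move=> tphi; have [K K0 HK] := test_function_cube tphi.
have [C C0 HC] := continuous_cube_bounded K (test_function_continuous_partial (i := i) tphi).
exists C => // x; have [/HC//|xK] := pselect (cube K x).
by rewrite (C1c_partial0 i HK xK) normr0 ltW.
Qed.

(** Integration by parts: the two integrands add up to the partial derivative of [phi \* psi], whose
    integral vanishes. *)
Lemma test_function_weak_partial phi i : test_function Omega phi ->
  is_weak_partial Omega i phi (partial i phi).
Proof.
move=> tphi psi tpsi.
have out (a : E -> R) : (forall x, ~ Omega x -> a x = 0) ->
    \int[leb]_(x in Omega) a x = \int[leb]_x a x.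
  move=> a0; rewrite Rintegral_mkcond; congr (Rintegral _ _ _).
  apply/funext => x; rewrite patchE; case: ifPn => // /negP xO.
  by rewrite a0// => xO'; apply: xO; rewrite inE.
rewrite !out; last 2 first.
  by move=> x xO; rewrite (test_function_out tpsi)// mulr0.
  by move=> x xO; rewrite (test_function_out tphi)// mul0r.
have tp : test_function Omega (phi \* psi) by apply: test_functionM tphi _; case: tpsi.
have [K K0 HK] := test_function_cube tphi.
have c1 := test_function_continuous tphi.
have c2 := @test_function_continuous_partial _ i tpsi.
have c3 := @test_function_continuous_partial _ i tphi.
have c4 := test_function_continuous tpsi.
have i1 : leb.-integrable setT (EFin \o (fun x => phi x * partial i psi x)).
  apply: (@integrable_cube_supp _ _ _ K).
    by move=> x; exact: cvgM (c1 x) (c2 x).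
  by move=> x /HK ->; rewrite mul0r.
have i2 : leb.-integrable setT (EFin \o (fun x => partial i phi x * psi x)).
  apply: (@integrable_cube_supp _ _ _ K).
    by move=> x; exact: cvgM (c3 x) (c4 x).
  by move=> x xK; rewrite (C1c_partial0 i HK xK) mul0r.
apply/eqP; rewrite -subr_eq0 opprK -RintegralD//; apply/eqP.
rewrite /Rintegral -[RHS]/(fine 0) -(integral_partial0 (test_function_C1c i tp)).
congr fine; apply: eq_integral => x _ /=; congr EFin.
rewrite /partial [RHS]deriveM; last 2 first.
  exact: test_function_derivable.
  exact: test_function_derivable.
by congr (_ + _); exact: mulrC.
Qed.

End test_functions.

Section fundamental_lemma.
Context {R : realType} {d : nat} (Omega : set 'rV[R]_d).
Local Notation E := 'rV[R]_d.
Local Notation leb := (lebesgue_rV d : {measure set E -> \bar R}).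

Definition cbox (a b : E) : set E := [set x | forall i, x 0 i \in `[a 0 i, b 0 i]].

Lemma rbox_cbox (a b : E) : rbox a b `<=` cbox a b.
Proof. by move=> x xab i; apply: subset_itv_oo_cc; exact: xab. Qed.

Lemma cbox_compact (a b : E) : compact (cbox a b).
Proof.
apply: (rV_compact (A := fun i => [set` `[a 0 i, b 0 i]%R])) => i.
exact: segment_compact.
Qed.

(** A smooth function supported in the closed box. As c tends to 0 each exponential factor tends to
    1, so the bump converges to the indicator of the open box while staying in [0, 1]. *)
Definition bump (a b : E) (c : R) (x : E) : R :=
  \prod_(i < d) (flat c 1 (x 0 i - a 0 i) * flat c 1 (b 0 i - x 0 i)).

Lemma flat1E (c x : R) : flat c 1 x = if 0 < x then expR (- (c / x)) else 0.
Proof. by rewrite /flat hornerC mul1r. Qed.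

Lemma flat1_ge0 (c x : R) : 0 <= flat c 1 x.
Proof. by rewrite flat1E; case: ifPn => // _; exact: expR_ge0. Qed.

Lemma flat1_le1 (c x : R) : 0 < c -> flat c 1 x <= 1.
Proof.
move=> c0; rewrite flat1E; case: ifPn => // x0.
by rewrite expR_le1 oppr_le0 divr_ge0// ltW.
Qed.

Lemma bump_ge0 a b c x : 0 <= bump a b c x.
Proof. by rewrite prodr_ge0// => i _; rewrite mulr_ge0 ?flat1_ge0. Qed.

Lemma bump_le1 a b c x : 0 < c -> bump a b c x <= 1.
Proof.
move=> c0; rewrite prodr_ile1// => i _.
by rewrite mulr_ge0 ?mulr_ile1 ?flat1_ge0 ?flat1_le1.
Qed.

Lemma bump_neq0 a b c x : bump a b c x != 0 -> rbox a b x.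
Proof.
move=> /prodf_neq0 H i; have := H i isT.
rewrite mulf_eq0 negb_or !flat1E in_itv/=.
case: ifPn => [|_]; last by rewrite eqxx.
by case: ifPn => [|_]; rewrite ?eqxx ?andbF// !subr_gt0 => -> ->.
Qed.

Lemma coord_Coo (i : 'I_d) : Coo (fun i : 'I_d => delta_mx 0 i : E) (fun x => x 0 i).
Proof.
have D j (x : E) : is_derive x (delta_mx 0 j : E) (fun x : E => x 0 i) ((j == i)%:R).
  have H : (fun h : R => (h *: (delta_mx 0 j : E) + x) 0 i) =
      (fun h => (j == i)%:R * h + x 0 i).
    by apply/funext => h; rewrite !mxE eqxx/= mulrC eq_sym.
  apply: DeriveDef; first apply/derivable1P.
    by rewrite H; have [] := is_derive_affine (j == i)%:R (x 0 i) 0.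
  by rewrite derive_lineE H; have [] := is_derive_affine (j == i)%:R (x 0 i) 0.
have c : continuous (fun x : E => x 0 i) by exact: coord_continuous.
case=> [|n]; split.
- exact: c.
- by move=> j x; have [] := D j x.
- by [].
- exact: c.
- by move=> j x; have [] := D j x.
- move=> j; rewrite (_ : (fun _ => _) = cst (j == i)%:R); first exact: Ck_cst.
  by apply/funext => x; have [] := D j x.
Qed.

Lemma bump_test a b c : 0 < c -> cbox a b `<=` Omega ->
  test_function Omega (bump a b c).
Proof.
move=> c0 abO.
have sub : closure [set x | bump a b c x != 0] `<=` cbox a b.
  rewrite (_ : cbox a b = closure (cbox a b)).
    by apply: closure_subset => x /bump_neq0 /rbox_cbox.
  apply: (closure_id _).1; apply: compact_closed; last exact: cbox_compact.
  exact: norm_hausdorff.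
split.
- apply/smoothP => n; apply: Ck_prod => i; apply: CkM.
    apply: (@Ck_comp _ _ _ _ _ (flat c 1) (fun x : E => x 0 i - a 0 i)).
      exact: Coo1_flat.
    by apply: CkD; [exact: coord_Coo|exact: Ck_cst].
  apply: (@Ck_comp _ _ _ _ _ (flat c 1) (fun x : E => b 0 i - x 0 i)).
    exact: Coo1_flat.
  by apply: CkD; [exact: Ck_cst|apply: CkN; exact: coord_Coo].
- exact: (subclosed_compact (@closed_closure _ _) (@cbox_compact a b) sub).
- exact: subset_trans abO.
Qed.

Lemma cvg_flat1 (x : R) : flat n.+1%:R^-1 1 x @[n --> \oo] --> ((0 < x)%R%:R : R).
Proof.
under eq_fun do rewrite flat1E.
have [x0|x0] := ltP 0 x; last exact: cvg_cst.
have -> : true%:R = expR (- (0 / x)) :> R by rewrite mul0r oppr0 expR0.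
have H : - (n.+1%:R^-1 / x) @[n --> \oo] --> - (0 / x).
  by apply: cvgN; apply: cvgM; [exact: cvg_harmonic|exact: cvg_cst].
exact: (cvg_comp _ _ H (@continuous_expR R _)).
Qed.

Lemma cvg_prod_seq (J : Type) (r : seq J) (F : J -> nat -> R) (l : J -> R) :
  (forall j, F j n @[n --> \oo] --> l j) ->
  \prod_(j <- r) F j n @[n --> \oo] --> \prod_(j <- r) l j.
Proof.
move=> H; elim: r => [|j r IH].
  by under eq_fun do rewrite big_nil; rewrite big_nil; exact: cvg_cst.
under eq_fun do rewrite big_cons; rewrite big_cons.
by apply: cvgM.
Qed.

Lemma cvg_bump a b x :
  bump a b n.+1%:R^-1 x @[n --> \oo] --> (\1_(rbox a b) x : R).
Proof.
rewrite (_ : \1_(rbox a b) x =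
    \prod_(i < d) ((0 < x 0 i - a 0 i)%R%:R * (0 < b 0 i - x 0 i)%R%:R)).
  by apply: cvg_prod_seq => i; apply: cvgM; exact: cvg_flat1.
rewrite indicE; have [/set_mem xab|xab] := boolP (x \in rbox a b).
  rewrite big1// => i _; have := xab i.
  by rewrite in_itv/= !subr_gt0 => /andP[-> ->]; rewrite mulr1.
apply/esym/eqP; rewrite prodf_seq_eq0; apply: contraNT xab.
rewrite -all_predC => /allP H; rewrite inE => i.
have /= := H i (mem_index_enum i); rewrite in_itv/= !subr_gt0 mulf_eq0 negb_or.
by rewrite !pnatr_eq0 !eqb0 !negbK.
Qed.

Variable g : E -> R.
Hypothesis oO : open Omega.
Let mO : measurable Omega := open_measurable_rV oO.
Hypothesis ig : leb.-integrable Omega (EFin \o g).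
Hypothesis g0 : forall phi, test_function Omega phi ->
  \int[leb]_(x in Omega) (g x * phi x) = 0.

Lemma integral_rbox0 a b : cbox a b `<=` Omega ->
  (\int[leb]_(x in rbox a b) (g x)%:E = 0)%E.
Proof.
move=> abO.
have mg : measurable_fun Omega g by apply/measurable_EFinP; exact: measurable_int ig.
have bO : rbox a b `<=` Omega by apply: subset_trans abO; exact: rbox_cbox.
pose f n x := (g x * bump a b n.+1%:R^-1 x)%:E.
have n0 n : 0 < n.+1%:R^-1 :> R by rewrite invr_gt0.
have tb n := bump_test (n0 n) abO.
have fdom x n : Omega x -> (`|f n x| <= `|(g x)%:E|)%E.
  move=> _; rewrite lee_fin normrM ler_piMr//.
  by rewrite ger0_norm ?bump_ge0 ?bump_le1.
have flim x : Omega x -> f n x @[n --> \oo] --> (g x * \1_(rbox a b) x)%:E.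
  by move=> _; apply: cvg_EFin; [exact: nearW|apply: cvgM; [exact: cvg_cst|exact: cvg_bump]].
have mlim : measurable_fun Omega (fun x => (g x * \1_(rbox a b) x)%:E).
  apply/measurable_EFinP; apply: measurable_funM => //.
  by apply: measurable_indic; exact: rbox_measurable.
have mf n : measurable_fun Omega (f n).
  apply/measurable_EFinP; apply: measurable_funM => //.
  apply: measurable_funTS; apply: continuous_measurable_rV.
  exact: test_function_continuous (tb n).
have f0 n : (\int[leb]_(x in Omega) f n x = 0)%E.
  have := g0 (tb n); rewrite /Rintegral => H.
  have iF : leb.-integrable Omega (f n).
    by apply: (le_integrable mO (mf n) _ ig) => x; exact: fdom.
  by rewrite -[LHS]fineK ?H//; exact: integrable_fin_num.
have [_ _] := @dominated_convergence _ _ _ leb Omega mO f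
  (fun x => (g x * \1_(rbox a b) x)%:E) (fun x => `|(g x)%:E|)%E
  mf mlim (aeW leb flim) (integrable_abse ig) (aeW leb fdom).
under eq_fun do rewrite f0.
move=> /(cvg_unique (@ereal_hausdorff _) (cvg_cst _)) H.
rewrite [LHS](_ : _ = \int[leb]_(x in Omega) (g x * \1_(rbox a b) x)%:E)%E; last first.
  rewrite -{1}(setIidr bO) integral_mkcondr; apply: eq_integral => x _.
  by rewrite patchE indicE; case: ifPn; rewrite ?mulr1 ?mulr0.
by rewrite -H.
Qed.

(** A Dynkin argument: the charge sending [A] to the integral of [g] over [A] and the box vanishes
    on all open boxes, which are stable under intersection and generate the sigma-algebra. Its total
    mass is zero, which handles complements. *)
Lemma integral_qbox_measurable0 (p : 'rV[rat]_d * nat) (A : set E) : (forall y : E, (forall i, y 0 i \in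
    `[ratr (p.1 0 i) - p.2.+1%:R^-1, ratr (p.1 0 i) + p.2.+1%:R^-1]) -> Omega y) ->
  measurable A -> (\int[leb]_(x in A `&` qbox p) (g x)%:E = 0)%E.
Proof.
move=> pO mA; set Q := qbox p.
have mQ : measurable Q by exact: rbox_measurable.
have QO : Q `<=` Omega.
  by move=> y yp; apply: pO => i; have := yp i; rewrite !mxE; exact: subset_itv_oo_cc.
pose h := (EFin \o g) \_ Q.
have ih : leb.-integrable setT h.
  by apply/(integrable_mkcond _ mQ); exact: (integrableS mO mQ QO ig).
have nuE B : (\int[leb]_(x in B `&` Q) (g x)%:E)%E = induced_charge ih B.
  by rewrite /induced_charge integral_mkcondr.
pose G := [set X : set E | exists a b : E, X = rbox a b].
pose H := [set X : set E | measurable X /\ induced_charge ih X = 0%E].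
have nuT : induced_charge ih setT = 0%E.
  rewrite -nuE setTI; apply: integral_rbox0 => y yp; apply: pO => i.
  by have := yp i; rewrite !mxE.
have Grbox a b : H (rbox a b).
  split; first exact: rbox_measurable.
  rewrite -nuE.
  pose a' : E := \row_i Num.max (a 0 i) (ratr (p.1 0 i) - p.2.+1%:R^-1).
  pose b' : E := \row_i Num.min (b 0 i) (ratr (p.1 0 i) + p.2.+1%:R^-1).
  rewrite (_ : _ `&` _ = rbox a' b').
    apply: integral_rbox0 => y yp; apply: pO => i; have := yp i.
    by rewrite !mxE !in_itv/= ge_max le_min => /andP[/andP[_ ->] /andP[_ ->]].
  apply/seteqP; split => [x [xa xp] i|x xp].
    have := xa i; have := xp i; rewrite !mxE !in_itv/= gt_max lt_min.
    by move=> /andP[-> ->] /andP[-> ->].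
  split=> i; have := xp i; rewrite !mxE !in_itv/= gt_max lt_min;
    by move=> /andP[/andP[? ?] /andP[? ?]]; apply/andP.
have setIG : setI_closed G.
  move=> _ _ [a [b ->]] [a' [b' ->]].
  exists (\row_i Num.max (a 0 i) (a' 0 i)), (\row_i Num.min (b 0 i) (b' 0 i)).
  apply/seteqP; split => [x [xa xp] i|x xp].
    have := xa i; have := xp i; rewrite !mxE !in_itv/= gt_max lt_min.
    by move=> /andP[-> ->] /andP[-> ->].
  split=> i; have := xp i; rewrite !mxE !in_itv/= gt_max lt_min;
    by move=> /andP[/andP[? ?] /andP[? ?]]; apply/andP.
have lH : lambda_system setT H.
  apply/dynkin_lambda_system; split.
  - by split.
  - move=> X [mX X0]; split; first exact: measurableC.
    have E1 : induced_charge ih setT =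
        (induced_charge ih X + induced_charge ih (~` X))%E.
      have := charge_partition (induced_charge ih) (@measurableT _ E) mX
        (measurableC mX) (setUv X) (setICr X).
      by rewrite !setTI.
    by move: E1; rewrite nuT X0 add0e => <-.
  - move=> F tF HF; split; first by apply: bigcupT_measurable => k; have [] := HF k.
    have := @charge_semi_sigma_additive _ _ _ (induced_charge ih) F
      (fun k => (HF k).1) tF (bigcupT_measurable _ (fun k => (HF k).1)).
    rewrite (_ : (fun n => _) = cst 0%E); last first.
      by apply/funext => n; rewrite big1// => i _; have [] := HF i.
    by move=> /(cvg_unique (@ereal_hausdorff _) (cvg_cst _)) <-.
have GH : <<s G >> `<=` H.
  apply: (lambda_system_subset setIG lH); last by [].
  by move=> _ [a [b ->]]; exact: Grbox.
(* A strip is the union of boxes whose other sides ]-n, n[ exhaust the line. *)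
have coordG i x y : <<s G >> (rV_coord i @^-1` `]x, y[).
  rewrite (_ : _ @^-1` _ = \bigcup_n rbox (\row_j if j == i then x else - n%:R)
     (\row_j if j == i then y else n%:R)).
    apply: sigma_algebra_bigcup => n; apply: sub_sigma_algebra.
    by do 2!eexists; reflexivity.
  apply/seteqP; split => [z /= zxy|z [n _ /(_ i)]]; last by rewrite !mxE eqxx.
  exists (Num.trunc `|z|).+1 => // j; rewrite !mxE; case: eqVneq => [->//|_].
  rewrite in_itv/= -ltr_norml.
  apply: (@le_lt_trans _ _ `|z|); last exact: truncnS_gt.
  by rewrite [leRHS]mx_normrE; exact: (le_bigmax _ (fun ij => `|z ij.1 ij.2|) (0, j)).
have mG : measurable `<=` <<s G >>.
  apply: smallest_sub; first exact: smallest_sigma_algebra.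
  rewrite -bigcup_seq/= => B [i /= _] [C mC <-]; rewrite setTI.
  have : @measurable _ (measurableTypeR R) `<=`
      image_set_system setT (rV_coord i) <<s G >>.
    rewrite [X in X `<=` _]measurable_realfun.RGenOpens.measurableE.
    apply: smallest_sub.
      by apply: sigma_algebra_image; exact: smallest_sigma_algebra.
    by move=> _ [x [y ->]]; rewrite /image_set_system/= setTI; exact: coordG.
  by move=> /(_ _ mC); rewrite /image_set_system/= setTI.
by rewrite nuE; have [] := GH _ (mG _ mA).
Qed.

(** [g] vanishes almost everywhere on each rational box inside [Omega], and countably many of these
    cover [Omega]. *)
Lemma fundamental_lemma : \forall x \ae leb, Omega x -> g x = 0.
Proof.
pose P (p : 'rV[rat]_d * nat) := forall y : E, (forall i, y 0 i \in
    `[ratr (p.1 0 i) - p.2.+1%:R^-1, ratr (p.1 0 i) + p.2.+1%:R^-1]) -> Omega y.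
have aep p : P p -> \forall x \ae leb, qbox p x -> (g x)%:E = 0%E.
  move=> pO.
  have mQ : measurable (qbox p : set E) by exact: rbox_measurable.
  have QO : qbox p `<=` Omega.
    move=> y yp; apply: pO => i; have := yp i; rewrite !mxE.
    exact: subset_itv_oo_cc.
  apply: (@integral_ae_eq _ _ _ leb _ mQ (cst 0%E) (EFin \o g)).
  - exact: (integrableS mO mQ QO ig).
  - exact: measurable_cst.
  - move=> A AQ mA; rewrite integral_cst// mul0e -{1}(setIidl AQ).
    exact: integral_qbox_measurable0.
have : \forall x \ae leb, forall k : nat, if unpickle k is Some p then
    (P p -> qbox p x -> (g x)%:E = 0%E) else True.
  apply: ae_foralln => k; case: unpickle => [p|]; last exact: aeW.
  have [/aep Pp|Pp] := pselect (P p); last exact: aeW.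
  by apply: filterS Pp => x Hx _.
apply: filterS => x H Ox.
have /rV_ball_nearP[e e0 He] : \forall y \near x, Omega y by exact: open_nbhs_nbhs.
have [p [px pO]] := open_qbox e0 He.
by have := H (pickle p); rewrite pickleK => /(_ pO px) [].
Qed.

End fundamental_lemma.

(** * Square integrable functions and H^1_0 *)

Section L2.
Context d (T : measurableType d) {R : realType} (mu : {measure set T -> \bar R}).
Variable D : set T.
Hypothesis mD : measurable D.
Implicit Types (f g h : T -> R) (c : R).

Definition sqint f : \bar R := (\int[mu]_(x in D) ((f x) ^+ 2)%:E)%E.

Definition L2 f := measurable_fun D f /\ (sqint f < +oo)%E.

Lemma sqint_ge0 f : (0 <= sqint f)%E.
Proof. by apply: integral_ge0 => x _; rewrite lee_fin sqr_ge0. Qed.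

Lemma measurable_sq f : measurable_fun D f ->
  measurable_fun D (fun x => ((f x) ^+ 2)%:E).
Proof. by move=> mf; apply/measurable_EFinP; exact: measurable_funX. Qed.

Lemma le_sqint f g c : 0 <= c -> measurable_fun D f -> measurable_fun D g ->
  (forall x, D x -> `|f x| <= c * `|g x|) ->
  (sqint f <= (c ^+ 2)%:E * sqint g)%E.
Proof.
move=> c0 mf mg fg; rewrite /sqint -ge0_integralZl//; last first.
  by rewrite lee_fin sqr_ge0.
  by move=> x _; rewrite lee_fin sqr_ge0.
  exact: measurable_sq.
apply: ge0_le_integral => //.
- by move=> x _; rewrite lee_fin sqr_ge0.
- exact: measurable_sq.
- by apply: measurable_funeM; exact: measurable_sq.
- move=> x Dx; rewrite -EFinM lee_fin -exprMn -(real_normK (num_real (f x))).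
  rewrite -(real_normK (num_real (c * g x))) lerXn2r ?nnegrE//.
  by rewrite normrM (ger0_norm c0) fg.
Qed.

Lemma sqintD f g : measurable_fun D f -> measurable_fun D g ->
  (sqint (f \+ g)%R <= 2%:E * sqint f + 2%:E * sqint g)%E.
Proof.
move=> mf mg; rewrite /sqint -!ge0_integralZl//; try exact: measurable_sq;
  try by move=> x _; rewrite lee_fin sqr_ge0.
rewrite -ge0_integralD//; first last.
- by apply: measurable_funeM; exact: measurable_sq.
- by move=> x _; rewrite -EFinM lee_fin mulr_ge0 ?sqr_ge0.
- by apply: measurable_funeM; exact: measurable_sq.
- by move=> x _; rewrite -EFinM lee_fin mulr_ge0 ?sqr_ge0.
apply: ge0_le_integral => //.
- by move=> x _; rewrite lee_fin sqr_ge0.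
- by apply: measurable_sq; exact: measurable_funD.
- by apply: emeasurable_funD; apply: measurable_funeM; exact: measurable_sq.
- move=> x _; rewrite -!EFinM -EFinD lee_fin.
  rewrite -subr_ge0 (_ : _ - _ = (f x - g x) ^+ 2) ?sqr_ge0//=.
  by ring.
Qed.

Lemma sqint_ae f g : measurable_fun D f -> measurable_fun D g ->
  (\forall x \ae mu, D x -> f x = g x) -> sqint f = sqint g.
Proof.
move=> mf mg fg; apply: ge0_ae_eq_integral => //; try exact: measurable_sq;
  try by move=> x _; rewrite lee_fin sqr_ge0.
by apply: filterS fg => x H Dx; rewrite H.
Qed.

Lemma L2_le f g c : L2 g -> measurable_fun D f ->
  (forall x, D x -> `|f x| <= c * `|g x|) -> L2 f.
Proof.
move=> [mg ig] mf fg; split => //.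
have fg' x : D x -> `|f x| <= `|c| * `|g x|.
  by move=> Dx; rewrite (le_trans (fg _ Dx))// ler_wpM2r// ler_norm.
apply: (le_lt_trans (le_sqint (normr_ge0 c) mf mg fg')).
by rewrite lte_mul_pinfty// lee_fin sqr_ge0.
Qed.

Lemma L2D f g : L2 f -> L2 g -> L2 (f \+ g).
Proof.
move=> [mf If] [mg Ig]; split; first exact: measurable_funD.
apply: (le_lt_trans (sqintD mf mg)).
by rewrite lte_add_pinfty// lte_mul_pinfty.
Qed.

Lemma L2Z c f : L2 f -> L2 (fun x => c * f x).
Proof.
move=> Lf; apply: (L2_le (c := `|c|) Lf).
  by apply: measurable_funM => //; case: Lf.
by move=> x _; rewrite normrM.
Qed.

Lemma L2B f g : L2 f -> L2 g -> L2 (f \- g).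
Proof.
move=> Lf Lg; have := L2D Lf (L2Z (-1) Lg).
by congr L2; apply/funext => x /=; rewrite mulN1r.
Qed.

Lemma L2M f h c : L2 f -> measurable_fun D h ->
  (forall x, D x -> `|h x| <= c) -> L2 (fun x => h x * f x).
Proof.
move=> Lf mh hc; apply: (L2_le (c := c) Lf).
  by apply: measurable_funM => //; case: Lf.
by move=> x Dx; rewrite normrM ler_wpM2r ?hc.
Qed.

Lemma L2_integrable_sq f : L2 f -> mu.-integrable D (fun x => ((f x) ^+ 2)%:E).
Proof.
move=> [mf If]; apply/integrableP; split; first exact: measurable_sq.
rewrite (_ : (fun x => _) = (fun x => ((f x) ^+ 2)%:E))//.
by apply/funext => x; rewrite gee0_abs// lee_fin sqr_ge0.
Qed.

Lemma L2_integrableM f g : L2 f -> L2 g ->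
  mu.-integrable D (fun x => (f x * g x)%:E).
Proof.
move=> Lf Lg; have [mf _] := Lf; have [mg _] := Lg.
have := integrableD mD (L2_integrable_sq Lf) (L2_integrable_sq Lg).
apply: le_integrable => //.
  by apply/measurable_EFinP; exact: measurable_funM.
move=> x _; rewrite lee_fin [leRHS]ger0_norm ?addr_ge0 ?sqr_ge0//.
have := sqr_ge0 (`|f x| - `|g x|).
rewrite -(real_normK (num_real (f x))) -(real_normK (num_real (g x))) normrM.
have := normr_ge0 (f x); have := normr_ge0 (g x).
by move: (`|f x|) (`|g x|) => a b a0 b0; nra.
Qed.

Lemma L2_bounded f c : (mu D < +oo)%E -> measurable_fun D f ->
  (forall x, D x -> `|f x| <= c) -> L2 f.
Proof.
move=> muD mf fc; apply: (@L2_le f (cst 1) c).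
- split => //; rewrite /sqint.
  by under eq_integral do rewrite expr1n; rewrite integral_cst// mul1e.
- by [].
- by move=> x Dx; rewrite normr1 mulr1; exact: fc.
Qed.

Lemma L2_integrable f : (mu D < +oo)%E -> L2 f -> mu.-integrable D (EFin \o f).
Proof.
move=> muD Lf.
have L1 : L2 (cst 1) by apply: (@L2_bounded _ 1) => // x _; rewrite normr1.
by have := L2_integrableM Lf L1; under eq_fun do rewrite mulr1.
Qed.

Lemma sqint_fin f : L2 f -> sqint f = (fine (sqint f))%:E.
Proof. by move=> [_ If]; rewrite fineK// ge0_fin_numE// sqint_ge0. Qed.

(** Young's inequality with a weight e takes the place of Cauchy-Schwarz: it is free of square
    roots, and the weight is tuned at each use. *)
Lemma le_Rintegral_L2 f g (e : R) : 0 < e -> L2 f -> L2 g ->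
  `|\int[mu]_(x in D) (f x * g x)| <=
    (e * fine (sqint f) + e^-1 * fine (sqint g)) / 2.
Proof.
move=> e0 Lf Lg.
have I1 := L2_integrableM Lf Lg.
have If := L2_integrable_sq Lf; have Ig := L2_integrable_sq Lg.
apply: (le_trans (le_normr_Rintegral mD I1)).
have e20 : 0 < e / 2 by rewrite divr_gt0.
have IfZ : mu.-integrable D (fun x => (e / 2 * (f x) ^+ 2)%:E).
  by under eq_fun do rewrite EFinM; exact: integrableZl.
have IgZ : mu.-integrable D (fun x => (e^-1 / 2 * (g x) ^+ 2)%:E).
  by under eq_fun do rewrite EFinM; exact: integrableZl.
rewrite [leRHS](_ : _ = \int[mu]_(x in D) (e / 2 * (f x) ^+ 2 + e^-1 / 2 * (g x) ^+ 2)).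
  apply: le_Rintegral => //.
  - exact: integrable_norm.
  - rewrite (_ : EFin \o _ = (fun x => (e / 2 * (f x) ^+ 2)%:E) \+
        (fun x => (e^-1 / 2 * (g x) ^+ 2)%:E))%E//; exact: integrableD.
  - move=> x _; rewrite normrM -(real_normK (num_real (f x))) -(real_normK (num_real (g x))).
    move: (`|f x|) (`|g x|) => a b.
    rewrite -subr_ge0 (_ : _ - _ = e / 2 * (a - e^-1 * b) ^+ 2); last by field; rewrite gt_eqF.
    by rewrite mulr_ge0 ?sqr_ge0// ltW.
rewrite RintegralD// !RintegralZl// /Rintegral -!/(sqint _).
by field; rewrite gt_eqF.
Qed.

End L2.

Section cvg_L2.
Context d (T : measurableType d) {R : realType} (mu : {measure set T -> \bar R}).
Variable D : set T.
Hypothesis mD : measurable D.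
Local Notation L2 := (L2 mu D).
Local Notation sqint := (sqint mu D).

Lemma cvge0P (u : (\bar R)^nat) : (forall n, 0 <= u n)%E ->
  u n @[n --> \oo] --> 0%E <->
  forall e : R, 0 < e -> \forall n \near \oo, (u n <= e%:E)%E.
Proof.
move=> u0; split => [uc e e0|H].
  have : nbhs 0%E [set x : \bar R | (x < e%:E)%E].
    by apply: open_nbhs_nbhs; split; [exact: open_ereal_lt_ereal|rewrite /= lte_fin].
  by move=> /uc H; near=> n; apply: ltW; near: n; exact: H.
have fu : \forall n \near \oo, u n \is a fin_num.
  by apply: filterS (H 1 ltr01) => n un; rewrite ge0_fin_numE// (le_lt_trans un)// ltry.
apply: cvg_EFin => //; apply/cvgrPdist_le => e e0; near=> n.
have un : (u n <= e%:E)%E by near: n; exact: H.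
have fn : u n \is a fin_num by near: n.
rewrite sub0r normrN /= ger0_norm ?fine_ge0//.
by rewrite -lee_fin fineK.
Unshelve. all: by end_near. Qed.

Lemma cvg_subseq (u : (\bar R)^nat) (l : \bar R) (k : nat -> nat) :
  (forall n, (n <= k n)%N) -> u n @[n --> \oo] --> l ->
  u (k n) @[n --> \oo] --> l.
Proof.
move=> kn ul; apply: (cvg_comp _ _ _ ul) => A [N _ NA].
by exists N => // n Nn; apply: NA; exact: leq_trans (kn n).
Qed.

Lemma cvg_sume0 (J : Type) (r : seq J) (a : J -> nat -> \bar R) :
  (forall j, a j n @[n --> \oo] --> 0%E) ->
  (\sum_(j <- r) a j n)%E @[n --> \oo] --> 0%E.
Proof.
move=> H; elim: r => [|j r IH].
  by under eq_fun do rewrite big_nil; exact: cvg_cst.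
have := cvgeD _ (H j) IH; rewrite adde0 => /(_ _ isT) aj.
rewrite (_ : (fun n => _) = (fun n => a j n + \sum_(j <- r) a j n)%E); first exact: aj.
by apply/funext => n; rewrite big_cons.
Qed.

Definition cvgL2 (f : (T -> R)^nat) (g : T -> R) :=
  sqint (f n \- g) @[n --> \oo] --> 0%E.

Lemma eq_cvgL2 (f f' : (T -> R)^nat) (g g' : T -> R) :
  (forall n, sqint (f' n \- g') = sqint (f n \- g)) -> cvgL2 f g -> cvgL2 f' g'.
Proof.
by move=> H; rewrite /cvgL2 (_ : (fun n => sqint (f' n \- g')) =
  (fun n => sqint (f n \- g)))//; apply/funext.
Qed.

Lemma squeeze0e (u v : (\bar R)^nat) : (forall n, 0 <= u n <= v n)%E ->
  v n @[n --> \oo] --> 0%E -> u n @[n --> \oo] --> 0%E.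
Proof.
move=> uv v0; apply: (squeeze_cvge _ (cvg_cst 0%E) v0).
by apply: nearW.
Qed.

Lemma cvgL2_Rintegral (f : (T -> R)^nat) (g h : T -> R) : (forall n, L2 (f n)) -> L2 g -> L2 h ->
  cvgL2 f g ->
  \int[mu]_(x in D) (f n x * h x) @[n --> \oo] --> \int[mu]_(x in D) (g x * h x).
Proof.
move=> Lf Lg Lh /cvge0P fg; pose q := fine (sqint h).
have q0 : 0 <= q by rewrite fine_ge0// sqint_ge0.
apply/cvgrPdist_le => e e0.
have ce0 : 0 < e * e / (q + 1) by rewrite divr_gt0 ?mulr_gt0// ltr_wpDl.
near=> n.
rewrite -RintegralB//; try exact: L2_integrableM.
rewrite (_ : Rintegral _ _ _ = \int[mu]_(x in D) ((g \- f n) x * h x)); last first.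
  by congr Rintegral; apply/funext => x; rewrite mulrBl.
have Lgf := L2B mD Lg (Lf n).
(* With this weight both terms of Young's bound are at most e, and their half sum too; the shift by
   1 covers q = 0. *)
have c0 : 0 < (q + 1) / e by rewrite divr_gt0// ltr_wpDl.
apply: (le_trans (le_Rintegral_L2 mD c0 Lgf Lh)).
have H : fine (sqint (g \- f n)) <= e * e / (q + 1).
  rewrite -lee_fin -sqint_fin//.
  rewrite (_ : sqint (g \- f n) = sqint (f n \- g)).
    by near: n; apply: fg => //; move=> ?; exact: sqint_ge0.
  by apply: eq_integral => x _ /=; rewrite -sqrrN opprB.
rewrite ler_pdivrMr// invf_div.
apply: (@le_trans _ _ ((q + 1) / e * (e * e / (q + 1)) + e / (q + 1) * q)).
  by rewrite lerD2r ler_wpM2l// ltW.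
rewrite [X in X + _](_ : _ = e); last by field; rewrite !gt_eqF// ltr_wpDl.
rewrite mulrDr mulr1 lerD2l mulrAC ler_pdivrMr ?ltr_wpDl//.
by rewrite ler_wpM2l ?(ltW e0)// lerDl.
Unshelve. all: by end_near. Qed.

Lemma cvgL2_lipschitz (f : (T -> R)^nat) (g : T -> R) (h : R -> R) c : 0 <= c ->
  (forall n, measurable_fun D (f n)) -> measurable_fun D g ->
  measurable_fun setT h ->
  (forall a b, `|h a - h b| <= c * `|a - b|) ->
  cvgL2 f g -> cvgL2 (fun n => h \o f n) (h \o g).
Proof.
move=> c0 mf mg mh hc fg.
apply: (@squeeze0e _ (fun n => (c ^+ 2)%:E * sqint (f n \- g)%R)%E).
  move=> n; rewrite sqint_ge0/=; apply: le_sqint => //.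
  - by apply: measurable_funB; exact: measurableT_comp.
  - exact: measurable_funB.
  - by move=> x _; exact: hc.
rewrite -(mule0 (c ^+ 2)%:E); exact: cvgeZl.
Qed.

(** The difference is h(f_n) (u_n - v) + (h(f_n) - h(g)) v. The first term is bounded times small in
    L^2; the second tends to 0 by dominated convergence, its square being at most (2c)^2 v^2. *)
Lemma cvgL2_mul (f u : (T -> R)^nat) (g v : T -> R) (h : R -> R) c :
  (forall x, `|h x| <= c) -> continuous h ->
  (forall n, measurable_fun D (f n)) -> measurable_fun D g ->
  (\forall x \ae mu, D x -> f n x @[n --> \oo] --> g x) ->
  (forall n, L2 (u n)) -> L2 v -> cvgL2 u v ->
  cvgL2 (fun n x => h (f n x) * u n x) (fun x => h (g x) * v x).
Proof.
move=> hc ch mf mg fg Lu Lv uv.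
have c0 : 0 <= c by rewrite (le_trans _ (hc 0)).
have mh := continuous_measurable_fun ch.
have mhf n : measurable_fun D (h \o f n) by exact: measurableT_comp.
have mhg : measurable_fun D (h \o g) by exact: measurableT_comp.
pose r n x := (h (f n x) - h (g x)) * v x.
have mr n : measurable_fun D (r n).
  apply: measurable_funM; last by case: Lv.
  exact: (measurable_funB (mhf n) mhg).
have r0 : sqint (r n) @[n --> \oo] --> 0%E.
  have dom : mu.-integrable D (fun x => ((2 * c) ^+ 2)%:E * ((v x) ^+ 2)%:E)%E.
    by apply: integrableZl => //; exact: L2_integrable_sq.
  have rlim x : D x -> (f n x @[n --> \oo] --> g x) ->
      ((r n x) ^+ 2)%:E @[n --> \oo] --> 0%:E.
    move=> Dx H; apply: cvg_EFin; first exact: nearW.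
    have rx : r n x @[n --> \oo] --> (0 : R).
      rewrite -(mul0r (v x)) -(subrr (h (g x))).
      apply: cvgM; last exact: cvg_cst.
      apply: cvgB; last exact: cvg_cst.
      exact: (cvg_comp _ _ H (ch (g x))).
    rewrite (_ : _ \o _ = (fun n => r n x * r n x)).
      by rewrite -[X in _ --> X](mulr0 0); exact: (cvgM rx rx).
    by apply/funext => n /=; rewrite expr2.
  have rdom x n : D x ->
      (`|((r n x) ^+ 2)%:E| <= ((2 * c) ^+ 2)%:E * ((v x) ^+ 2)%:E)%E.
    move=> Dx; rewrite gee0_abs; last by rewrite lee_fin sqr_ge0.
    rewrite -EFinM lee_fin.
    rewrite -exprMn -(real_normK (num_real (r n x))).
    rewrite -(real_normK (num_real (2 * c * v x))) lerXn2r ?nnegrE//.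
    rewrite /r !normrM (ger0_norm c0) (ger0_norm (ler0n _ 2)) ler_wpM2r//.
    by rewrite (le_trans (ler_normB _ _))// mulr_natl mulr2n lerD.
  have rae : \forall x \ae mu, D x ->
      (fun n => ((r n x) ^+ 2)%:E) n @[n --> \oo] --> 0%:E.
    by apply: filterS fg => x H Dx; exact: (rlim x Dx (H Dx)).
  have [_ _] := @dominated_convergence _ _ _ mu D mD
    (fun n x => ((r n x) ^+ 2)%:E) (cst 0%E) _
    (fun n => measurable_sq (mr n)) (measurable_cst _) rae dom (aeW mu rdom).
  by rewrite integral0.
apply: (@squeeze0e _ (fun n =>
    2%:E * ((c ^+ 2)%:E * sqint (u n \- v)%R) + 2%:E * sqint (r n))%E).
  move=> n; rewrite sqint_ge0/=.
  have mu1 : measurable_fun D (fun x => h (f n x) * (u n \- v) x).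
    exact: (measurable_funM (mhf n) (measurable_funB (Lu n).1 Lv.1)).
  rewrite (_ : _ \- _ = (fun x => h (f n x) * (u n \- v) x) \+ r n); last first.
    by apply/funext => x /=; rewrite /r; ring.
  have H1 := sqintD mu mD mu1 (mr n).
  have H2 : (sqint (fun x => h (f n x) * (u n \- v) x)%R <=
      (c ^+ 2)%:E * sqint (u n \- v)%R)%E.
    apply: le_sqint => //; first exact: (measurable_funB (Lu n).1 Lv.1).
    by move=> x _; rewrite normrM ler_wpM2r.
  apply: (le_trans H1); rewrite leeD2r// lee_pmul2l//.
rewrite -[X in _ --> X](adde0 0%E); apply: cvgeD => //.
  rewrite -(mule0 2%:E); apply: cvgeZl => //.
  by rewrite -(mule0 (c ^+ 2)%:E); exact: cvgeZl.
by rewrite -(mule0 2%:E); exact: cvgeZl.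
Qed.

(** Indices are chosen with squared distance at most 2^-(n+1). The series of squared differences is
    then integrable, hence finite almost everywhere, and its terms tend to 0. The indices need not
    increase. *)
Lemma cvgL2_ae_subsequence (f : (T -> R)^nat) (g : T -> R) :
  (forall n, L2 (f n)) -> L2 g -> cvgL2 f g ->
  exists k : nat -> nat, (forall n, (n <= k n)%N) /\
    \forall x \ae mu, D x -> f (k n) x @[n --> \oo] --> g x.
Proof.
move=> Lf Lg /cvge0P; move=> /(_ (fun n => sqint_ge0 _ _ _)) fg.
pose e (n : nat) : R := 1 / (2 ^ n.+1)%:R.
have e0 n : 0 < e n by rewrite divr_gt0// ltr0n expn_gt0.
have /choice[k HK] : forall n, exists k,
    (n <= k)%N /\ (sqint (f k \- g)%R <= (e n)%:E)%E.
  move=> n; have [k _ Hk] := fg _ (e0 n); exists (maxn n k).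
  by split; [exact: leq_maxl|exact: (Hk _ (leq_maxr _ _))].
have Hk n := (HK n).2.
exists k; split=> [n|]; first exact: (HK n).1.
have mfg n : measurable_fun D (fun x => (((f (k n) \- g) x) ^+ 2)%:E).
  by apply: measurable_sq; apply: measurable_funB; [case: (Lf (k n))|case: Lg].
pose S x := (\sum_(n <oo) (((f (k n) \- g)%R x) ^+ 2)%:E)%E.
have nn n x : (0 <= (((f (k n) \- g)%R x) ^+ 2)%:E)%E by rewrite lee_fin sqr_ge0.
have iS : mu.-integrable D S.
  apply/integrableP; split; first exact: ge0_emeasurable_sum.
  under eq_integral do rewrite gee0_abs ?nneseries_ge0//.
  rewrite integral_nneseries//.
  apply: (@le_lt_trans _ _ 1%:E); last exact: ltry.
  apply: le_trans (epsilon_trick0 xpredT (@ler01 R)).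
  apply: lee_nneseries => [n _ _|n _]; first exact: sqint_ge0.
  exact: Hk.
have := integrable_ae mD iS; apply: filterS => x H Dx.
have /nneseries_tail_cvg : (S x < +oo)%E by rewrite -ge0_fin_numE ?H// nneseries_ge0.
move=> /(_ (fun n _ => nn n x)) tail.
have sq0 : (((f (k n) \- g) x) ^+ 2)%:E @[n --> \oo] --> 0%E.
  apply: squeeze0e tail => N; rewrite nn/=.
  apply: le_trans (nneseries_lim_ge N.+1 (fun n _ _ => nn n x)).
  by rewrite big_nat1.
apply/cvgrPdist_le => eps eps0.
have eps2 : 0 < eps ^+ 2 by rewrite exprn_gt0.
move/(cvge0P (fun n => nn n x))/(_ _ eps2) : sq0; apply: filterS => n.
rewrite lee_fin -(real_normK (num_real ((f (k n) \- g) x))) distrC.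
by rewrite ler_sqr ?nnegrE// ltW.
Qed.

End cvg_L2.

Lemma poweR2_le {R : realType} (x : \bar R) (e : R) : (0 <= x)%E -> 0 <= e ->
  (x `^ 2 <= (e ^+ 2)%:E)%E = (x <= e%:E)%E.
Proof.
case: x => [r| |]//=; rewrite ?lee_fin => r0 e0.
  by rewrite powR_mulrn// ler_sqr.
by rewrite pnatr_eq0/= !leNgt !ltry.
Qed.

Lemma poweR2_lty {R : realType} (x : \bar R) : (0 <= x)%E ->
  (x `^ 2 < +oo)%E = (x < +oo)%E.
Proof. by case: x => [r| |]//= _; rewrite ?ltry ?pnatr_eq0. Qed.

Lemma poweR2_fin {R : realType} (x : \bar R) : (0 <= x)%E -> (x < +oo)%E ->
  (x `^ 2)%E = ((fine x) ^+ 2)%:E.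
Proof. by case: x => [r| |]//=; rewrite lee_fin => r0 _; rewrite powR_mulrn. Qed.

Lemma cvg_poweR2 {R : realType} (u : (\bar R)^nat) : (forall n, 0 <= u n)%E ->
  u n @[n --> \oo] --> 0%E <-> (u n `^ 2)%E @[n --> \oo] --> 0%E.
Proof.
move=> u0; have u20 n : (0 <= u n `^ 2)%E by exact: poweR_ge0.
split=> [/(cvge0P u0) H|/(cvge0P u20) H].
  apply/(cvge0P u20) => e e0.
  have s0 : 0 < Num.sqrt e by rewrite sqrtr_gt0.
  apply: filterS (H _ s0) => n.
  by rewrite -poweR2_le ?sqrtr_ge0// sqr_sqrtr// ltW.
apply/(cvge0P u0) => e e0.
have e20 : 0 < e ^+ 2 by rewrite exprn_gt0.
by apply: filterS (H _ e20) => n; rewrite poweR2_le// ltW.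
Qed.

(** Meant for composition with a test function bounded by C; the value 0 at 0 preserves the
    vanishing outside the support. *)
Lemma continuous_primitive {R : realType} (h : R -> R) (C : R) : 0 < C -> continuous h ->
  exists F : R -> R, F 0 = 0 /\
    forall s : R, `|s| <= C -> is_derive s 1 F (h s).
Proof.
(* The margin 1 puts [-C, C] in the interior of [a, u], where the fundamental theorem yields a
   two-sided derivative. *)
move=> C0 ch; pose a := - C - 1; pose u := C + 1.
have au : a < u by rewrite /a /u; lra.
have iab : lebesgue_measure.-integrable `[a, u] (EFin \o h).
  apply: continuous_compact_integrable; first exact: segment_compact.
  exact: continuous_subspaceT.
pose H x := \int[lebesgue_measure]_(t in `[a, x]) h t.
have dH s : `|s| <= C -> derivable H s 1 /\ H^`()%classic s = h s.
  rewrite ler_norml => /andP[s1 s2].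
  apply: (continuous_FTC1_closed _ iab) => //; last exact: ch.
    by rewrite /u; lra.
  by rewrite /a; lra.
exists (fun x => H x - H 0); split=> [|s sC]; first exact: subrr.
have [d1 d2] := dH s sC.
rewrite (_ : (fun _ => _) = H \- cst (H 0)); last by [].
have d3 : is_derive s 1 H (h s) by rewrite -d2 derive1E; exact/derivableP.
by apply: is_derive_eq; rewrite subr0.
Qed.

(** * Weak derivatives and the chain rule in H^1_0 *)

Section sobolev.
Context {R : realType} {d : nat} (Omega : set 'rV[R]_d).
Local Notation E := 'rV[R]_d.
Local Notation leb := (lebesgue_rV d : {measure set E -> \bar R}).
Hypothesis oO : open Omega.
Hypothesis bO : bounded_set Omega.
Let mO : measurable Omega := open_measurable_rV oO.
Let fO : (leb Omega < +oo)%E := bounded_lty mO bO.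
Local Notation L2 := (L2 leb Omega).
Local Notation sqint := (sqint leb Omega).
Local Notation cvgL2 := (cvgL2 leb Omega).
Implicit Types (phi psi u v w : E -> R).

Lemma normL_sqint v : (normL Omega 2%:E v `^ 2 = sqint v)%E.
Proof.
rewrite /normL poweR_Lnorm ?pnatr_eq0// /sqint [RHS]integral_mkcond.
apply: eq_integral => x _ /=.
rewrite patchE; case: ifPn => xO; rewrite patchE ?xO ?(negbTE xO) ?normr0 /=.
  by rewrite powR_mulrn// real_normK// num_real.
by rewrite powR_mulrn// expr0n.
Qed.

Lemma normL_ge0 p v : (0 <= normL Omega p v)%E.
Proof. exact: Lnorm_ge0. Qed.

Lemma LpP v : Lp Omega 2%:E v <-> L2 v.
Proof.
split.
  move=> /andP[]; rewrite !inE /= /finite_norm => mv fv; split.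
    by apply/(measurable_restrictT _ mO).
  by rewrite -normL_sqint poweR2_lty// normL_ge0.
move=> [mv fv]; apply/andP; rewrite !inE /=; split.
  by apply/(measurable_restrictT _ mO).
by rewrite /finite_norm -[X in (X < _)%E]/(normL Omega 2%:E v) -poweR2_lty ?normL_ge0// normL_sqint.
Qed.

Lemma test_L2 phi : test_function Omega phi -> L2 phi.
Proof.
move=> tphi; have [C _ HC] := test_function_bounded tphi.
apply: (L2_bounded mO (c := C)) => //.
apply: measurable_funTS; apply: continuous_measurable_rV.
exact: test_function_continuous tphi.
Qed.

Lemma test_partial_L2 phi i : test_function Omega phi -> L2 (partial i phi).
Proof.
move=> tphi; have [C _ HC] := test_function_partial_bounded i tphi.
apply: (L2_bounded mO (c := C)) => //.
apply: measurable_funTS; apply: continuous_measurable_rV.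
exact: test_function_continuous_partial tphi.
Qed.

Lemma weak_partial_spec i v g : L2 g -> is_weak_partial Omega i v g ->
  L2 (weak_partial Omega i v) /\ is_weak_partial Omega i v (weak_partial Omega i v).
Proof.
move=> Lg wg; rewrite /weak_partial; case: xgetP => [h _ [Lh wh]|].
  by split => //; apply/LpP.
by move=> /(_ g)/=; case; split => //; apply/LpP.
Qed.

(** The difference is orthogonal to all test functions, and it is in L^1 because [Omega] is bounded,
    so the fundamental lemma applies. *)
Lemma weak_partial_unique i v g h : L2 g -> L2 h ->
  is_weak_partial Omega i v g -> is_weak_partial Omega i v h ->
  \forall x \ae leb, Omega x -> g x = h x.
Proof.
move=> Lg Lh wg wh.
have Lgh := L2B mO Lg Lh.
have : \forall x \ae leb, Omega x -> (g \- h) x = 0.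
  apply: (fundamental_lemma oO); first exact: (L2_integrable mO fO Lgh).
  move=> phi tphi; have Lp := test_L2 tphi.
  under eq_Rintegral do rewrite mulrBl.
  rewrite RintegralB//; try exact: L2_integrableM.
  apply/eqP; rewrite subr_eq0 -eqr_opp; apply/eqP.
  by rewrite -(wg _ tphi) -(wh _ tphi).
by apply: filterS => x H Ox; apply/eqP; rewrite -subr_eq0; apply/eqP; exact: H.
Qed.

Lemma weak_partialE i v g : L2 g -> is_weak_partial Omega i v g ->
  \forall x \ae leb, Omega x -> weak_partial Omega i v x = g x.
Proof.
move=> Lg wg; have [L w] := weak_partial_spec Lg wg.
exact: weak_partial_unique w wg.
Qed.

Lemma is_weak_partial_lin i (a : R) u v g h : L2 u -> L2 v -> L2 g -> L2 h ->
  is_weak_partial Omega i u g -> is_weak_partial Omega i v h ->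
  is_weak_partial Omega i (a *: u + v) (a *: g + h).
Proof.
move=> Lu Lv Lg Lh wg wh phi tphi.
have Lp := test_L2 tphi; have Lp' := test_partial_L2 i tphi.
have lin (p q r : E -> R) : L2 p -> L2 q -> L2 r ->
    \int[leb]_(x in Omega) ((a *: p + q) x * r x) =
    a * \int[leb]_(x in Omega) (p x * r x) + \int[leb]_(x in Omega) (q x * r x).
  move=> L1 L2 L3; rewrite -RintegralZl//; last exact: L2_integrableM.
  rewrite -RintegralD//; last exact: L2_integrableM.
    apply: eq_Rintegral => x _ /=.
    by rewrite -[(a *: p + q) x]/(a * p x + q x) mulrDl mulrA.
  rewrite (_ : EFin \o _ = (fun x => a%:E * (p x * r x)%:E)%E)//.
  by apply: integrableZl => //; exact: L2_integrableM.
by rewrite !lin// wg// wh// opprD mulrN.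
Qed.

Lemma H1P v : H1 Omega v -> L2 v /\
  forall i, L2 (weak_partial Omega i v) /\ is_weak_partial Omega i v (weak_partial Omega i v).
Proof.
move=> [/LpP Lv Hv]; split => // i; have [g [/LpP Lg wg]] := Hv i.
exact: weak_partial_spec wg.
Qed.

(** [weak_partial] selects a representative by choice, so its linearity can be claimed only almost
    everywhere. *)
Lemma H1_lin (a : R) u v : H1 Omega u -> H1 Omega v -> H1 Omega (a *: u + v) /\
  forall i, \forall x \ae leb, Omega x -> weak_partial Omega i (a *: u + v) x =
    a * weak_partial Omega i u x + weak_partial Omega i v x.
Proof.
move=> /H1P[Lu Wu] /H1P[Lv Wv].
have L i : L2 (a *: weak_partial Omega i u + weak_partial Omega i v).
  by apply: L2D => //; [apply: L2Z => //; exact: (Wu i).1|exact: (Wv i).1].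
have w i := is_weak_partial_lin a Lu Lv (Wu i).1 (Wv i).1 (Wu i).2 (Wv i).2.
split=> [|i]; last exact: weak_partialE (L i) (w i).
split; first by apply/LpP; apply: L2D => //; exact: L2Z.
by move=> i; exists (a *: weak_partial Omega i u + weak_partial Omega i v); split => //; apply/LpP.
Qed.

Lemma test_H1 phi : test_function Omega phi -> H1 Omega phi.
Proof.
move=> tphi; split; first by apply/LpP; exact: test_L2.
move=> i; exists (partial i phi); split; last exact: test_function_weak_partial.
by apply/LpP; exact: test_partial_L2.
Qed.

Lemma weak_partial_test phi i : test_function Omega phi ->
  \forall x \ae leb, Omega x -> weak_partial Omega i phi x = partial i phi x.
Proof.
move=> tphi; apply: weak_partialE; first exact: test_partial_L2.
exact: test_function_weak_partial.
Qed.

Lemma normH1_ge0 v : (0 <= normH1 Omega v)%E.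
Proof. exact: poweR_ge0. Qed.

Lemma normH1_sqint v : (normH1 Omega v `^ 2 =
  sqint v + \sum_(i < d) sqint (weak_partial Omega i v))%E.
Proof.
rewrite /normH1 -poweRrM mulVf ?pnatr_eq0// poweRe1.
  by rewrite normL_sqint; congr (_ + _)%E; apply: eq_bigr => i _; exact: normL_sqint.
by rewrite adde_ge0 ?poweR_ge0// sume_ge0// => i _; exact: poweR_ge0.
Qed.

Lemma cvg_normH1 (u : (E -> R)^nat) v : (forall n, H1 Omega (u n)) -> H1 Omega v ->
  normH1 Omega (u n - v) @[n --> \oo] --> 0%E <->
  (cvgL2 u v /\ forall i, cvgL2 (fun n => weak_partial Omega i (u n)) (weak_partial Omega i v)).
Proof.
move=> Hu Hv.
have NE n : (normH1 Omega (u n - v)%R `^ 2 = sqint (u n \- v)%R +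
    \sum_(i < d) sqint (weak_partial Omega i (u n) \- weak_partial Omega i v)%R)%E.
  rewrite normH1_sqint; congr (_ + _)%E; apply: eq_bigr => i _.
  have [Hb wb] := H1_lin (-1) Hv (Hu n).
  have E1 : -1 *: v + u n = u n - v by rewrite scaleN1r addrC.
  rewrite E1 in Hb wb.
  have [_ /(_ i)[[m1 _] _]] := H1P Hb.
  have [_ /(_ i)[Lu _]] := H1P (Hu n); have [_ /(_ i)[Lv _]] := H1P Hv.
  apply: sqint_ae => //; first exact: (measurable_funB Lu.1 Lv.1).
  by apply: filterS (wb i) => x H /H ->; rewrite mulN1r addrC.
rewrite cvg_poweR2; last by move=> n; exact: normH1_ge0.
under eq_fun do rewrite NE.
split=> [H|[H0 H]].
  split=> [|i].
    apply: squeeze0e H => n; rewrite sqint_ge0 leeDl// sume_ge0// => i _.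
    exact: sqint_ge0.
  apply: squeeze0e H => n; rewrite sqint_ge0/=.
  rewrite (bigD1 i)//=.
  apply: le_trans (leeDr _ (sqint_ge0 _ _ _)).
  by rewrite leeDl// sume_ge0// => j _; exact: sqint_ge0.
rewrite -[X in _ --> X](adde0 0%E); apply: cvgeD => //.
exact: cvg_sume0.
Qed.

(** The pointwise convergence, obtained on a subsequence, is what [cvgL2_mul] needs to pass to the
    limit in nonlinear factors such as g'(phi_n). *)
Lemma H10_approx v : H10 Omega v -> exists phi : nat -> E -> R,
  [/\ forall n, test_function Omega (phi n),
      cvgL2 phi v,
      forall i, cvgL2 (fun n => partial i (phi n)) (weak_partial Omega i v)
    & \forall x \ae leb, Omega x -> phi n x @[n --> \oo] --> v x].
Proof.
move=> [Hv [phi [tphi /cvg_normH1 []//]]]; first by move=> n; exact: test_H1.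
move=> c0 c1.
have Lp n := test_L2 (tphi n); have [Lv Wv] := H1P Hv.
have [k [kn kae]] := cvgL2_ae_subsequence mO Lp Lv c0.
exists (phi \o k); split => //.
- by move=> n; exact: tphi.
- exact: cvg_subseq kn c0.
move=> i; apply: (eq_cvgL2 _ (cvg_subseq kn (c1 i))) => n.
have [_ /(_ i)[L1 _]] := H1P (test_H1 (tphi (k n))).
have Lt := test_partial_L2 i (tphi (k n)).
apply: sqint_ae => //.
- exact: (measurable_funB Lt.1 (Wv i).1.1).
- exact: (measurable_funB L1.1 (Wv i).1.1).
by apply: filterS (weak_partial_test i (tphi (k n))) => x H /H /= ->.
Qed.

Lemma cvgL2_unit (f : (E -> R)^nat) g : (forall n, L2 (f n)) -> L2 g -> cvgL2 f g ->
  \int[leb]_(x in Omega) f n x @[n --> \oo] --> \int[leb]_(x in Omega) g x.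
Proof.
move=> Lf Lg fg.
have L1 : L2 (cst 1) by apply: (L2_bounded mO (c := 1)) => // x _; rewrite normr1.
have H := cvgL2_Rintegral mO Lf Lg L1 fg.
have E1 (h : E -> R) : \int[leb]_(x in Omega) (h x * cst 1 x) = \int[leb]_(x in Omega) h x.
  by apply: eq_Rintegral => x _; rewrite /= mulr1.
by move: H; rewrite E1; under eq_fun do rewrite E1.
Qed.

(** For test functions phi_n tending to v, the g(phi_n) are again test functions because g is smooth
    with g(0) = 0. They tend to g(v) by the Lipschitz bound, and their gradients tend to g'(v) times
    that of v, which identifies the weak derivative and gives membership in H^1_0. *)
Lemma chain_rule (g : R -> R) c v : Coo1 g -> g 0 = 0 ->
  (forall s, `|g^`()%classic s| <= c) -> H10 Omega v ->
  [/\ H10 Omega (g \o v),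
      forall i, \forall x \ae leb, Omega x ->
        weak_partial Omega i (g \o v) x =
        g^`()%classic (v x) * weak_partial Omega i v x
    & (normH1 Omega (g \o v) `^ 2 <= (c ^+ 2)%:E * normH1 Omega v `^ 2)%E].
Proof.
move=> Cg g0 gc Hv; have [phi [tphi c0 c1 cae]] := H10_approx Hv.
have [Lv Wv] := H1P Hv.1.
have c00 : 0 <= c by rewrite (le_trans _ (gc 0)).
have mg : measurable_fun setT g by apply: continuous_measurable_fun; exact: Coo1_continuous.
have mg' : measurable_fun setT g^`()%classic.
  by apply: continuous_measurable_fun; apply: Coo1_continuous; exact: Coo1_derive.
have lip a b : `|g a - g b| <= c * `|a - b|.
  wlog ba : a b / b <= a.
    move=> H; have [ba|/ltW ab] := leP b a; first exact: H.
    by rewrite distrC (distrC a); exact: H.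
  have [//|||s _ ->] := @MVT_segment _ g g^`()%classic b a.
  - by move=> s _; rewrite derive1E; apply/derivableP; exact: Coo1_derivable.
  - exact/continuous_subspaceT/Coo1_continuous.
  by rewrite normrM ler_wpM2r.
have tg n : test_function Omega (g \o phi n) by exact: test_function_comp.
have pg n i : partial i (g \o phi n) =
    (fun x => g^`()%classic (phi n x) * partial i (phi n) x).
  apply/funext => x; rewrite /partial.
  have [_ ->//] := is_derive_comp1 (Coo1_derivable Cg) (@test_function_derivable _ _ _ _ (tphi n) i x).
have cg0 : cvgL2 (fun n => g \o phi n) (g \o v).
  by apply: (cvgL2_lipschitz mO c00) => //; [move=> n; exact: (test_L2 (tphi n)).1|exact: Lv.1].
have cg1 i : cvgL2 (fun n => partial i (g \o phi n))
    (fun x => g^`()%classic (v x) * weak_partial Omega i v x).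
  under eq_fun do rewrite pg.
  apply: (cvgL2_mul mO gc) => //.
  - exact/Coo1_continuous/Coo1_derive.
  - by move=> n; exact: (test_L2 (tphi n)).1.
  - exact: Lv.1.
  - by move=> n; exact: test_partial_L2.
  - exact: (Wv i).1.
have Lgv : L2 (g \o v).
  apply: (L2_le mO (c := c) Lv); first exact: measurableT_comp Lv.1.
  by move=> x _ /=; have := lip (v x) 0; rewrite g0 !subr0.
have Lg'v i : L2 (fun x => g^`()%classic (v x) * weak_partial Omega i v x).
  apply: (L2M mO (c := c) (Wv i).1) => //.
  exact: measurableT_comp Lv.1.
have wg i : is_weak_partial Omega i (g \o v)
    (fun x => g^`()%classic (v x) * weak_partial Omega i v x).
  move=> psi tpsi.
  have h1 := cvgL2_Rintegral mO (fun n => test_L2 (tg n)) Lgv (test_partial_L2 i tpsi) cg0.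
  have h2 := cvgL2_Rintegral mO (fun n => test_partial_L2 i (tg n)) (Lg'v i) (test_L2 tpsi) (cg1 i).
  apply: (cvg_unique (@Rhausdorff R) h1).
  rewrite (_ : (fun n => _) = (fun n =>
    - \int[leb]_(x in Omega) (partial i (g \o phi n) x * psi x))); first exact: cvgN.
  by apply/funext => n; exact: (test_function_weak_partial i (tg n) tpsi).
have H1g : H1 Omega (g \o v).
  split; first exact/LpP.
  by move=> i; exists (fun x => g^`()%classic (v x) * weak_partial Omega i v x); split => //; exact/LpP.
have wpE i := weak_partialE (Lg'v i) (wg i).
split; [|exact: wpE|].
- split; first exact: H1g.
  exists (fun n => g \o phi n); split; first exact: tg.
  apply: (iffRL (cvg_normH1 _ H1g)); first by move=> n; exact: test_H1.
  split; [exact: cg0|move=> i]; apply: (eq_cvgL2 _ (cg1 i)) => n.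
  have [_ /(_ i)[L1 _]] := H1P (test_H1 (tg n)).
  have [_ /(_ i)[L3 _]] := H1P H1g.
  have Lt := test_partial_L2 i (tg n).
  apply: sqint_ae => //.
  - exact: (measurable_funB L1.1 L3.1).
  - exact: (measurable_funB Lt.1 (Lg'v i).1).
  by apply: filterS2 (weak_partial_test i (tg n)) (wpE i) => x H H' Ox /=; rewrite H// H'.
- rewrite !normH1_sqint ge0_muleDr ?sqint_ge0//; last first.
    by rewrite sume_ge0// => i _; exact: sqint_ge0.
  rewrite leeD//.
    apply: le_sqint => //; [exact: Lgv.1|exact: Lv.1|].
    by move=> x _ /=; have := lip (v x) 0; rewrite g0 !subr0.
  rewrite ge0_sume_distrr//; last by move=> i _; exact: sqint_ge0.
  apply: lee_sum => i _.
  have [_ /(_ i)[L3 _]] := H1P H1g.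
  rewrite (sqint_ae mO L3.1 (Lg'v i).1 (wpE i)); apply: le_sqint => //.
  + exact: (Lg'v i).1.
  + exact: (Wv i).1.1.
  + by move=> x _; rewrite normrM ler_wpM2r.
Qed.

(** With F a primitive of h, the integrand is the partial derivative of F(phi). As h is merely
    continuous, F(phi) is only C^1 and is handled by [C1c] rather than as a test function. *)
Lemma integral_divergence_test (h : R -> R) phi i : continuous h ->
  test_function Omega phi ->
  \int[leb]_(x in Omega) (h (phi x) * partial i phi x) = 0.
Proof.
move=> ch tphi; have [C C0 HC] := test_function_bounded tphi.
have [F [F0 dF]] := continuous_primitive C0 ch.
have dFp x : is_derive x (delta_mx 0 i : E) (F \o phi) (h (phi x) * partial i phi x).
  have d1 := dF _ (HC x).
  have := @is_derive_comp1 _ _ F phi x (delta_mx 0 i)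
    (@ex_derive _ _ _ _ _ _ _ d1) (@test_function_derivable _ _ _ _ tphi i x).
  by rewrite derive1E (@derive_val _ _ _ _ _ _ _ d1).
have pE : partial i (F \o phi) = (fun x => h (phi x) * partial i phi x).
  by apply/funext => x; rewrite /partial; have [_ ->] := dFp x.
have [K K0 HK] := test_function_cube tphi.
have c1 := test_function_continuous tphi.
have chp : continuous (h \o phi).
  by move=> y; apply: continuous_comp; [exact: c1|exact: ch].
have cp := @test_function_continuous_partial _ _ _ _ i tphi.
have Cc : C1c i (F \o phi).
  split.
  - move=> x; apply: (@continuous_comp _ _ _ phi F).
      exact: (test_function_continuous tphi).
    by apply/differentiable_continuous/derivable1_diffP; have [] := dF _ (HC x).
  - by rewrite pE => x; exact: cvgM (chp x) (cp x).
  - by move=> x; have [] := dFp x.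
  - by exists K => // x /HK px /=; rewrite px.
have := integral_partial0 Cc; rewrite pE => H0.
rewrite Rintegral_mkcond /Rintegral (_ : (fun x => _) =
  (fun x => (h (phi x) * partial i phi x)%:E)) ?H0//.
apply/funext => x; rewrite patchE; case: ifPn => // xO.
rewrite (test_function_partial_out i tphi) ?mulr0// => Ox.
by move/negP: xO; apply; rewrite inE.
Qed.

Lemma integral_divergence (h : R -> R) c v i : continuous h ->
  (forall s, `|h s| <= c) -> H10 Omega v ->
  \int[leb]_(x in Omega) (h (v x) * weak_partial Omega i v x) = 0.
Proof.
move=> ch hc Hv; have [phi [tphi c0 c1 cae]] := H10_approx Hv.
have [Lv Wv] := H1P Hv.1.
have mh := continuous_measurable_fun ch.
have Lh (u w : E -> R) : L2 u -> L2 w -> L2 (fun x => h (u x) * w x).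
  move=> Lu Lw; apply: (L2M mO (c := c) Lw) => //.
  exact: measurableT_comp Lu.1.
have cvg1 : cvgL2 (fun n x => h (phi n x) * partial i (phi n) x)
    (fun x => h (v x) * weak_partial Omega i v x).
  apply: (cvgL2_mul mO hc) => //.
  - by move=> n; exact: (test_L2 (tphi n)).1.
  - exact: Lv.1.
  - by move=> n; exact: test_partial_L2.
  - exact: (Wv i).1.
have := cvgL2_unit (fun n => Lh _ _ (test_L2 (tphi n)) (test_partial_L2 i (tphi n)))
  (Lh _ _ Lv (Wv i).1) cvg1.
rewrite (_ : (fun n => _) = cst 0); last first.
  by apply/funext => n; exact: integral_divergence_test.
by move=> /(cvg_unique (@Rhausdorff R) (cvg_cst _)) <-.
Qed.

End sobolev.

(** * Lower integrals and Bochner measurability *)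

Section lower_integral.
Context d (T : measurableType d) {R : realType} (mu : {measure set T -> \bar R}).
Local Open Scope ereal_scope.

(* The integral of a nonnegative function is a supremum over simple functions,
   so no measurability is needed. *)
Lemma ge0_le_integral_nomeas (D : set T) (f g : T -> \bar R) :
  (forall x, D x -> 0 <= f x) -> (forall x, D x -> f x <= g x) ->
  \int[mu]_(x in D) f x <= \int[mu]_(x in D) g x.
Proof.
move=> f0 fg; have g0 x : D x -> 0 <= g x by move=> Dx; exact: le_trans (f0 x Dx) (fg x Dx).
rewrite !ge0_integralE//; apply: ereal_sup_le => _ [h /= hf <-]; exists h => // x.
apply: le_trans (hf x) _; rewrite !patchE; case: ifPn => // /set_mem; exact: fg.
Qed.

(** The exceptional null set is removed from the integral of the measurable [f] alone; what remains
    is a pointwise comparison, valid for an arbitrary nonnegative [g]. *)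
Lemma ge0_ae_le_integral_meas (D : set T) (f g : T -> \bar R) : measurable D ->
  measurable_fun D f ->
  (forall x, D x -> 0 <= f x) -> (forall x, D x -> 0 <= g x) ->
  (\forall x \ae mu, D x -> f x <= g x) ->
  \int[mu]_(x in D) f x <= \int[mu]_(x in D) g x.
Proof.
move=> mD mf f0 g0 [N [mN muN fgN]]; rewrite (ge0_negligible_integral _ _ _ _ muN)//.
apply: (@le_trans _ _ (\int[mu]_(x in D `\` N) g x)).
  apply: ge0_le_integral_nomeas; first by move=> t [Dt _]; exact: f0.
  by move=> t [Dt Nt]; move/subsetCl : fgN; exact.
rewrite integral_mkcond [leRHS]integral_mkcond.
apply: ge0_le_integral_nomeas => x _; rewrite !patchE.
  by case: ifPn => // /set_mem[Dx _]; exact: g0.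
rewrite in_setD; case: (boolP (x \in D)) => //= /set_mem Dx.
by case: ifPn => // _; exact: g0.
Qed.
End lower_integral.

Section limn_esup_bounds.
Context {R : realType}.
Implicit Types (u : (\bar R)^nat) (c : \bar R).

Lemma limn_esup_le_near u c : (\forall n \near \oo, (u n <= c)%E) ->
  (limn_esup u <= c)%E.
Proof.
move=> [N _ H]; apply: ereal_inf_le; exists (ereal_sup (u @` [set n | (N <= n)%N])).
  by exists [set n | (N <= n)%N] => //; exists N.
by apply: ge_ereal_sup => _ [n Nn <-]; exact: H.
Qed.

Lemma limn_esup_ge_near u c : (\forall n \near \oo, (c <= u n)%E) ->
  (c <= limn_esup u)%E.
Proof.
move=> [N _ H]; apply: le_ereal_inf_tmp => _ [A [M _ MA] <-].
apply: (@le_trans _ _ (u (maxn N M))); first by apply: H; exact: leq_maxl.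
by apply: ereal_sup_ubound; exists (maxn N M) => //; apply: MA; exact: leq_maxr.
Qed.

End limn_esup_bounds.

Section quasi_measurable.
Context d (T : measurableType d) {R : realType} (mu : {measure set T -> \bar R}).
Variables (D : set T) (mD : measurable D).

Lemma lower_integral_lty (P l : T -> \bar R) :
  (forall t, 0 <= P t)%E -> (\int[mu]_(t in D) P t < +oo)%E ->
  measurable_fun D l -> (forall t, 0 <= l t)%E ->
  (\forall t \ae mu, D t -> (l t <= 4%:E * P t)%E) ->
  (\int[mu]_(t in D) l t < +oo)%E.
Proof.
move=> P0 iP ml l0 lP.
apply: (@le_lt_trans _ _ (4%:E * \int[mu]_(t in D) P t)%E); last first.
  by rewrite lte_mul_pinfty.
have step : (\int[mu]_(t in D) ((4^-1)%:E * l t) <= \int[mu]_(t in D) P t)%E.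
  apply: ge0_ae_le_integral_meas => //.
  - exact: measurable_funeM.
  - by move=> t _; rewrite mule_ge0// lee_fin invr_ge0.
  - apply: filterS lP => t H /H lt.
    have := lee_wpmul2l (_ : (0 <= (4^-1)%:E :> \bar R)%E) lt.
    rewrite lee_fin invr_ge0 => /(_ (ler0n _ _)) /le_trans; apply.
    by rewrite muleA -EFinM mulVf// mul1e.
rewrite ge0_integralZl// in step.
rewrite -[leLHS]mul1e (_ : 1%:E = 4%:E * (4^-1)%:E :> \bar R)%E.
  by rewrite -muleA; apply: lee_wpmul2l => //; rewrite lee_fin.
by rewrite -EFinM divff.
Qed.

(* Applied to [P t = N (u t) ^ 2]: the seminorm [N] is not
   known to be measurable along a Bochner measurable [u], but up to a factor 4
   it can be replaced by a limit of its values on simple functions. *)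
Lemma quasi_measurable (P : T -> \bar R) (q e : (T -> \bar R)^nat) :
  (forall n, measurable_fun D (q n)) ->
  (forall n t, 0 <= q n t)%E -> (forall t, 0 <= P t)%E -> (forall n t, 0 <= e n t)%E ->
  (\forall t \ae mu, D t -> e n t @[n --> \oo] --> 0%E) ->
  (\forall t \ae mu, D t -> forall n, P t <= 2%:E * q n t + 2%:E * e n t)%E ->
  (\forall t \ae mu, D t -> forall n, q n t <= 2%:E * P t + 2%:E * e n t)%E ->
  (forall l : T -> \bar R, measurable_fun D l -> (forall t, 0 <= l t)%E ->
    (\forall t \ae mu, D t -> (l t <= 4%:E * P t)%E) -> (\int[mu]_(t in D) l t < +oo)%E) ->
  exists k : T -> R, [/\ forall t, 0 <= k t, mu.-integrable D (EFin \o k),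
    measurable_fun D k
    & \forall t \ae mu, D t -> (P t <= (k t)%:E <= 4%:E * P t)%E].
Proof.
move=> mq q0 P0 e0 ae_e aeP aeq iP.
(* As e n t tends to 0, P <= 2 q + 2 e gives P <= l, and q <= 2 P + 2 e gives l <= 4 P. This is the
   origin of the factor 4. *)
pose l t := (2%:E * limn_esup (q ^~ t))%E.
have ml : measurable_fun D l by apply: measurable_funeM; exact: measurable_fun_limn_esup.
have l0 t : (0 <= l t)%E.
  by apply: mule_ge0 => //; apply: limn_esup_ge_near; apply: nearW.
have bnd : \forall t \ae mu, D t -> (P t <= l t <= 4%:E * P t)%E.
  apply: filterS3 ae_e aeP aeq => t + + + Dt.
  move=> /(_ Dt) et /(_ Dt) Pt /(_ Dt) qt.
  have small eps : 0 < eps -> \forall n \near \oo, (2%:E * e n t <= eps%:E)%E.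
    move=> eps0; have e20 : 0 < eps / 2 by rewrite divr_gt0.
    move/(cvge0P (fun n => e0 n t))/(_ _ e20) : et; apply: filterS => n H.
    rewrite (_ : eps%:E = 2%:E * (eps / 2)%:E)%E; first exact: lee_wpmul2l.
    by rewrite -EFinM mulrC divfK.
  apply/andP; split.
    apply/lee_addgt0Pr => eps /small H.
    have HP : (limn_esup (q ^~ t) = (2^-1)%:E * l t)%E.
      by rewrite /l muleA -EFinM mulVf// mul1e.
    have [n _ /(_ n (leqnn n)) _] := H.
    have lim_le : (P t - eps%:E <= l t)%E.
      have : ((2^-1)%:E * (P t - eps%:E) <= limn_esup (q ^~ t))%E.
        apply: limn_esup_ge_near; apply: filterS H => m Hm.
        rewrite -(@lee_pmul2l _ 2%:E)//.
        rewrite muleA -EFinM divff// mul1e leeBlDr//.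
        by apply: le_trans (Pt m) _; exact: leeD2l.
      rewrite HP lee_pmul2l//; by rewrite lte_fin invr_gt0.
    by rewrite -leeBlDr.
  apply/lee_addgt0Pr => eps eps0.
  have e20 : 0 < eps / 2 by rewrite divr_gt0.
  have H := small _ e20.
  have L : (limn_esup (q ^~ t) <= 2%:E * P t + (eps / 2)%:E)%E.
    apply: limn_esup_le_near; apply: filterS H => m Hm.
    by apply: le_trans (qt m) _; exact: leeD2l.
  have two0 : (0 <= 2%:E :> \bar R)%E by rewrite lee_fin.
  apply: (le_trans (lee_wpmul2l two0 L)).
  rewrite muleDr; [|by []|by rewrite fin_num_adde_defl].
  rewrite muleA -!EFinM (_ : 2 * (eps / 2) = eps); last by rewrite mulrC divfK.
  by rewrite -natrM.
have il : (\int[mu]_(t in D) l t < +oo)%E.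
  by apply: iP => //; apply: filterS bnd => t H /H /andP[].
have intl : mu.-integrable D l.
  by apply/integrableP; split => //; under eq_integral do rewrite gee0_abs//.
have finl := integrable_ae mD intl.
exists (fun t => fine (l t)).
have mk : measurable_fun D (fun t => fine (l t)) by exact: measurableT_comp.
split => //.
- by move=> t; rewrite fine_ge0.
- apply: le_integrable intl => //; first exact/measurable_EFinP.
  move=> t _ /=; rewrite (ger0_norm (fine_ge0 (l0 t))) (gee0_abs (l0 t)).
  by case: (l t) (l0 t) => //= _; exact: leey.
- by apply: filterS2 bnd finl => t H1 H2 Dt; rewrite fineK ?H2 ?H1.
Qed.

End quasi_measurable.

Section bochner_simple.
Context {R : realType} {V : lmodType R}.
Variables (X : set V) (I : set R).
Hypothesis mI : measurable (I : set (measurableTypeR R)).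
Hypothesis fI : (@lebesgue_measure R I < +oo)%E.
Variable s : R -> V.
Hypothesis ss : bochner_simple X I s.

(** A preimage is a finite union of level sets of [s], so [p] may be any map and [V] carries no
    sigma-algebra. *)
Lemma measurable_bochner_simple d (Y : measurableType d) (p : V -> Y) :
  measurable_fun (I : set (measurableTypeR R)) (p \o s).
Proof.
have [fs _ ms] := ss; move=> _ A mA.
rewrite (_ : _ `&` _ = \bigcup_(v in (s @` I) `&` p @^-1` A) (I `&` s @^-1` [set v])).
  apply: fin_bigcup_measurable; last by move=> v _; exact: ms.
  exact: finite_setIl.
apply/seteqP; split => [t [It At]|t [v [_ Av] [It /= sv]]].
  by exists (s t) => //; split => //; exists t.
by split => //=; rewrite sv.
Qed.

Let F (p : V -> R) (v : V) (t : R) : \bar R :=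
  ((p v)%:E * (\1_(I `&` s @^-1` [set v]) t)%:E)%E.

Let indic_integrable v :
  (@lebesgue_measure R).-integrable I (fun t => (\1_(I `&` s @^-1` [set v]) t)%:E).
Proof.
have [_ _ /(_ v) mv] := ss; apply/integrableP; split.
  by apply/measurable_EFinP; exact: measurable_funTS.
rewrite (eq_integral (fun t : measurableTypeR R => (\1_(I `&` s @^-1` [set v]) t)%:E)); last first.
  by move=> t _; rewrite gee0_abs// lee_fin.
rewrite integral_indic// setIAC setIid (le_lt_trans _ fI)//.
by apply: le_measure; [exact/mem_set|exact/mem_set|exact: subIsetl].
Qed.

Let F_integrable p v : (@lebesgue_measure R).-integrable I (F p v).
Proof.
by apply: integrableZl => //; exact: indic_integrable.
Qed.

Let simple_sum p t : I t ->
  (p (s t))%:E = (\sum_(v <- fset_set (s @` I)) F p v t)%E.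
Proof.
move=> It; have [fs _ ms] := ss.
have st : s t \in fset_set (s @` I) by rewrite in_fset_set//; apply/mem_set; exists t.
rewrite (bigD1_seq (s t))//=; last exact: fset_uniq.
rewrite big1 ?adde0.
  by rewrite /F indicE mem_set ?mule1.
by move=> v vst; rewrite /F indicE memNset ?mule0// => -[_ /= E]; rewrite E eqxx in vst.
Qed.

Lemma integrable_bochner_simple (p : V -> R) :
  (@lebesgue_measure R).-integrable I (EFin \o (p \o s)).
Proof.
apply: (eq_integrable mI (fun t => \sum_(v <- fset_set (s @` I)) F p v t)%E).
  by move=> t /set_mem It; rewrite /= simple_sum.
exact: integrable_sum.
Qed.

Lemma Rintegral_bochner_simple (p : V -> R) :
  \int[lebesgue_measure]_(t in I) p (s t) =
  \sum_(v <- fset_set (s @` I)) fine (lebesgue_measure (I `&` s @^-1` [set v])) * p v.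
Proof.
rewrite /Rintegral (eq_integral (fun t : measurableTypeR R => \sum_(v <- fset_set (s @` I)) F p v t)%E).
  rewrite integral_sum//.
  transitivity (fine (\sum_(v <- fset_set (s @` I))
      (fine (lebesgue_measure (I `&` s @^-1` [set v])) * p v)%:E)); last by rewrite sumEFin.
  congr fine; apply: eq_bigr => v _; rewrite (integralZl mI (indic_integrable v)).
  have [_ _ /(_ v) mv] := ss.
  rewrite (integral_indic _ mI mv) setIAC setIid EFinM muleC; congr (_ * _)%E.
  rewrite fineK// ge0_fin_numE; last exact: measure_ge0.
  apply: le_lt_trans fI.
  by apply: le_measure; [exact/mem_set|exact/mem_set|exact: subIsetl].
by move=> t /set_mem It; rewrite simple_sum.
Qed.

End bochner_simple.

(** * Functions of time *)

Section ae_lebesgue.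
Context {R : realType}.
Local Notation mu := (@lebesgue_measure R).
Implicit Types P Q S : R -> Prop.

Lemma aeS P Q : (forall t, P t -> Q t) ->
  (\forall t \ae mu, P t) -> \forall t \ae mu, Q t.
Proof. exact: (@filterS _ _ (ae_filter_ringOfSetsType mu)). Qed.

Lemma aeS2 P Q S : (forall t, P t -> Q t -> S t) ->
  (\forall t \ae mu, P t) -> (\forall t \ae mu, Q t) -> \forall t \ae mu, S t.
Proof. exact: (@filterS2 _ _ (ae_filter_ringOfSetsType mu)). Qed.

Lemma aeS3 P Q S S' : (forall t, P t -> Q t -> S t -> S' t) ->
  (\forall t \ae mu, P t) -> (\forall t \ae mu, Q t) -> (\forall t \ae mu, S t) ->
  \forall t \ae mu, S' t.
Proof. exact: (@filterS3 _ _ (ae_filter_ringOfSetsType mu)). Qed.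

Lemma ae_leb_forall (P : nat -> R -> Prop) : (forall n, \forall t \ae mu, P n t) ->
  \forall t \ae mu, forall n, P n t.
Proof. exact: ae_foralln. Qed.

End ae_lebesgue.

Section primitive.
Context {R : realType}.
Local Notation mu := (@lebesgue_measure R).
Implicit Types (p : R -> R).

Definition primitive p (x : R) : R := \int[mu]_(t in `]-oo, x]) p t.

Lemma primitiveB p (s t : R) : mu.-integrable setT (EFin \o p) -> s <= t ->
  primitive p t - primitive p s = \int[mu]_(r in `]s, t]) p r.
Proof.
move=> ip st; rewrite /primitive Rintegral_itvB//.
exact: integrableS ip.
Qed.

Lemma continuous_primitive_L1 p : mu.-integrable setT (EFin \o p) ->
  continuous (primitive p).
Proof.
move=> ip x; pose a := x - 1; pose b := x + 1.
have ab : a < b by rewrite /a /b; lra.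
have iab : mu.-integrable `[a, b] (EFin \o p) by exact: integrableS ip.
have /(continuous_within_itvP _ ab)[cI _ _] := parameterized_integral_continuous (ltW ab) iab.
have xab : x \in `]a, b[ by rewrite in_itv/= /a /b; apply/andP; split; lra.
have E y : a <= y -> primitive p y = primitive p a + \int[mu]_(t in `[a, y]) p t.
  move=> ay; have iay : mu.-integrable `]a, y] (EFin \o p) by exact: integrableS ip.
  by rewrite -Rintegral_itv_obnd_cbnd// -primitiveB// addrC subrK.
have cx : {for x, continuous (fun y => primitive p a + \int[mu]_(t in `[a, y]) p t)}.
  by apply: cvgD; [exact: cvg_cst|exact: cI].
rewrite /continuous_at E; last by rewrite /a; lra.
apply: cvg_trans cx; apply: near_eq_cvg; near=> y.
by rewrite [RHS]E//; apply: ltW; near: y; apply: lt_nbhsr; rewrite /a; lra.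
Unshelve. all: by end_near. Qed.

(** Lebesgue's differentiation theorem, the source of all Lebesgue points used below. *)
Lemma ae_derive_primitive p : mu.-integrable setT (EFin \o p) ->
  \forall x \ae mu, is_derive (x : R) 1 (primitive p) (p x).
Proof.
move=> ip; have ipy (y : R) : mu.-integrable `]-oo, y] (EFin \o p).
  exact: integrableS ip.
have lp := open_integrable_locally openT ip.
have := FTC1Ny ipy lp.
apply: aeS => x [dx ex].
by apply: DeriveDef; [exact: dx|rewrite -derive1E; exact: ex].
Qed.

End primitive.

Section quotients.
Context {R : realType}.
Local Notation mu := (@lebesgue_measure R).

Lemma cvg_backward_quotient (f : R -> R) (x l : R) (h : nat -> R) :
  is_derive x 1 f l -> (forall n, 0 < h n) -> h n @[n --> \oo] --> (0 : R) ->
  (f x - f (x - h n)) / h n @[n --> \oo] --> l.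
Proof.
move=> [df dl] h0 hc; rewrite -dl.
have hN : - h n @[n --> \oo] --> (0 : R)^'.
  have : - h n @[n --> \oo] --> (0 : R) by rewrite -oppr0; exact: cvgN.
  move=> H A /= [e e0 eA].
  have Hn : \forall n \near \oo, ball (0 : R) e (- h n) by exact: H (nbhsx_ballx _ _ e0).
  by apply: filterS Hn => n Hn; apply: eA => //; rewrite oppr_eq0 gt_eqF.
have := cvg_comp _ _ hN df.
rewrite (_ : _ \o _ = (fun n => (f x - f (x - h n)) / h n))//.
apply/funext => n /=; rewrite /shift/= [_%:A]mulr1 (addrC _ x).
by rewrite -[LHS]/(_ * _) invrN mulNr -mulrN opprB mulrC.
Qed.

Lemma Rintegral_derive (q Q : R -> R) (a b : R) : a < b -> continuous q ->
  (forall x, a <= x <= b -> is_derive x 1 Q (q x)) ->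
  \int[mu]_(x in `[a, b]) q x = Q b - Q a.
Proof.
move=> ab cq dQ.
have cQ x : a <= x <= b -> {for x, continuous Q}.
  by move=> /dQ[df _]; apply: differentiable_continuous; apply/derivable1_diffP.
have H := @continuous_FTC2 R q Q a b ab.
rewrite /Rintegral H//.
- exact: continuous_subspaceT.
- split.
  + move=> x; rewrite in_itv/= => /andP[/ltW ax /ltW xb].
    by have [] := dQ x; rewrite ?ax.
  + by apply: cvg_at_right_filter; apply: cQ; rewrite lexx ltW.
  + by apply: cvg_at_left_filter; apply: cQ; rewrite lexx ltW.
- move=> x; rewrite in_itv/= => /andP[/ltW ax /ltW xb].
  rewrite derive1E; have axb : a <= x <= b by rewrite ax.
  by have [_ ->] := dQ x axb.
Qed.

End quotients.

Section backward.
Context {R : realType}.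
Local Notation mu := (@lebesgue_measure R).

(* Fatou-type argument: the backward difference quotients of [primitive p - psi],
   corrected by [k], are nonnegative and their limit dominates [p + k]. *)
Lemma nonincreasing_backward (psi p k : R -> R) (a b : R) : 0 < a -> a < b ->
  continuous psi ->
  (forall x, 0 <= p x) -> (forall x, 0 <= k x) ->
  mu.-integrable setT (EFin \o p) -> mu.-integrable `[a, b] (EFin \o k) ->
  (\forall t \ae mu, `[a, b]%classic t -> forall s : R, 0 < s < t ->
    psi t - psi s <= primitive p t - primitive p s + (t - s) * k t) ->
  (\forall t \ae mu, `[a, b]%classic t -> forall e : R, 0 < e ->
    \forall s \near t^'-, psi t - psi s <= e * (t - s)) ->
  psi b <= psi a.
Proof.
move=> a0 ab cpsi p0 k0 ip ik HA HB.
(* The steps stay below a, so that t - h n is positive for every t in [a, b]. *)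
pose h (n : nat) : R := a / n.+2%:R.
have h0 n : 0 < h n by rewrite divr_gt0.
have ha n : h n < a by rewrite ltr_pdivrMr// ltr_pMr// ltr1n.
have hc : h n @[n --> \oo] --> (0 : R).
  rewrite -(mulr0 a); apply: cvgMr.
  have := @cvg_harmonic R; rewrite /harmonic => H.
  by have := cvg_comp _ _ (cvg_addnr 1) H; rewrite /comp/=; under eq_fun do rewrite addn1.
pose theta t := primitive p t - psi t.
have cP := continuous_primitive_L1 ip.
have cth : continuous theta by move=> x; apply: cvgB; [exact: cP|exact: cpsi].
pose q n t := (theta t - theta (t - h n)) / h n.
have cq n : continuous (q n).
  move=> x; apply: cvgMl; apply: cvgB; first exact: cth.
  have sc : y - h n @[y --> x] --> x - h n by apply: cvgB; [exact: cvg_id|exact: cvg_cst].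
  exact: (cvg_comp _ _ sc (cth _)).
pose D : set (measurableTypeR R) := `[a, b]%classic.
have mD : measurable D by exact: measurable_itv.
have iq n : mu.-integrable D (EFin \o q n).
  apply: continuous_compact_integrable; first exact: segment_compact.
  exact: continuous_subspaceT.
have ipD : mu.-integrable D (EFin \o p) by exact: integrableS ip.
(* Truncating from above by p + k gives 0 <= g n <= p + k almost everywhere, so that dominated
   convergence does the work of Fatou's lemma. *)
pose g n t := Num.min (q n t + k t) (p t + k t).
have iqk n : mu.-integrable D (EFin \o (fun t => q n t + k t)).
  by rewrite (_ : EFin \o _ = (EFin \o q n) \+ (EFin \o k))%E//; exact: integrableD.
have ipk : mu.-integrable D (EFin \o (fun t => p t + k t)).
  by rewrite (_ : EFin \o _ = (EFin \o p) \+ (EFin \o k))%E//; exact: integrableD.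
have mg n : measurable_fun D (g n).
  by apply: measurable_minr; apply/measurable_EFinP;
    [exact: (measurable_int _ (iqk n))|exact: (measurable_int _ ipk)].
have gp : \forall t \ae mu, forall n, D t -> (`|(g n t)%:E| <= (p t + k t)%:E)%E.
  apply: aeS HA => t H n Dt; rewrite [leLHS]/= lee_fin.
  have pk : 0 <= p t + k t by rewrite addr_ge0.
  have qk : 0 <= q n t + k t.
    have at_ : a <= t by move: Dt; rewrite /D/= in_itv/= => /andP[].
    have hn := h0 n; have hna := ha n.
    have /(H Dt) : 0 < t - h n < t by apply/andP; split; lra.
    have qE : h n * q n t = theta t - theta (t - h n) by rewrite /q mulrC divfK// gt_eqF.
    rewrite subKr -(pmulr_rge0 _ hn) mulrDr qE /theta; lra.
  by rewrite /g ger0_norm ?le_min ?qk// ge_min lexx orbT.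
have glim : \forall t \ae mu, D t -> (g n t)%:E @[n --> \oo] --> (p t + k t)%:E.
  apply: aeS2 (ae_derive_primitive ip) HB => t dp H Dt.
  apply: cvg_EFin; first exact: nearW.
  have qp := cvg_backward_quotient dp h0 hc.
  apply/cvgrPdist_le => e e0.
  have e20 : 0 < e / 2 by rewrite divr_gt0.
  move/cvgrPdist_le : (qp) => /(_ _ e20) qpe.
  have thn : t - h n @[n --> \oo] --> t^'-.
    have tc : t - h n @[n --> \oo] --> t.
      by rewrite -[X in _ --> X]subr0; apply: cvgB => //; exact: cvg_cst.
    move=> A /= HA'.
    have Hn : \forall n \near \oo, t - h n < t -> A (t - h n) by exact: (tc _ HA').
    by apply: filterS Hn => n; apply; rewrite ltrBlDr ltrDl.
  have := thn _ (H Dt _ e20); rewrite /= => psie.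
  near=> n.
  have hn := h0 n.
  have H1 : `|p t - (primitive p t - primitive p (t - h n)) / h n| <= e / 2.
    by near: n.
  have H2 : psi t - psi (t - h n) <= e / 2 * (t - (t - h n)) by near: n; exact: psie.
  have H3 : (psi t - psi (t - h n)) / h n <= e / 2.
    by rewrite ler_pdivrMr// (le_trans H2)//; lra.
  have qe : q n t = (primitive p t - primitive p (t - h n)) / h n -
      (psi t - psi (t - h n)) / h n.
    by rewrite /q /theta; lra.
  move: H1; rewrite ler_norml => /andP[H1 H1'].
  have m1 : g n t <= p t + k t by rewrite /g ge_min lexx orbT.
  have m2 : p t + k t - e <= g n t by rewrite /g le_min; apply/andP; split; lra.
  by change (`|p t + k t - g n t| <= e); rewrite ler_norml; apply/andP; split; lra.
have [_ _ dct] := @dominated_convergence _ _ _ mu D mD (fun n => EFin \o g n)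
  (EFin \o (fun t => p t + k t)) (EFin \o (fun t => p t + k t))
  (fun n => iffRL (measurable_EFinP _ _) (mg n))
  (measurable_int _ ipk) glim ipk gp.
have {dct} dct : \int[mu]_(t in D) g n t @[n --> \oo] --> \int[mu]_(t in D) (p t + k t).
  have fin := integrable_fin_num mD ipk.
  by move: dct; rewrite -(fineK fin) => /fine_cvgP[_].
(* The integral of a difference quotient of theta is a difference of quotients of its primitive Q at
   b and at a; these converge to theta b and theta a. *)
have [Q [_ dQ]] := @continuous_primitive R theta (b + 1) (ltr_wpDl (ltW (lt_trans a0 ab)) ltr01) cth.
have dQ' x : - b <= x <= b -> is_derive (x : R) 1 Q (theta x).
  by move=> /andP[xb bx]; apply: dQ; rewrite ler_norml; apply/andP; split; lra.
have hb n x : a <= x <= b -> is_derive (x : R) 1 Q (theta x) /\ is_derive (x - h n) 1 Q (theta (x - h n)).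
  move=> /andP[ax xb]; have hn := h0 n; have hna := ha n.
  by split; apply: dQ'; apply/andP; split; lra.
have intq n : \int[mu]_(t in D) q n t = (Q b - Q (b - h n)) / h n - (Q a - Q (a - h n)) / h n.
  pose Q1 t := (h n)^-1 * (Q t - Q (1 * t + - h n)).
  have dQ1 x : a <= x <= b -> is_derive (x : R) 1 Q1 (q n x).
    move=> axb; have [d1 d2] := hb n _ axb.
    have {}d2 : is_derive (1 * x + - h n) 1 Q (theta (x - h n)) by rewrite mul1r.
    have d3 := is_derive_affine_comp d2.
    by rewrite /Q1; apply: is_derive_eq; rewrite mul1r; exact: mulrC.
  by rewrite /D (Rintegral_derive ab (cq n) dQ1) /Q1 !mul1r; ring.
have intq_lim : \int[mu]_(t in D) q n t @[n --> \oo] --> theta b - theta a.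
  under eq_fun do rewrite intq.
  apply: cvgB; apply: cvg_backward_quotient => //.
    by apply: (hb 0 b _).1; rewrite lexx ltW.
  by apply: (hb 0 a _).1; rewrite lexx ltW.
have lim2 : \int[mu]_(t in D) q n t + \int[mu]_(t in D) k t @[n --> \oo] -->
    theta b - theta a + \int[mu]_(t in D) k t by apply: cvgD => //; exact: cvg_cst.
have : \int[mu]_(t in D) (p t + k t) <= theta b - theta a + \int[mu]_(t in D) k t.
  apply: (ler_cvg_to dct lim2); apply: nearW => n.
  rewrite -RintegralD//; apply: le_Rintegral => //.
  - have := integrableD mD (integrable_abse (iqk n)) (integrable_abse ipk).
    apply: le_integrable => //; first exact/measurable_EFinP.
    move=> t _; rewrite /= lee_fin [leRHS]ger0_norm ?addr_ge0// /g /Num.min.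
    by case: ifP => _; rewrite ?lerDl ?lerDr.
  - by move=> t _; rewrite /g ge_min lexx.
have -> : \int[mu]_(t in D) (p t + k t) = primitive p b - primitive p a + \int[mu]_(t in D) k t.
  rewrite RintegralD// primitiveB ?(ltW ab)// Rintegral_itv_obnd_cbnd//.
  exact: integrableS ip.
by rewrite /theta; lra.
Unshelve. all: by end_near. Qed.

End backward.

Section smooth_step.
Context {R : realType}.
Local Notation mu := (@lebesgue_measure R).

(** The normalised primitive of the bump exp(-1/x) exp(-1/(1-x)) on ]0, 1[. *)
Lemma smooth_step : exists S : R -> R, [/\ Coo1 S,
  forall x, x <= 0 -> S x = 0, forall x, 1 <= x -> S x = 1,
  forall x, 0 <= S x <= 1
  & forall x, 0 <= S^`()%classic x /\ (x <= 0 \/ 1 <= x -> S^`()%classic x = 0)].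
Proof.
pose rho x : R := flat 1 1 x * flat 1 1 (-1 * x + 1).
have Crho : Coo1 rho.
  have Ca := Coo1_affine (-1 : R) 1.
  by move=> n; apply: CkM; [exact: Coo1_flat|exact: (Ck_comp (Coo1_flat _ ltr01) (Ca n))].
have crho := Coo1_continuous Crho.
have rho0 x : 0 <= rho x by rewrite mulr_ge0// flat1_ge0.
have rho_out x : x <= 0 \/ 1 <= x -> rho x = 0.
  by rewrite /rho => -[x0|x1]; [rewrite flat0// mul0r|rewrite (@flat0 _ _ _ (-1 * x + 1)) ?mulr0//; lra].
have i01 : mu.-integrable `[0, 1] (EFin \o rho).
  by apply: continuous_compact_integrable; [exact: segment_compact|exact: continuous_subspaceT].
have irho : mu.-integrable setT (EFin \o rho).
  have -> : EFin \o rho = EFin \o (rho \_ `[0, 1]).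
    apply/funext => x; rewrite /= patchE; case: ifPn => //; rewrite notin_setE/= in_itv/=.
    move=> /negP; rewrite negb_and -!ltNge => /orP[/ltW ?|/ltW ?]; rewrite rho_out//; [by left|by right].
  by rewrite -restrict_EFin; apply/integrable_restrict => //=; rewrite setTI.
pose P := primitive rho.
have dP (x : R) : is_derive x 1 P (rho x).
  have xx : x < x + 1 by lra.
  have ix : mu.-integrable [set` Interval -oo%O (BRight (x + 1))] (EFin \o rho).
    exact: integrableS irho.
  have [d1 d2] := continuous_FTC1 xx ix (ltNyr _) (crho x).
  by apply: DeriveDef; [exact: d1|rewrite -derive1E; exact: d2].
have P0 x : x <= 0 -> P x = 0.
  move=> x0; rewrite /P /primitive (_ : Rintegral _ _ _ = \int[mu]_(t in `]-oo, x]) 0).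
    by rewrite Rintegral_cst// mul0r.
  apply: eq_Rintegral => t /set_mem; rewrite /= in_itv/= => tx.
  by rewrite rho_out//; left; exact: le_trans x0.
have Pnd x y : x <= y -> P x <= P y.
  move=> xy; rewrite -subr_ge0 primitiveB//; exact: Rintegral_ge0.
have P1 x : 1 <= x -> P x = P 1.
  move=> x1; apply/eqP; rewrite -subr_eq0 primitiveB// (_ : Rintegral _ _ _ = \int[mu]_(t in `]1, x]) 0).
    by rewrite Rintegral_cst// mul0r.
  apply: eq_Rintegral => t /set_mem; rewrite /= in_itv/= => /andP[/ltW t1 _].
  by rewrite rho_out//; right.
have P1_gt0 : 0 < P 1.
  rewrite lt_neqAle eq_sym; apply/andP; split; last by rewrite -(P0 0)// Pnd.
  (* A zero total integral would make the nondecreasing P identically 0, against a positive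
     derivative at 1/2. *)
  apply/eqP => P10.
  have Pz x : P x = 0.
    have [x0|x0] := leP x 0; first exact: P0.
    have [x1|/ltW x1] := leP x 1; last by rewrite P1.
    by apply/eqP; rewrite eq_le -{1}P10 Pnd//= -(P0 0)// Pnd// ltW.
  have := dP (2^-1); rewrite (_ : P = cst 0); last exact/funext.
  move=> [_]; rewrite derive_cst => /esym/eqP.
  by rewrite /rho mulf_eq0 !flat1E !ifT; [rewrite !gt_eqF// expR_gt0|lra|lra].
pose S x := (P 1)^-1 * P x.
have dS (x : R) : is_derive x 1 S ((P 1)^-1 * rho x).
  by rewrite /S; apply: is_derive_eq.
have S' x : S^`()%classic x = (P 1)^-1 * rho x.
  by rewrite derive1E; have [_ ->] := dS x.
exists S; split.
- apply: Coo1_primitive dS => n.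
  exact: (CkZ _ (Crho n)).
- by move=> x /P0 Px; rewrite /S Px mulr0.
- by move=> x /P1 Px; rewrite /S Px mulVf// gt_eqF.
- move=> x; rewrite /S mulr_ge0 ?invr_ge0 ?(ltW P1_gt0)//=; last first.
    have [x0|/ltW x0] := leP x 0; first by rewrite P0.
    by rewrite -(P0 0)// Pnd.
  rewrite mulrC ler_pdivrMr// mul1r.
  by have [/Pnd//|/ltW/P1 ->] := leP x 1.
- move=> x; rewrite S' mulr_ge0 ?invr_ge0 ?(ltW P1_gt0)//; split => //.
  by move=> /rho_out ->; rewrite mulr0.
Qed.

End smooth_step.
Lemma near_natSinv_le {R : realType} (e : R) : 0 < e ->
  \forall n \near \oo, n.+1%:R^-1 <= e.
Proof.
move=> e0; have := near_infty_natSinv_lt (PosNum e0).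
by apply: filterS => n /ltW.
Qed.

(** * From a distributional derivative in time to increments *)

Section du_bois_reymond.
Context {R : realType}.
Local Notation mu := (@lebesgue_measure R).
Variable S : R -> R.
Hypothesis CS : Coo1 S.
Hypothesis S0 : forall x, x <= 0 -> S x = 0.
Hypothesis S1 : forall x, 1 <= x -> S x = 1.
Hypothesis S01 : forall x, 0 <= S x <= 1.
Hypothesis S' : forall x,
  0 <= S^`()%classic x /\ (x <= 0 \/ 1 <= x -> S^`()%classic x = 0).

(** A smooth version of the indicator of ]s, +oo[, rising from 0 to 1 over [s, s + 1/(n+1)]. *)
Definition step (n : nat) (s r : R) : R := S (n.+1%:R * r + - (n.+1%:R * s)).
Definition dstep (n : nat) (s r : R) : R :=
  n.+1%:R * S^`()%classic (n.+1%:R * r + - (n.+1%:R * s)).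

Lemma is_derive_step n s r : is_derive (r : R) 1 (step n s) (dstep n s r).
Proof.
rewrite /step /dstep; apply: is_derive_affine_comp.
by apply: DeriveDef; [exact: Coo1_derivable|rewrite derive1E].
Qed.

Lemma Coo1_step n s : Coo1 (step n s).
Proof. by move=> m; exact: (Ck_comp CS (Coo1_affine _ _ m)). Qed.

Lemma continuous_dstep n s : continuous (dstep n s).
Proof.
have := Coo1_continuous (Coo1_derive (Coo1_step n s)).
rewrite (_ : (step n s)^`()%classic = dstep n s)//.
by apply/funext => r; rewrite derive1E; have [_ ->] := is_derive_step n s r.
Qed.

Lemma dstep_ge0 n s r : 0 <= dstep n s r.
Proof. by rewrite mulr_ge0//; have [] := S' (n.+1%:R * r + - (n.+1%:R * s)). Qed.

Lemma dstep0 n s r : r <= s \/ s + n.+1%:R^-1 <= r -> dstep n s r = 0.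
Proof.
move=> H; rewrite /dstep; have [_ ->] := S' (n.+1%:R * r + - (n.+1%:R * s)); first by rewrite mulr0.
rewrite -mulrBr; case: H => H; [left|right].
  by rewrite pmulr_rle0// subr_le0.
by rewrite mulrC -ler_pdivrMr// mul1r lerBrDl.
Qed.

Lemma step0 n s r : r <= s -> step n s r = 0.
Proof. by move=> rs; rewrite /step S0// -mulrBr pmulr_rle0// subr_le0. Qed.

Lemma step1 n s r : s + n.+1%:R^-1 <= r -> step n s r = 1.
Proof.
by move=> H; rewrite /step S1// -mulrBr mulrC -ler_pdivrMr// mul1r lerBrDl.
Qed.

Lemma step_cvg s r : step n s r @[n --> \oo] --> (if s < r then 1 else 0 : R).
Proof.
case: ltP => sr; last first.
  by rewrite (_ : step ^~ s ^~ r = cst 0); [exact: cvg_cst|apply/funext => n; rewrite step0].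
apply: cvg_near_cst.
have rs : 0 < r - s by rewrite subr_gt0.
apply: filterS (near_natSinv_le rs) => n H.
by rewrite step1// -lerBrDl.
Qed.

(** The functions [dstep n s] form an approximate identity at s: nonnegative, supported in
    [s, s + 1/(n+1)], and of integral 1 over [0, T] once n is large. *)
Lemma dstep_cvg (F : R -> R) (s T : R) : continuous F -> 0 < s < T ->
  \int[mu]_(r in `[0, T]) (dstep n s r * F r) @[n --> \oo] --> F s.
Proof.
move=> cF /andP[s0 sT].
have T0 : 0 < T by exact: lt_trans sT.
apply/cvgrPdist_le => e e0.
have /cvgrPdist_le/(_ _ e0) := cF s; move=> [del /= del0 Hdel].
have Ts0 : 0 < T - s by rewrite subr_gt0.
near=> n.
have nd : n.+1%:R^-1 < del by near: n; exact: (near_infty_natSinv_lt (PosNum del0)).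
have nT : s + n.+1%:R^-1 <= T by rewrite -lerBrDl; near: n; exact: near_natSinv_le.
have I1 : \int[mu]_(r in `[0, T]) dstep n s r = 1.
  rewrite (Rintegral_derive T0 (@continuous_dstep n s) (fun x _ => is_derive_step n s x)).
  by rewrite step1// step0 ?subr0// ltW.
have ic (h : R -> R) : continuous h -> mu.-integrable `[0, T] (EFin \o h).
  by move=> ch; apply: continuous_compact_integrable; [exact: segment_compact|exact: continuous_subspaceT].
have cd := @continuous_dstep n s.
have cdF : continuous (fun r => dstep n s r * F r) by move=> x; apply: cvgM; [exact: cd|exact: cF].
have cdFs : continuous (fun r => dstep n s r * F s) by move=> x; apply: cvgM; [exact: cd|exact: cvg_cst].
have -> : F s = \int[mu]_(r in `[0, T]) (dstep n s r * F s).
  by rewrite RintegralZr// ?I1 ?mul1r//; exact: ic.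
rewrite -RintegralB//; [|exact: ic|exact: ic].
have cD : continuous (fun r => dstep n s r * F s - dstep n s r * F r).
  by move=> x; apply: cvgB; [exact: cdFs|exact: cdF].
apply: (le_trans (le_normr_Rintegral _ (ic _ cD))) => //.
have -> : e = \int[mu]_(r in `[0, T]) (dstep n s r * e).
  by rewrite RintegralZr// ?I1 ?mul1r//; exact: ic.
apply: le_Rintegral => //.
- apply: (ic (fun r => `|dstep n s r * F s - dstep n s r * F r|)).
  by move=> x; exact: (cvg_norm (cD x)).
- by apply: ic => x; apply: cvgM; [exact: cd|exact: cvg_cst].
move=> r _; rewrite -mulrBr normrM (ger0_norm (dstep_ge0 _ _ _)).
have [rs|sr] := leP r s; first by rewrite dstep0 ?mul0r//; left.
have [nr|rn] := leP (s + n.+1%:R^-1) r; first by rewrite dstep0 ?mul0r//; right.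
rewrite ler_wpM2l ?dstep_ge0//; apply: Hdel.
by rewrite /ball_/= ltr0_norm ?subr_lt0// opprB ltrBlDl (lt_trans rn)// ltrD2l.
Unshelve. all: by end_near. Qed.

(** Test with the smooth version of the indicator of ]s, t]: its derivative tends to the Dirac mass
    at s minus the one at t, so the left side tends to F s - F t and the right side to minus the
    integral of G. *)
Lemma du_bois_reymond_step (T : R) (F G : R -> R) (s t : R) : continuous F ->
  mu.-integrable `]0, T[ (EFin \o G) ->
  (forall phi, time_test_function T phi ->
    \int[mu]_(r in `]0, T[) (phi^`()%classic r * F r) =
    - \int[mu]_(r in `]0, T[) (phi r * G r)) ->
  0 < s -> s < t -> t < T ->
  F t - F s = \int[mu]_(r in `]s, t]) G r.
Proof.
move=> cF iG H s0 st tT.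
have mI : measurable (`]0, T[%classic : set (measurableTypeR R)) by exact: measurable_itv.
have T0 : 0 < T by apply: lt_trans tT; apply: lt_trans st.
have Tt0 : 0 < T - t by rewrite subr_gt0.
pose phi n r := step n s r - step n t r.
have Cphi n : Coo1 (phi n).
  by move=> m; apply: (CkD (Coo1_step n s m)); exact: (CkN (Coo1_step n t m)).
have dphi n : (phi n)^`()%classic = fun r => dstep n s r - dstep n t r.
  apply/funext => r; rewrite derive1E.
  have d1 := is_derive_step n s r; have d2 := is_derive_step n t r.
  by have [_ ->] := is_deriveB d1 d2.
have phi_out n r : r <= s \/ t + n.+1%:R^-1 <= r -> phi n r = 0.
  rewrite /phi => -[rs|rt].
    by rewrite !step0 ?subr0// (le_trans rs)// ltW.
  by rewrite !step1 ?subrr// (le_trans _ rt)// lerD2r ltW.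
(* The support reaches t + 1/(n+1), which lies below T only for large n. *)
have tphi : \forall n \near \oo, time_test_function T (phi n).
  have T20 : 0 < (T - t) / 2 by rewrite divr_gt0.
  apply: filterS (near_natSinv_le T20) => n Hn.
  have sub : closure [set r | phi n r != 0] `<=` `[s, t + n.+1%:R^-1].
    rewrite [X in _ `<=` X](closure_id _).1; last exact: interval_closed.
    apply: closure_subset => r /= pr; rewrite in_itv/=; apply/andP; split; apply/ltW; rewrite ltNge; apply/negP => Hr.
      by move/eqP : pr; apply; apply: phi_out; left.
    by move/eqP : pr; apply; apply: phi_out; right.
  split.
  - exact: Coo1_derive1n.
  - apply: subclosed_compact sub; [exact: closed_closure|exact: segment_compact].
  - apply: subset_trans sub _ => r /=; rewrite !in_itv/= => /andP[sr rt].
    rewrite (lt_le_trans s0 sr)/= (le_lt_trans rt)// -ltrBrDl (le_lt_trans Hn)//.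
    by rewrite ltr_pdivrMr// mulr_natr mulr2n ltrDl.
have L1 : \int[mu]_(r in `]0, T[) ((phi n)^`()%classic r * F r) @[n --> \oo] --> F s - F t.
  have ic (h : R -> R) : continuous h -> mu.-integrable `[0, T] (EFin \o h).
    by move=> ch; apply: continuous_compact_integrable; [exact: segment_compact|exact: continuous_subspaceT].
  have cdF n x : continuous (fun r => dstep n x r * F r).
    by move=> y; apply: cvgM; [exact: continuous_dstep|exact: cF].
  rewrite (_ : (fun n => _) = fun n => \int[mu]_(r in `[0, T]) (dstep n s r * F r) -
      \int[mu]_(r in `[0, T]) (dstep n t r * F r)).
    by apply: cvgB; apply: dstep_cvg => //; apply/andP; split; lra.
  apply/funext => n; rewrite -RintegralB//; [|exact: ic|exact: ic].
  have iD : mu.-integrable `[0, T] (EFin \o (fun r => dstep n s r * F r - dstep n t r * F r)).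
    by apply: ic => x; apply: cvgB; exact: cdF.
  rewrite -Rintegral_itv_obnd_cbnd; last first.
    by apply: integrableS iD => // r /=; rewrite !in_itv/= => /andP[/ltW -> ->].
  rewrite -Rintegral_itv_bndo_bndc; last first.
    by apply: integrableS iD => //; exact: subset_itv_oo_cc.
  by apply: eq_Rintegral => r _; rewrite dphi mulrBl.
have L2 : \int[mu]_(r in `]0, T[) (phi n r * G r) @[n --> \oo] --> \int[mu]_(r in `]s, t]) G r.
  have mG : measurable_fun `]0, T[ G by apply/measurable_EFinP; exact: (measurable_int _ iG).
  pose g n r := phi n r * G r; pose l r := (if (s < r <= t) then 1 else 0) * G r.
  have mphi n : measurable_fun `]0, T[ (phi n).
    by apply: measurable_funTS; apply: continuous_measurable_fun; exact: (Coo1_continuous (Cphi n)).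
  have mg n : measurable_fun `]0, T[ (EFin \o g n).
    by apply/measurable_EFinP; exact: measurable_funM (mphi n) mG.
  have cg r : g n r @[n --> \oo] --> l r.
    apply: cvgM; last exact: cvg_cst.
    have E : (if s < r then 1 else 0) - (if t < r then 1 else 0) = (if s < r <= t then 1 else 0) :> R.
      by case: (ltP s r) => sr; case: (ltP t r) => tr //=; rewrite ?subrr ?subr0//; exfalso; lra.
    by rewrite -E; exact: (cvgB (@step_cvg s r) (@step_cvg t r)).
  have cgE r : `]0, T[%classic r -> (g n r)%:E @[n --> \oo] --> (l r)%:E.
    by move=> _; apply: cvg_EFin; [exact: nearW|exact: cg].
  have lE : l = G \_ `]s, t].
    apply/funext => r; rewrite /l patchE mem_setE in_itv/=.
    by case: ifPn => _; rewrite ?mul1r ?mul0r.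
  have subst_ : `]s, t]%classic `<=` `]0, T[%classic.
    by move=> r /=; rewrite !in_itv/= => /andP[sr rt]; apply/andP; split; lra.
  have il : mu.-integrable `]0, T[ (EFin \o l).
    rewrite lE -restrict_EFin; apply/integrable_restrict => //.
    by rewrite setIidr//; exact: integrableS iG.
  have bd n r : `]0, T[%classic r -> (`|(g n r)%:E| <= `|(G r)%:E|)%E.
    move=> _; rewrite lee_fin /g normrM ler_piMl// /phi.
    have := S01 (n.+1%:R * r + - (n.+1%:R * s)); have := S01 (n.+1%:R * r + - (n.+1%:R * t)).
    rewrite -/(step n s r) -/(step n t r) => /andP[p1 p2] /andP[p3 p4].
    by rewrite ler_norml; apply/andP; split; lra.
  have [_ _ dct] := @dominated_convergence _ _ _ mu _ mI (fun n => EFin \o g n)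
    (EFin \o l) (fun r => `|(G r)%:E|)%E mg (measurable_int _ il)
    (aeW mu cgE) (integrable_abse iG)
    (aeW mu (fun r n => bd n r)).
  have {dct} : \int[mu]_(r in `]0, T[) g n r @[n --> \oo] --> \int[mu]_(r in `]0, T[) l r.
    have fin := integrable_fin_num mI il.
    by move: dct; rewrite -(fineK fin) => /fine_cvgP[_].
  rewrite lE -Rintegral_mkcondr setIidr//.
have L1' : \int[mu]_(r in `]0, T[) ((phi n)^`()%classic r * F r) @[n --> \oo] --> - \int[mu]_(r in `]s, t]) G r.
  apply: cvg_trans (cvgN L2); apply: near_eq_cvg.
  by apply: filterS tphi => n /H ->.
have := cvg_unique (@Rhausdorff R) L1 L1'.
by move=> E; rewrite -[LHS]opprB E opprK.
Qed.

End du_bois_reymond.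

Lemma du_bois_reymond {R : realType} (T : R) (F G : R -> R) (s t : R) : continuous F ->
  (@lebesgue_measure R).-integrable `]0, T[ (EFin \o G) ->
  (forall phi, time_test_function T phi ->
    \int[lebesgue_measure]_(r in `]0, T[) (phi^`()%classic r * F r) =
    - \int[lebesgue_measure]_(r in `]0, T[) (phi r * G r)) ->
  0 < s -> s < t -> t < T ->
  F t - F s = \int[lebesgue_measure]_(r in `]s, t]) G r.
Proof. by have [S [CS S0 S1 S01 S']] := @smooth_step R; exact: (du_bois_reymond_step CS). Qed.

(** * The dual of H^1_0 and the energy identity *)

Section dual.
Context {R : realType} {d : nat} (Omega : set 'rV[R]_d).
Local Notation E := 'rV[R]_d.
Local Notation leb := (lebesgue_rV d : {measure set E -> \bar R}).
Hypothesis oO : open Omega.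
Hypothesis bO : bounded_set Omega.
Let mO : measurable Omega := open_measurable_rV oO.
Local Notation L2 := (L2 leb Omega).
Local Notation sqint := (sqint leb Omega).
Local Notation H10 := (H10 Omega).
Local Notation normH1 := (normH1 Omega).
Local Notation normHm1 := (normHm1 Omega).
Local Notation wp := (weak_partial Omega).

Lemma normH1_lin_le (c : R) v w : H1 Omega v -> H1 Omega w ->
  (normH1 (c *: v + w)%R `^ 2 <=
    2%:E * ((c ^+ 2)%:E * normH1 v `^ 2) + 2%:E * normH1 w `^ 2)%E.
Proof.
move=> Hv Hw; have [Hb wb] := H1_lin oO bO c Hv Hw.
have [Lv Wv] := H1P oO Hv; have [Lw Ww] := H1P oO Hw.
have [Lb Wb] := H1P oO Hb.
have lin f g : L2 f -> L2 g ->
    (sqint (c *: f + g)%R <= 2%:E * ((c ^+ 2)%:E * sqint f) + 2%:E * sqint g)%E.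
  move=> Lf Lg; have Lcf := L2Z mO c Lf.
  have H := sqintD leb mO Lcf.1 Lg.1; apply: (le_trans H); rewrite leeD2r// lee_wpmul2l//.
  have -> : sqint (fun x => c * f x) = (\int[leb]_(x in Omega) ((c ^+ 2)%:E * (f x ^+ 2)%:E))%E.
    by apply: eq_integral => x _; rewrite -EFinM exprMn.
  rewrite ge0_integralZl//; last by rewrite lee_fin sqr_ge0.
    by apply: measurable_sq; exact: Lf.1.
  by move=> x _; rewrite lee_fin sqr_ge0.
rewrite !normH1_sqint.
have S0 (f : E -> R) : (0 <= \sum_(i < d) sqint (wp i f))%E by apply: sume_ge0 => i _; exact: sqint_ge0.
have k0 : (0 <= (c ^+ 2)%:E)%E by rewrite lee_fin sqr_ge0.
have distr (k x y z t : \bar R) : (0 <= k -> 0 <= x -> 0 <= y -> 0 <= z -> 0 <= t ->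
    2%:E * (k * (x + y)) + 2%:E * (z + t) = (2%:E * (k * x) + 2%:E * z) + (2%:E * (k * y) + 2%:E * t))%E.
  by move=> k0' x0 y0 z0 t0; rewrite !ge0_muleDr ?mule_ge0// addeACA.
have distr_sum (k : \bar R) (x y : 'I_d -> \bar R) : (0 <= k)%E -> (forall i, 0 <= x i)%E -> (forall i, 0 <= y i)%E ->
    (2%:E * (k * \sum_(i < d) x i) + 2%:E * \sum_(i < d) y i = \sum_(i < d) (2%:E * (k * x i) + 2%:E * y i))%E.
  move=> k0' x0 y0; rewrite !ge0_sume_distrr//; last by move=> i _; exact: mule_ge0.
  by rewrite -big_split.
rewrite distr ?sqint_ge0//; apply: leeD; first exact: lin.
rewrite distr_sum//; try by move=> i; exact: sqint_ge0.
apply: lee_sum => i _.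
rewrite (@sqint_ae _ _ _ _ _ mO _ (c *: wp i v + wp i w)).
- by apply: lin; [exact: (Wv i).1|exact: (Ww i).1].
- exact: (Wb i).1.1.
- by have [] := L2D mO (L2Z mO c (Wv i).1) (Ww i).1.
- exact: wb.
Qed.

(** This is the chain rule for the linear function x -> a x. *)
Lemma H10_scale (a : R) v : H10 v -> H10 (a *: v) /\
  (normH1 (a *: v)%R `^ 2 <= (a ^+ 2)%:E * normH1 v `^ 2)%E.
Proof.
move=> Hv; have g0 : a * 0 + 0 = 0 :> R by rewrite mulr0 addr0.
have ga (s : R) : `|(fun x => a * x + 0)^`()%classic s| <= `|a|.
  by rewrite derive1E; have [_ ->] := is_derive_affine a 0 s.
have := chain_rule oO bO (Coo1_affine a 0) g0 ga Hv.
rewrite (_ : _ \o v = a *: v); last by apply/funext => x /=; rewrite addr0.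
rewrite (real_normK (num_real a)) => H; split; [by case: H|by case: H].
Qed.

Definition linear_form (l : (E -> R) -> R) := forall (a : R) v w,
  H10 v -> H10 w -> l (a *: v + w) = a * l v + l w.

Lemma linear_form_homogeneous l (a : R) v : linear_form l -> H10 v -> l (a *: v) = a * l v.
Proof.
move=> ll Hv; have [H0 _] := H10_scale 0 Hv; rewrite scale0r in H0.
have := ll 0 _ _ H0 H0; rewrite scale0r addr0 mul0r add0r => l00.
have l0 : l 0 = 0.
  by have := ll 1 _ _ H0 H0; rewrite scale1r addr0 mul1r => /eqP; rewrite -subr_eq0 opprD addNKr oppr_eq0 => /eqP.
by have := ll a _ _ Hv H0; rewrite addr0 l0 addr0.
Qed.

(** Rescale v into the unit ball. A positive upper bound b stands for the norm of v, so that a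
    vanishing norm needs no separate treatment. *)
Lemma le_dual l v (b : R) : linear_form l -> H10 v -> 0 < b ->
  (normH1 v `^ 2 <= (b ^+ 2)%:E)%E -> (`|l v|%:E <= b%:E * normHm1 l)%E.
Proof.
move=> ll Hv b0 vb; have [Hw Nw] := H10_scale b^-1 Hv.
have Nw1 : (normH1 (b^-1 *: v)%R <= 1)%E.
  rewrite -poweR2_le ?poweR_ge0// expr1n (le_trans Nw)//.
  apply: (@le_trans _ _ ((b^-1 ^+ 2)%:E * (b ^+ 2)%:E)%E).
    by apply: lee_wpmul2l => //; rewrite lee_fin sqr_ge0.
  by rewrite -EFinM lee_fin -exprMn mulVf ?expr1n// gt_eqF.
have : (`|l (b^-1 *: v)%R|%:E <= normHm1 l)%E.
  by apply: ereal_sup_ubound; exists (b^-1 *: v).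
have bi : 0 <= b^-1 by rewrite invr_ge0 ltW.
rewrite (linear_form_homogeneous _ ll Hv) normrM (ger0_norm bi).
have b0' : (0 <= b%:E)%E by rewrite lee_fin ltW.
move=> /(lee_wpmul2l b0'); by rewrite -EFinM mulrA divff ?mul1r// gt_eqF.
Qed.

(** Membership of 0 in H^1_0 ensures that the supremum is not taken over the empty set, where it
    would be -oo. *)
Lemma normHm1_ge0 l : H10 0 -> (0 <= normHm1 l)%E.
Proof.
move=> H0; apply: (@le_trans _ _ `|l 0|%:E); first by rewrite lee_fin.
apply: ereal_sup_ubound; exists 0 => //; split => //.
have [_] := H10_scale 0 H0; rewrite scale0r expr0n/= mul0e.
have -> : 0%E = (0 ^+ 2 : R)%:E by rewrite expr0n.
by rewrite poweR2_le ?poweR_ge0// => /le_trans; apply; rewrite lee_fin.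
Qed.

Lemma normHm1_triangle (l m : (E -> R) -> R) :
  (normHm1 l <= normHm1 m + normHm1 (l - m)%R)%E.
Proof.
apply: ge_ereal_sup => _ [v Hv <-].
apply: (@le_trans _ _ (`|m v|%:E + `|(l - m) v|%:E)%E).
  rewrite -EFinD lee_fin (_ : l v = m v + (l - m) v); first exact: ler_normD.
  by rewrite /= addrC; exact/esym/subrK.
by apply: leeD; apply: ereal_sup_ubound; exists v.
Qed.

Lemma normHm1N (l m : (E -> R) -> R) : normHm1 (l - m) = normHm1 (m - l).
Proof.
congr ereal_sup; apply: eq_imagel => v _; congr EFin.
exact: (distrC (l v) (m v)).
Qed.

Lemma normHm1_sq_triangle (l m : (E -> R) -> R) : H10 0 ->
  (normHm1 l `^ 2 <= 2%:E * normHm1 m `^ 2 + 2%:E * normHm1 (l - m)%R `^ 2)%E.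
Proof.
move=> H0; have := normHm1_triangle l m.
have := normHm1_ge0 l H0; have := normHm1_ge0 m H0; have := normHm1_ge0 (l - m) H0.
move: (normHm1 l) (normHm1 m) (normHm1 (l - m)) => a b c c0 b0 a0 abc.
have [boo|boo] := eqVneq b +oo%E; first by rewrite boo /= pnatr_eq0/= gt0_muley ?addye ?leey ?lte_fin// -ltNye (lt_le_trans _ (mule_ge0 _ (poweR_ge0 _ _))).
have [coo|coo] := eqVneq c +oo%E; first by rewrite coo /= pnatr_eq0/= gt0_muley ?addey ?leey ?lte_fin// -ltNye (lt_le_trans _ (mule_ge0 _ (poweR_ge0 _ _))).
have bf : b \is a fin_num by rewrite ge0_fin_numE// lt_neqAle boo leey.
have cf : c \is a fin_num by rewrite ge0_fin_numE// lt_neqAle coo leey.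
have af : a \is a fin_num by rewrite ge0_fin_numE// (le_lt_trans abc)// ltey_eq fin_numD bf cf.
rewrite !poweR2_fin -?ge0_fin_numE// -!EFinM -EFinD lee_fin.
move: abc a0 b0 c0; rewrite -(fineK af) -(fineK bf) -(fineK cf) -EFinD !lee_fin !fineK//.
move: (fine a) (fine b) (fine c) => x y z xyz x0 y0 z0.
have : x ^+ 2 <= (y + z) ^+ 2 by rewrite lerXn2r// nnegrE addr_ge0.
have := sqr_ge0 (y - z); lra.
Qed.

End dual.

Section H10_elements.
Context {R : realType} {d : nat} (Omega : set 'rV[R]_d).
Local Notation E := 'rV[R]_d.
Local Notation leb := (lebesgue_rV d : {measure set E -> \bar R}).
Hypothesis oO : open Omega.
Hypothesis bO : bounded_set Omega.
Let mO : measurable Omega := open_measurable_rV oO.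
Local Notation normH1 := (normH1 Omega).
Local Notation normHm1 := (normHm1 Omega).

Lemma test_function0 : test_function Omega 0.
Proof.
have E0 : [set x : E | (0 : E -> R) x != 0] = set0.
  by apply/seteqP; split => x //=; rewrite eqxx.
have F0 s : foldr partial (0 : E -> R) s = 0.
  elim: s => //= i s ->; apply/funext => x; rewrite /partial.
  by rewrite (_ : 0 = cst 0)// derive_cst.
split; rewrite ?E0 ?closure0//; last exact: compact0.
by move=> s; rewrite F0; split=> [x|i x]; [exact: cst_continuous|exact: derivable_cst].
Qed.

Lemma H10_0 : H10 Omega 0.
Proof.
have H1_0 := test_H1 oO bO test_function0.
split => //; exists (fun=> 0); split=> [n|]; first exact: test_function0.
apply/(cvg_normH1 oO bO) => //.
have sq0 f : sqint leb Omega (f \- f) = 0%E.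
  by rewrite /sqint; under eq_integral do rewrite /= subrr expr0n; rewrite integral0.
by split=> [|i]; rewrite /cvgL2; under eq_fun do rewrite sq0; exact: cvg_cst.
Qed.

Lemma H1_bounded v : H1 Omega v ->
  exists2 b : R, 0 < b & (normH1 v `^ 2 <= (b ^+ 2)%:E)%E.
Proof.
move=> /(H1P oO)[Lv Wv].
have fin : (normH1 v `^ 2 < +oo)%E.
  rewrite normH1_sqint lte_add_pinfty//; first by case: Lv.
  by apply: lte_sum_pinfty => i _; case: (Wv i) => -[].
have N0 : (0 <= normH1 v `^ 2)%E by exact: poweR_ge0.
(* For x >= 0 one has x <= (x + 1)^2, and the shift makes the bound positive. *)
exists (fine (normH1 v `^ 2)%E + 1); first by rewrite ltr_wpDl// fine_ge0.
rewrite -{1}(@fineK _ (normH1 v `^ 2)%E) ?ge0_fin_numE// lee_fin.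
have := fine_ge0 N0; move: (fine _) => x x0; nra.
Qed.

(** Young's form of the duality estimate, stated with bounds on squared norms since the majorants
    bound squares. The weight e is 1 for the domination and small for the upper limit. *)
Lemma le_dual_sq l v (b k e : R) : linear_form Omega l -> H10 Omega v ->
  0 < b -> (normH1 v `^ 2 <= b%:E)%E -> (normHm1 l `^ 2 <= k%:E)%E -> 0 < e ->
  `|l v| <= (e^-1 * k + e * b) / 2.
Proof.
move=> ll Hv b0 vb lk e0.
have k0 : 0 <= k by rewrite -lee_fin (le_trans (poweR_ge0 _ _) lk).
have sb0 : 0 < Num.sqrt b by rewrite sqrtr_gt0.
have vb' : (normH1 v `^ 2 <= (Num.sqrt b ^+ 2)%:E)%E by rewrite sqr_sqrtr// ltW.
have lk' : (normHm1 l <= (Num.sqrt k)%:E)%E.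
  by rewrite -poweR2_le ?sqrtr_ge0 ?sqr_sqrtr//; exact: (normHm1_ge0 oO bO l H10_0).
have := le_dual oO bO ll Hv sb0 vb'.
have sb0' : (0 <= (Num.sqrt b)%:E)%E by rewrite lee_fin sqrtr_ge0.
move=> /le_trans/(_ (lee_wpmul2l sb0' lk')); rewrite -EFinM lee_fin => /le_trans; apply.
rewrite -[in leRHS](sqr_sqrtr k0) -[in leRHS](sqr_sqrtr (ltW b0)).
move: (Num.sqrt b) (Num.sqrt k) => x y.
rewrite -subr_ge0 (_ : _ - _ = e^-1 * (e * x - y) ^+ 2 / 2); last by field; rewrite gt_eqF.
by rewrite divr_ge0// mulr_ge0 ?sqr_ge0// invr_ge0 ltW.
Qed.

Lemma linear_formB l m : linear_form Omega l -> linear_form Omega m ->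
  linear_form Omega (l - m).
Proof.
move=> ll lm a v w Hv Hw; rewrite -[LHS]/(l _ - m _) ll// lm//.
by rewrite -[(l - m) v]/(l v - m v) -[(l - m) w]/(l w - m w); ring.
Qed.

Lemma linear_formZ l c : linear_form Omega l -> linear_form Omega (c *: l).
Proof.
move=> ll a v w Hv Hw; rewrite -[LHS]/(c * l _) ll//.
by rewrite -[(c *: l) v]/(c * l v) -[(c *: l) w]/(c * l w); ring.
Qed.

Lemma linear_formD l m : linear_form Omega l -> linear_form Omega m ->
  linear_form Omega (l + m).
Proof.
move=> ll lm a v w Hv Hw; rewrite -[LHS]/(l _ + m _) ll// lm//.
by rewrite -[(l + m) v]/(l v + m v) -[(l + m) w]/(l w + m w); ring.
Qed.

Lemma linear_form_L2 u : L2 leb Omega u -> linear_form Omega (L2_Hm1 Omega u).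
Proof.
move=> Lu a v w [/(H1P oO)[Lv _] _] [/(H1P oO)[Lw _] _]; rewrite /L2_Hm1.
have iuv := L2_integrableM mO Lu Lv; have iuw := L2_integrableM mO Lu Lw.
rewrite -RintegralZl// -RintegralD//; last first.
  by rewrite (_ : EFin \o _ = (fun x => a%:E * (u x * v x)%:E)%E)//; exact: integrableZl.
by apply: eq_Rintegral => x _; rewrite -[(a *: v + w) x]/(a * v x + w x); ring.
Qed.

End H10_elements.

(** * Bochner measurable functions: majorants and evaluation *)

Section bochner_majorant.
Context {R : realType} {V : lmodType R}.
Variables (X : set V) (N : V -> \bar R) (I : set R).
Local Notation mu := (@lebesgue_measure R).
Hypothesis mI : measurable (I : set (measurableTypeR R)).

(** [p] is left abstract to cover both a squared norm and a squared distance to a fixed element. *)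
Lemma bochner_majorant (p : V -> \bar R) (u : R -> V) (s : nat -> R -> V) :
  (forall v, 0 <= p v)%E -> (forall a b, X a -> X b ->
     (p a <= 2%:E * p b + 2%:E * N (b - a)%R `^ 2)%E /\
     (p b <= 2%:E * p a + 2%:E * N (b - a)%R `^ 2)%E) ->
  (forall v, 0 <= N v)%E ->
  (\forall t \ae mu, I t -> X (u t)) -> simple_approx X N I u s ->
  (forall l : R -> \bar R, measurable_fun (I : set (measurableTypeR R)) l -> (forall t, 0 <= l t)%E ->
    (\forall t \ae mu, I t -> (l t <= 4%:E * p (u t))%E) -> (\int[mu]_(t in I) l t < +oo)%E) ->
  exists k : R -> R, [/\ forall t, 0 <= k t, mu.-integrable I (EFin \o k)
    & \forall t \ae mu, I t -> (p (u t) <= (k t)%:E <= 4%:E * p (u t))%E].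
Proof.
move=> p0 pN N0 uX [ss su] ip.
have [||||||||k [k0 ik _ kp]] := @quasi_measurable _ _ _ mu _ mI (p \o u) (fun n => p \o s n)
  (fun n t => N (s n t - u t)%R `^ 2)%E; last by exists k.
- by move=> n; exact: (measurable_bochner_simple (ss n)).
- by move=> n t; exact: p0.
- by move=> t; exact: p0.
- by move=> n t; exact: poweR_ge0.
- apply: aeS su => t H It; have N0t n : (0 <= N (s n t - u t)%R)%E by exact: N0.
  exact: (proj1 (cvg_poweR2 N0t) (H It)).
- apply: aeS uX => t H It n; have [_ sX _] := ss n.
  by apply: (pN _ _ (H It) _).1; apply: sX; exists t.
- apply: aeS uX => t H It n; have [_ sX _] := ss n.
  by apply: (pN _ _ (H It) _).2; apply: sX; exists t.
- exact: ip.
Qed.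

End bochner_majorant.

Section bochner_dual.
Context {R : realType} {d : nat} (Omega : set 'rV[R]_d) (I : set R).
Local Notation E := 'rV[R]_d.
Local Notation leb := (lebesgue_rV d : {measure set E -> \bar R}).
Local Notation mu := (@lebesgue_measure R).
Hypothesis oO : open Omega.
Hypothesis bO : bounded_set Omega.
Hypothesis mI : measurable (I : set (measurableTypeR R)).
Hypothesis fI : (mu I < +oo)%E.
Local Notation normH1 := (normH1 Omega).
Local Notation normHm1 := (normHm1 Omega).
Local Notation Hm1 := (Hm1 Omega).

(** Evaluation at v is continuous for the dual norm, so [w t v] is almost everywhere the limit of
    the measurable functions [s n t v]; the upper limit extends it to every t. *)
Lemma ae_evaluation (w : R -> (E -> R) -> R) s v : H10 Omega v ->
  (\forall t \ae mu, I t -> linear_form Omega (w t)) ->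
  simple_approx Hm1 normHm1 I w s ->
  exists G : R -> R, measurable_fun (I : set (measurableTypeR R)) G /\
    \forall t \ae mu, I t -> w t v = G t.
Proof.
move=> Hv lw [ss sw]; have [b b0 vb] := H1_bounded oO Hv.1.
exists (fun t => fine (limn_esup (fun n => (s n t v)%:E))); split.
  apply: measurableT_comp => //; apply: measurable_fun_limn_esup => n.
  exact: (measurable_bochner_simple (ss n) (fun l => (l v)%:E)).
apply: aeS2 lw sw => t + + It => /(_ It) lwt /(_ It) swt.
suff cv : (s n t v)%:E @[n --> \oo] --> (w t v)%:E by rewrite (cvg_limn_einf_sup cv).2.
apply: cvg_EFin; first exact: nearW.
have N0 n : (0 <= normHm1 (s n t - w t)%R)%E by apply: (normHm1_ge0 oO bO); exact: H10_0.
apply/cvgrPdist_le => e e0; have eb0 : 0 < e / b by rewrite divr_gt0.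
move/(cvge0P N0)/(_ _ eb0) : swt; apply: filterS => n H.
have [_ sX _] := ss n; have [ls _] := sX _ (ex_intro2 _ _ t It erefl).
have := le_dual oO bO (linear_formB ls lwt) Hv b0 vb.
have b0' : (0 <= b%:E)%E by rewrite lee_fin ltW.
move=> /le_trans/(_ (lee_wpmul2l b0' H)); rewrite -EFinM lee_fin mulrC divfK ?gt_eqF//.
by rewrite distrC.
Qed.

(** A Bochner integral commutes with the continuous evaluation at v: both sides are limits of the
    integrals of [s n t v], which the finite sum formula computes. *)
Lemma bochner_integral_eval (w : R -> (E -> R) -> R) J v (F : R -> R) :
  is_bochner_integral Hm1 normHm1 I w J -> H10 Omega v ->
  (\forall t \ae mu, I t -> linear_form Omega (w t)) ->
  mu.-integrable I (EFin \o F) -> (\forall t \ae mu, I t -> w t v = F t) ->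
  J v = \int[mu]_(t in I) F t.
Proof.
move=> [[lJ _] [s [[ss _] sI sJ]]] Hv lw iF wF; have [b b0 vb] := H1_bounded oO Hv.1.
have b0' : (0 <= b%:E)%E by rewrite lee_fin ltW.
have N0 l : (0 <= normHm1 l)%E by apply: (normHm1_ge0 oO bO); exact: H10_0.
have isn n := integrable_bochner_simple mI fI (ss n) (fun l => l v).
have ls n t : I t -> linear_form Omega (s n t).
  by move=> It; have [_ sX _] := ss n; have [] := sX _ (ex_intro2 _ _ t It erefl).
have c1 : \int[mu]_(t in I) s n t v @[n --> \oo] --> \int[mu]_(t in I) F t.
  apply/cvgrPdist_le => e e0; have eb0 : 0 < e / b by rewrite divr_gt0.
  have iN0 n : (0 <= \int[mu]_(t in I) normHm1 (s n t - w t)%R)%E by exact: integral_ge0.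
  move/(cvge0P iN0)/(_ _ eb0) : sI; apply: filterS => n H.
  have iD : mu.-integrable I (EFin \o (fun t => F t - s n t v)).
    by rewrite (_ : EFin \o _ = (EFin \o F) \- (EFin \o ((fun l => l v) \o s n)))%E//; exact: integrableB.
  rewrite -RintegralB//; last exact: isn.
  apply: (le_trans (le_normr_Rintegral mI iD)).
  have iA := integrable_abse iD.
  rewrite -lee_fin /Rintegral fineK; last exact: (integrable_fin_num mI iA).
  (* The constant b is divided out on the scalar side, because the dual norm of [s n t - w t] is not
     known to be measurable. *)
  have : (\int[mu]_(t in I) ((b^-1)%:E * `|F t - s n t v|%:E) <= (e / b)%:E)%E.
    apply: le_trans H; apply: ge0_ae_le_integral_meas => //.
    - by apply: measurable_funeM; exact: (measurable_int _ iA).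
    - by move=> t _; rewrite mule_ge0 ?lee_fin// invr_ge0 ltW.
    - apply: aeS2 lw wF => t + + It => /(_ It) lwt /(_ It) <-.
      have := le_dual oO bO (linear_formB (ls n t It) lwt) Hv b0 vb.
      have bi : (0 <= (b^-1)%:E)%E by rewrite lee_fin invr_ge0 ltW.
      move=> /(lee_wpmul2l bi); rewrite muleA -[in leRHS]EFinM mulVf ?gt_eqF// mul1e.
      by apply: le_trans; rewrite distrC.
  rewrite ge0_integralZl//; first last.
  - by rewrite lee_fin invr_ge0 ltW.
  - exact: (measurable_int _ iA).
  move=> /(lee_wpmul2l b0'); rewrite muleA -!EFinM mulfV ?gt_eqF// mul1e.
  by rewrite mulrC divfK ?gt_eqF.
have c2 : \int[mu]_(t in I) s n t v @[n --> \oo] --> J v.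
  apply/cvgrPdist_le => e e0; have eb0 : 0 < e / b by rewrite divr_gt0.
  have NJ n := N0 (simple_integral I (s n) - J).
  move/(cvge0P NJ)/(_ _ eb0) : sJ; apply: filterS => n H.
  have [fs sX ms] := ss n.
  have SE : simple_integral I (s n) = \sum_(l <- fset_set (s n @` I))
      fine (mu (I `&` s n @^-1` [set l])) *: l by rewrite /simple_integral fsbig_finite.
  have Sv : simple_integral I (s n) v = \int[mu]_(t in I) s n t v.
    by rewrite (Rintegral_bochner_simple mI fI (ss n) (fun l => l v)) SE fct_sumE.
  have lS : linear_form Omega (simple_integral I (s n)).
    rewrite SE big_seq; apply: (big_ind (linear_form Omega)).
    - by move=> a x y _ _; rewrite mulr0 addr0.
    - exact: linear_formD.
    - move=> l; rewrite in_fset_set// => /set_mem lI.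
      by apply: linear_formZ; have [] := sX _ lI.
  have := le_dual oO bO (linear_formB lS lJ) Hv b0 vb.
  move=> /le_trans/(_ (lee_wpmul2l b0' H)); rewrite -EFinM lee_fin mulrC divfK ?gt_eqF//.
  by rewrite -[(_ - J) v]/(simple_integral I (s n) v - J v) Sv distrC.
exact: (cvg_unique (@Rhausdorff R) c2 c1).
Qed.

End bochner_dual.

(** A point where |g| exceeds the essential bound would have a whole ball of such points, which has
    positive measure. *)
Lemma continuous_Loo_bounded {R : realType} (g : R -> R) : continuous g ->
  ((g : measurableTypeR R -> R) \in Lfun lebesgue_measure +oo%E) ->
  exists2 C : R, 0 < C & forall s, `|g s| <= C.
Proof.
move=> cg /andP[_] /set_mem; rewrite /= /finite_norm unlock.
have ball0 (x r : R) : 0 < r -> (0 < lebesgue_measure (ball x r))%E.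
  by move=> r0; rewrite lebesgue_measure_ball ?ltW// lte_fin mulrn_wgt0.
have T0 : (0 < lebesgue_measure [set: measurableTypeR R])%E.
  apply: lt_le_trans (ball0 0 1 ltr01) _.
  by apply: le_measure => //; apply/mem_set => //; exact: measurable_ball.
rewrite T0 => fin.
have [C C0 HC] : exists2 C : R, 0 < C & \forall x \ae lebesgue_measure, `|g x| <= C.
  have H := ess_sup_ge lebesgue_measure (abse \o (EFin \o (g : measurableTypeR R -> R))).
  move: fin H; case: (ess_sup _ _) => [r| |] fin H.
  - exists (`|r| + 1); first by rewrite ltr_wpDl.
    apply: aeS H => x /=; rewrite lee_fin => /le_trans; apply.
    by rewrite (le_trans (ler_norm r))// lerDl.
  - by rewrite ltxx in fin.
  - by exists 1 => //; apply: aeS H => x; rewrite leeNy_eq.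
exists C => // s; rewrite leNgt; apply/negP => Cs.
have : \forall x \near s, C < `|g x|.
  have cn : `|g x| @[x --> s] --> `|g s| by exact: (cvg_norm (cg s)).
  exact: (cvgr_gt _ cn).
move=> [r /= r0 Hr]; case: HC => N [mN muN HN].
have : (lebesgue_measure (ball s r) <= lebesgue_measure N)%E.
  apply: le_measure; [apply/mem_set; exact: measurable_ball|exact/mem_set|].
  by move=> x sx; apply: HN => /= gC; have := Hr x sx; rewrite ltNge gC.
by rewrite muN leNgt ball0.
Qed.

(** * Sign of the spatial terms *)

Section weak_form.
Context {R : realType} {d : nat} (Omega : set 'rV[R]_d).
Local Notation E := 'rV[R]_d.
Local Notation leb := (lebesgue_rV d : {measure set E -> \bar R}).
Hypothesis oO : open Omega.
Hypothesis bO : bounded_set Omega.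
Let mO : measurable Omega := open_measurable_rV oO.
Local Notation L2 := (L2 leb Omega).
Local Notation wp := (weak_partial Omega).

Lemma Rintegral_sum (J : Type) (r : seq J) (F : J -> E -> R) :
  (forall j, leb.-integrable Omega (EFin \o F j)) ->
  leb.-integrable Omega (EFin \o (fun x => \sum_(j <- r) F j x)) /\
  \sum_(j <- r) \int[leb]_(x in Omega) F j x =
  \int[leb]_(x in Omega) \sum_(j <- r) F j x.
Proof.
move=> iF; elim: r => [|j r [IH1 IH2]].
  rewrite big_nil (_ : (fun x => _) = cst 0); last by apply/funext => x; rewrite big_nil.
  by rewrite Rintegral_cst// mul0r; split => //; exact: integrable0.
rewrite big_cons IH2 -RintegralD//.
have -> : (fun x => \sum_(j <- j :: r) F j x) = (fun x => F j x + \sum_(j <- r) F j x).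
  by apply/funext => x; rewrite big_cons.
split => //; rewrite (_ : EFin \o _ = (EFin \o F j) \+
  (EFin \o (fun x => (\sum_(j <- r) F j x)%R)))%E//.
exact: integrableD.
Qed.

Variables (f : 'I_d -> R -> R) (B : 'I_d -> 'I_d -> R -> R).
Hypothesis cf : forall i, continuous (f i)^`()%classic.
Hypothesis bf : forall i, exists2 C : R, 0 < C & forall s, `|(f i)^`()%classic s| <= C.
Hypothesis cB : forall i j, continuous (B i j).
Hypothesis bB : forall i j, exists2 C : R, 0 < C & forall s, `|B i j s| <= C.
Variable theta : R.
Hypothesis theta0 : 0 < theta.
Hypothesis ell : forall (s : R) (xi : 'rV[R]_d),
  theta * \sum_(i < d) xi 0 i ^+ 2 <= \sum_(i < d) \sum_(j < d) B i j s * xi 0 i * xi 0 j.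

Lemma weak_form_le0 (M c : R) (w : E -> R) (l : R) : 0 <= M ->
  (forall s, `|dexcess M s| <= c) -> H10 Omega w ->
  l + \sum_(i < d) \sum_(j < d) \int[leb]_(x in Omega)
        (B i j (w x) * wp j w x * wp i (excess M \o w) x)
    + \sum_(i < d) \int[leb]_(x in Omega)
        ((f i)^`()%classic (w x) * wp i w x * (excess M \o w) x) = 0 ->
  l <= 0.
Proof.
move=> M0 dc Hw.
have e0 : excess M 0 = 0 by apply: excess0; rewrite normr0.
have dc' s : `|(excess M)^`()%classic s| <= c by rewrite excess_derive1.
have [Hv wv _] := chain_rule oO bO (Coo1_excess M) e0 dc' Hw.
have [Lw Ww] := H1P oO Hw.1; have [Lv Wv] := H1P oO Hv.1.
have [K K0 HK] := excess_bounded M.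
have mw (h : R -> R) : continuous h -> measurable_fun Omega (h \o w).
  move=> ch; apply: measurableT_comp Lw.1; exact: continuous_measurable_fun.
have -> : \sum_(i < d) \int[leb]_(x in Omega)
    ((f i)^`()%classic (w x) * wp i w x * (excess M \o w) x) = 0.
  apply: big1 => i _; have [C C0 HC] := bf i.
  have ch : continuous (fun s => (f i)^`()%classic s * excess M s).
    by move=> s; apply: cvgM; [exact: cf|exact: (Coo1_continuous (Coo1_excess M))].
  have hb (s : R) : `|(f i)^`()%classic s * excess M s| <= C * K.
    by rewrite normrM; apply: ler_pM.
  rewrite -(integral_divergence oO bO i ch hb Hw).
  by apply: eq_Rintegral => x _; rewrite /= mulrAC.
rewrite addr0 => /eqP; rewrite addr_eq0 => /eqP ->; rewrite oppr_le0.
have iB i j : leb.-integrable Omega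
    (EFin \o (fun x => B i j (w x) * wp j w x * wp i (excess M \o w) x)).
  apply: L2_integrableM => //; last exact: (Wv i).1.
  have [C C0 HC] := bB i j.
  by apply: (L2M mO (c := C) (Ww j).1) => //; exact: mw.
have iBj i := Rintegral_sum (index_enum 'I_d) (iB i).
under eq_bigr do rewrite (iBj _).2.
have [i2 ->] := Rintegral_sum (index_enum 'I_d) (fun i => (iBj i).1).
rewrite /Rintegral fine_ge0//.
(* The chain rule for the test function pulls out [dexcess] and leaves the elliptic form in the
   gradient of [w]. It holds almost everywhere, so integrals are compared rather than integrands. *)
have -> : (\int[leb]_(x in Omega) (\sum_(i < d) \sum_(j < d)
      (B i j (w x) * wp j w x * wp i (excess M \o w) x))%:E =
    \int[leb]_(x in Omega) (dexcess M (w x) * \sum_(i < d) \sum_(j < d)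
      (B i j (w x) * wp i w x * wp j w x))%:E)%E.
  have mwp i : measurable_fun Omega (wp i w) by exact: (Ww i).1.1.
  apply: ae_eq_integral => //.
  - exact: (measurable_int _ i2).
  - have m1 : measurable_fun Omega (dexcess M \o w) by apply: mw; exact: continuous_dexcess.
    have m2 : measurable_fun Omega (fun x => \sum_(i < d) \sum_(j < d)
        (B i j (w x) * wp i w x * wp j w x)).
      apply: measurable_sum => i; apply: measurable_sum => j.
      have m3 : measurable_fun Omega (B i j \o w) by apply: mw; exact: cB.
      exact: (measurable_funM (measurable_funM m3 (mwp i)) (mwp j)).
    by apply/measurable_EFinP; exact: (measurable_funM m1 m2).
  - have : \forall x \ae leb, forall i, Omega x -> wp i (excess M \o w) x =
        (excess M)^`()%classic (w x) * wp i w x by apply: filter_forall.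
    apply: filterS => x H Ox; congr EFin; rewrite mulr_sumr; apply: eq_bigr => i _.
    rewrite mulr_sumr; apply: eq_bigr => j _; rewrite (H i Ox) excess_derive1.
    by move: (B i j (w x)) (wp j w x) (wp i w x) (dexcess M (w x)) => b p q e; ring.
apply: integral_ge0 => x _; rewrite lee_fin mulr_ge0 ?dexcess_ge0//.
have -> : \sum_(i < d) \sum_(j < d) (B i j (w x) * wp i w x * wp j w x) =
    \sum_(i < d) \sum_(j < d) B i j (w x) * (\row_i wp i w x) 0 i * (\row_i wp i w x) 0 j.
  by apply: eq_bigr => i _; apply: eq_bigr => j _; rewrite !mxE.
apply: le_trans (ell _ _).
by rewrite mulr_ge0 ?(ltW theta0)// sumr_ge0// => i _; exact: sqr_ge0.
Qed.

End weak_form.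

Section clamp.
Context {R : realType}.
Variable T : R.
Hypothesis T0 : 0 <= T.

(** The projection onto [0, T]; composing with it turns continuity relative to [0, T] into
    continuity on the whole line. *)
Definition clamp (t : R) : R := Num.max 0 (Num.min t T).

Lemma clamp_in t : `[0, T]%classic (clamp t).
Proof.
by rewrite /= in_itv/= /clamp le_max lexx/= ge_max T0/= ge_min lexx orbT.
Qed.

Lemma clamp_id t : `[0, T]%classic t -> clamp t = t.
Proof.
rewrite /= in_itv/= /clamp => /andP[t0 tT].
by rewrite min_l// max_r.
Qed.

Lemma clamp_cvg t0 : clamp t @[t --> t0] --> within `[0, T]%classic (nbhs (clamp t0)).
Proof.
have c : clamp t @[t --> t0] --> clamp t0.
  have cm : Num.min t T @[t --> t0] --> Num.min t0 T.
    rewrite minr_absE; under eq_fun do rewrite minr_absE.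
    apply: cvgMl; apply: cvgB; first by apply: cvgD; [exact: cvg_id|exact: cvg_cst].
    by apply: cvg_norm; apply: cvgB; [exact: cvg_id|exact: cvg_cst].
  rewrite /clamp maxr_absE; under eq_fun do rewrite maxr_absE.
  apply: cvgMl; apply: cvgD; first by apply: cvgD; [exact: cvg_cst|exact: cm].
  by apply: cvg_norm; apply: cvgB; [exact: cvg_cst|exact: cm].
move=> A /= HA.
have H : \forall t \near t0, `[0, T]%classic (clamp t) -> A (clamp t) by exact: (c _ HA).
by apply: filterS H => t; apply; exact: clamp_in.
Qed.

End clamp.

Section ae_Rintegral.
Context d (X : measurableType d) {R : realType} (mu : {measure set X -> \bar R}).

Lemma ae_integrable (D : set X) (f g : X -> R) : measurable D ->
  measurable_fun D f -> mu.-integrable D (EFin \o g) ->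
  (\forall x \ae mu, D x -> `|f x| <= g x) -> mu.-integrable D (EFin \o f).
Proof.
move=> mD mf ig fg; apply/integrableP; split; first exact/measurable_EFinP.
have iA := integrable_abse ig; have /integrableP[mg gfin] := ig.
apply: le_lt_trans gfin; apply: ae_ge0_le_integral => //.
- by apply: measurableT_comp => //; exact/measurable_EFinP.
- exact: measurableT_comp.
- by apply: filterS fg => x H Dx /=; rewrite lee_fin (le_trans (H Dx))// ler_norm.
Qed.

(** [g] is replaced by the maximum of [f] and [g], equal to it almost everywhere, so that the
    comparison becomes pointwise. *)
Lemma ae_le_Rintegral (D : set X) (f g : X -> R) : measurable D ->
  mu.-integrable D (EFin \o f) -> mu.-integrable D (EFin \o g) ->
  (\forall x \ae mu, D x -> f x <= g x) ->
  \int[mu]_(x in D) f x <= \int[mu]_(x in D) g x.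
Proof.
move=> mD jf ig fg.
have mf : measurable_fun D f by apply/measurable_EFinP; exact: measurable_int jf.
have mg : measurable_fun D g by apply/measurable_EFinP; exact: measurable_int ig.
have mm : measurable_fun D (fun x => Num.max (f x) (g x)) by exact: measurable_maxr.
have E : \forall x \ae mu, D x -> (g x)%:E = (Num.max (f x) (g x))%:E.
  by apply: filterS fg => x H Dx; rewrite max_r// H.
have im : mu.-integrable D (EFin \o (fun x => Num.max (f x) (g x))).
  apply: ae_integrable (integrable_abse ig) _ => //.
  by apply: filterS fg => x H Dx; rewrite max_r// H.
have -> : \int[mu]_(x in D) g x = \int[mu]_(x in D) Num.max (f x) (g x).
  congr fine; apply: ae_eq_integral => //; exact/measurable_EFinP.
by apply: le_Rintegral => // x _; rewrite le_max lexx.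
Qed.

End ae_Rintegral.

Section energy.
Context {R : realType} {d : nat} (Omega : set 'rV[R]_d) (T : R).
Local Notation E := 'rV[R]_d.
Local Notation leb := (lebesgue_rV d : {measure set E -> \bar R}).
Local Notation mu := (@lebesgue_measure R).
Local Notation I := (`]0, T[%classic : set R).
Local Notation L2 := (L2 leb Omega).
Local Notation sqint := (sqint leb Omega).
Local Notation normHm1 := (normHm1 Omega).
Hypothesis oO : open Omega.
Hypothesis bO : bounded_set Omega.
Let mO : measurable Omega := open_measurable_rV oO.
Let fO : (leb Omega < +oo)%E := bounded_lty mO bO.
Hypothesis T0 : 0 < T.
Let mI : measurable (I : set (measurableTypeR R)) := measurable_itv _.

Lemma interval_lty : (mu I < +oo)%E.
Proof. by rewrite lebesgue_measure_itv/= lte_fin T0 -EFinB ltry. Qed.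

Variable U : R -> E -> R.
Hypothesis LU : forall t, `[0, T]%classic t -> L2 (U t).
Hypothesis cU : forall t0, `[0, T]%classic t0 ->
  normL Omega 2%:E (U t - U t0) @[t --> within `[0, T]%classic (nbhs t0)] --> 0%E.

(** The hypothesis is a Lipschitz estimate in Young's form. It serves both for the pairing with a
    fixed function and for the integral of [cost]. *)
Lemma continuous_clamped (Phi : (E -> R) -> R) (q : R) : 0 <= q ->
  (forall a b, L2 a -> L2 b -> forall e : R, 0 < e ->
    `|Phi a - Phi b| <= e * fine (sqint (a \- b)) + e^-1 * q) ->
  continuous (fun t => Phi (U (clamp T t))).
Proof.
move=> q0 HPhi t0; apply/cvgrPdist_le => eps eps0.
(* This weight makes the term q / e at most eps / 2; the radius [del] then does the same for the
   other term. *)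
pose e := 2 * (q + 1) / eps.
have e0 : 0 < e by rewrite divr_gt0// mulr_gt0// ltr_wpDl.
have eq2 : e^-1 * q <= eps / 2.
  rewrite /e invf_div mulrAC ler_pdivrMr ?mulr_gt0 ?ltr_wpDl//.
  rewrite (_ : eps / 2 * (2 * (q + 1)) = eps * (q + 1)); last by field.
  by rewrite (ler_wpM2l (ltW eps0))// lerDl.
pose del := Num.sqrt (eps / (2 * e)).
have del0 : 0 < del by rewrite sqrtr_gt0 divr_gt0// mulr_gt0.
have Hn : nbhs 0%E [set x : \bar R | (x < del%:E)%E].
  by apply: open_nbhs_nbhs; split; [exact: open_ereal_lt_ereal|rewrite /= lte_fin].
have H1 := cU (clamp_in (ltW T0) t0) Hn.
have H : \forall t \near t0, (normL Omega 2%:E (U (clamp T t) - U (clamp T t0))%R < del%:E)%E.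
  exact: (clamp_cvg (ltW T0) H1).
apply: filterS H => t Ht; rewrite distrC.
apply: (le_trans (HPhi _ _ (LU (clamp_in (ltW T0) t)) (LU (clamp_in (ltW T0) t0)) e e0)).
have Ld := L2B mO (LU (clamp_in (ltW T0) t)) (LU (clamp_in (ltW T0) t0)).
have sq : fine (sqint (U (clamp T t) \- U (clamp T t0))) <= eps / (2 * e).
  have ed0 : 0 <= eps / (2 * e) by rewrite ltW// divr_gt0// mulr_gt0.
  rewrite -lee_fin -sqint_fin// -normL_sqint.
  rewrite -[X in (_ <= X%:E)%E](sqr_sqrtr ed0) -/del.
  by rewrite poweR2_le ?normL_ge0 ?(ltW Ht)// (ltW del0).
rewrite [leRHS]splitr; apply: lerD => //.
apply: (le_trans (ler_wpM2l (ltW e0) sq)).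
by rewrite (_ : e * (eps / (2 * e)) = eps / 2)//; field; rewrite gt_eqF.
Qed.

Lemma continuous_pairing v : L2 v ->
  continuous (fun t => \int[leb]_(x in Omega) (U (clamp T t) x * v x)).
Proof.
move=> Lv; pose q := fine (sqint v) / 2.
have q0 : 0 <= q by rewrite divr_ge0// fine_ge0// sqint_ge0.
apply: (continuous_clamped (Phi := fun a => \int[leb]_(x in Omega) (a x * v x)) q0).
move=> a b La Lb e e0; have Lab := L2B mO La Lb.
rewrite -RintegralB//; [|exact: L2_integrableM|exact: L2_integrableM].
have -> : \int[leb]_(x in Omega) (a x * v x - b x * v x) =
    \int[leb]_(x in Omega) ((a \- b) x * v x).
  by apply: eq_Rintegral => x _; rewrite /= mulrBl.
apply: (le_trans (le_Rintegral_L2 mO e0 Lab Lv)); rewrite mulrDl /q mulrA; apply: lerD => //.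
have s0 : 0 <= e * fine (sqint (a \- b)) by rewrite mulr_ge0 ?(ltW e0) ?fine_ge0 ?sqint_ge0.
by rewrite ler_pdivrMr// mulr_natr mulr2n lerDl.
Qed.

Variables (u : R -> E -> R) (ut : R -> (E -> R) -> R).
Hypothesis tu : time_derivative Omega T u ut.
Hypothesis uU : \forall t \ae mu, I t -> u t = U t %[ae leb in Omega].
Hypothesis Lu : \forall t \ae mu, I t -> L2 (u t).

Lemma Hm1_linear l : Hm1 Omega l -> linear_form Omega l.
Proof. by case. Qed.

Lemma derivative_majorant : exists k : R -> R, [/\ forall t, 0 <= k t,
  mu.-integrable I (EFin \o k)
  & \forall t \ae mu, I t -> (normHm1 (ut t) `^ 2 <= (k t)%:E)%E].
Proof.
have [[uX [s su] iu] _] := tu.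
have N0 l : (0 <= normHm1 l)%E by apply: (normHm1_ge0 oO bO); exact: H10_0.
have [||||||k [k0 ik H]] := @bochner_majorant _ _ (Hm1 Omega) normHm1 I mI
  (fun l => normHm1 l `^ 2)%E ut s; last by exists k; split => //; apply: aeS H => t Ht /Ht /andP[].
- by move=> l; exact: poweR_ge0.
- move=> a b _ _; split; last by apply: (normHm1_sq_triangle oO bO); exact: H10_0.
  by rewrite normHm1N; apply: (normHm1_sq_triangle oO bO); exact: H10_0.
- exact: N0.
- exact: uX.
- exact: su.
- by move=> l ml l0 lP; apply: (lower_integral_lty mI _ iu ml l0 lP) => t; exact: poweR_ge0.
Qed.

(** Evaluating the H^-1 identity at v gives a scalar distributional derivative, to which the du
    Bois-Reymond lemma applies. With the continuous representative [U] the increment formula holds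
    for all s < t, not just almost all, so v may later depend on t. *)
Lemma energy_identity v : H10 Omega v -> exists G : R -> R,
  [/\ mu.-integrable I (EFin \o G), \forall t \ae mu, I t -> ut t v = G t
    & forall s t, 0 < s -> s < t -> t < T ->
      \int[leb]_(x in Omega) ((U t x - U s x) * v x) = \int[mu]_(r in `]s, t]) G r].
Proof.
move=> Hv; have [Lv _] := H1P oO Hv.1.
have [[uX [s su] iu] tder] := tu.
have lut : \forall t \ae mu, I t -> linear_form Omega (ut t).
  by apply: aeS uX => t H /H /Hm1_linear.
have [G [mG HG]] := ae_evaluation oO bO Hv lut su.
have [k [k0 ik Hk]] := derivative_majorant.
have [b b0 vb] := H1_bounded oO Hv.1.
have b20 : 0 < b ^+ 2 by rewrite exprn_gt0.
have iG : mu.-integrable I (EFin \o G).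
  have ikb : mu.-integrable I (EFin \o (fun t => k t + b ^+ 2)).
    rewrite (_ : EFin \o _ = (EFin \o k) \+ (cst (b ^+ 2)%:E))%E//; apply: integrableD => //.
    apply/integrableP; split => //; rewrite integral_cst//= lte_mul_pinfty//.
    exact: interval_lty.
  apply: (ae_integrable mI mG ikb); apply: aeS3 HG Hk lut => t + + + It.
  move=> /(_ It) <- /(_ It) Hkt /(_ It) lt.
  have := le_dual_sq oO bO lt Hv b20 vb Hkt ltr01.
  rewrite invr1 !mul1r => /le_trans; apply; rewrite ler_pdivrMr// mulr_natr mulr2n lerDl.
  by rewrite addr_ge0// ltW.
exists G; split => // s1 t1 s0 st tT.
pose F t := \int[leb]_(x in Omega) (U (clamp T t) x * v x).
have cF : continuous F by exact: continuous_pairing.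
have subI t : I t -> `[0, T]%classic t.
  by rewrite /= !in_itv/= => /andP[/ltW -> /ltW ->].
have H phi : time_test_function T phi ->
    \int[mu]_(r in I) (phi^`()%classic r * F r) = - \int[mu]_(r in I) (phi r * G r).
  move=> tphi; have [J [J1 J2]] := tder _ tphi.
  have [dphi cphi sphi] := tphi.
  have cont : continuous phi by apply: derivable_continuous => x; exact: (dphi 0%N x).
  have cont' : continuous phi^`()%classic.
    by apply: derivable_continuous => x; exact: (dphi 1%N x).
  have icont (h : R -> R) : continuous h -> mu.-integrable I (EFin \o h).
    move=> ch; have : mu.-integrable `[0, T] (EFin \o h).
      by apply: continuous_compact_integrable; [exact: segment_compact|exact: continuous_subspaceT].
    by apply: integrableS => //; exact: subset_itv_oo_cc.
  have E1 : J v = \int[mu]_(r in I) (phi^`()%classic r * F r).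
    apply: (bochner_integral_eval oO bO mI interval_lty J1 Hv).
    - apply: aeS Lu => t H It; apply: linear_formZ; exact: (linear_form_L2 oO (H It)).
    - by apply: icont => x; apply: cvgM; [exact: cont'|exact: cF].
    - apply: aeS2 uU Lu => t + + It => /(_ It) uUt /(_ It) Lut.
      have LUt := LU (subI t It).
      rewrite -[LHS]/(phi^`()%classic t * L2_Hm1 Omega (u t) v) /F clamp_id; last exact: subI.
      congr (_ * _); rewrite /L2_Hm1 /Rintegral; congr fine; apply: ae_eq_integral => //.
      + exact: (measurable_int _ (L2_integrableM mO Lut Lv)).
      + exact: (measurable_int _ (L2_integrableM mO LUt Lv)).
      + by apply: filterS uUt => x Hx Ox; rewrite Hx.
  have E2 : (- J) v = \int[mu]_(r in I) (phi r * G r).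
    have [c _ HC] : exists2 c, c \in `[0, T] & forall t, t \in `[0, T] -> `|phi t| <= `|phi c|.
      apply: (@EVT_max _ (fun t => `|phi t|)); first exact: ltW.
      by apply: continuous_subspaceT => x; exact: (cvg_norm (cont x)).
    apply: (bochner_integral_eval oO bO mI interval_lty J2 Hv).
    - by apply: aeS lut => t H It; apply: linear_formZ; exact: H.
    - have iGC : mu.-integrable I (EFin \o (fun t => `|phi c| * `|G t|)).
        rewrite (_ : EFin \o _ = (fun t => `|phi c|%:E * `|(G t)%:E|)%E)//.
        by apply: integrableZl => //; exact: integrable_abse iG.
      apply: (ae_integrable mI _ iGC).
        apply: measurable_funM => //; apply: measurable_funTS.
        exact: continuous_measurable_fun.
      apply: (aeW mu) => t It; rewrite normrM ler_wpM2r// HC//.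
      exact: (subI t It).
    - by apply: aeS HG => t H It; rewrite -H.
  by rewrite -E1 -E2 -[(- J) v]/(- J v) opprK.
have := du_bois_reymond cF iG H s0 st tT.
have s1I : `[0, T]%classic s1 by rewrite /= in_itv/=; apply/andP; split; lra.
have t1I : `[0, T]%classic t1 by rewrite /= in_itv/=; apply/andP; split; lra.
rewrite /F !clamp_id// => <-; rewrite -RintegralB//; try exact: L2_integrableM (LU _) Lv.
by apply: eq_Rintegral => x _; rewrite mulrBl.
Qed.

End energy.

(** * The maximum principle *)

Lemma ae_finite_set {R : realType} {V : choiceType} (A : set V) (P : V -> R -> Prop) :
  finite_set A -> (forall y, A y -> \forall t \ae (@lebesgue_measure R), P y t) ->
  \forall t \ae (@lebesgue_measure R), forall y, A y -> P y t.
Proof.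
move=> fA H.
have := @filter_bigI _ _ (fset_set A) (fun y => [set t | P y t]) _ (ae_filter_ringOfSetsType (@lebesgue_measure R)).
move=> /(_ _)/wrap[y yA|]; first by apply: H; move: yA; rewrite in_fset_set// => /set_mem.
by apply: aeS => t Ht y Ay; apply: Ht => /=; rewrite in_fset_set//; exact/mem_set.
Qed.

Lemma is_derive_left_le {R : realType} (f : R -> R) (t l m : R) : is_derive t 1 f l ->
  l < m -> \forall s \near t^'-, f t - f s <= m * (t - s).
Proof.
move=> [df dl] lm.
have ml0 : 0 < m - l by rewrite subr_gt0.
have c : h^-1 *: ((f \o shift t) h%:A - f t) @[h --> 0^'] --> l by rewrite -dl; exact: df.
move/cvgrPdist_le : c => /(_ _ ml0) [e /= e0 He].
exists e => //= s st slt; have h0 : s - t != 0 by rewrite subr_eq0 lt_eqF.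
have Hb : ball_ [eta Num.Def.normr] 0 e (s - t) by rewrite /ball_/= sub0r opprB.
have := He _ Hb h0; rewrite /= [_%:A]mulr1 subrK ler_norml => /andP[H _].
have ts : 0 < t - s by rewrite subr_gt0.
have E : (s - t)^-1 *: (f s - f t) = (f t - f s) / (t - s).
  by rewrite -[LHS]/(_ * _) -opprB invrN mulNr -mulrN opprB mulrC.
move: H; rewrite E => H; rewrite -ler_pdivrMr//; lra.
Qed.

Section maximum_principle.
Context {R : realType} {d : nat} (Omega : set 'rV[R]_d) (T : R).
Local Notation E := 'rV[R]_d.
Local Notation leb := (lebesgue_rV d : {measure set E -> \bar R}).
Local Notation mu := (@lebesgue_measure R).
Local Notation I := (`]0, T[%classic : set R).
Local Notation L2 := (L2 leb Omega).
Local Notation sqint := (sqint leb Omega).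
Local Notation H10 := (H10 Omega).
Local Notation Hm1 := (Hm1 Omega).
Local Notation normH1 := (normH1 Omega).
Local Notation normHm1 := (normHm1 Omega).
Hypothesis oO : open Omega.
Hypothesis bO : bounded_set Omega.
Let mO : measurable Omega := open_measurable_rV oO.
Let fO : (leb Omega < +oo)%E := bounded_lty mO bO.
Hypothesis T0 : 0 < T.
Let mI : measurable (I : set (measurableTypeR R)) := measurable_itv _.
Let N0 l : (0 <= normHm1 l)%E.
Proof. by apply: (normHm1_ge0 oO bO); exact: (H10_0 oO bO). Qed.
Let Ntri l m := @normHm1_sq_triangle _ _ _ oO bO l m (H10_0 oO bO).

Lemma interval_cst_integrable (c : R) : mu.-integrable I (EFin \o (fun=> c)).
Proof.
rewrite (_ : EFin \o _ = cst c%:E)//; apply/integrableP; split => //.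
rewrite (_ : (fun x => _) = cst `|c|%:E)// integral_cst//= lte_mul_pinfty//.
exact: interval_lty.
Qed.

Lemma Rintegral_step_le (G k : R -> R) (a b s t : R) :
  mu.-integrable I (EFin \o G) -> mu.-integrable I (EFin \o k) ->
  (\forall r \ae mu, I r -> G r <= a * k r + b) -> 0 < s -> s < t -> t < T ->
  \int[mu]_(r in `]s, t]) G r <=
    a * (primitive (k \_ I) t - primitive (k \_ I) s) + (t - s) * b.
Proof.
move=> iG ik Gk s0 st tT.
have sub : `]s, t]%classic `<=` I.
  by move=> r /=; rewrite !in_itv/= => /andP[sr rt]; apply/andP; split; lra.
have mst : measurable (`]s, t]%classic : set (measurableTypeR R)) by exact: measurable_itv.
have ikI : mu.-integrable setT (EFin \o (k \_ I)).
  by rewrite -restrict_EFin; apply/integrable_restrict => //=; rewrite setTI.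
have ics (g : R -> R) : mu.-integrable I (EFin \o g) -> mu.-integrable `]s, t] (EFin \o g).
  by move=> ig; exact: integrableS ig.
have iak : mu.-integrable I (EFin \o (fun r => a * k r)).
  by rewrite (_ : EFin \o _ = (fun r => a%:E * (k r)%:E)%E)//; exact: integrableZl.
have ib := interval_cst_integrable b.
have iakb : mu.-integrable I (EFin \o (fun r => a * k r + b)).
  by rewrite (_ : EFin \o _ = (EFin \o (fun r => a * k r)%R) \+ (EFin \o (fun=> b)))%E//; exact: integrableD.
apply: (@le_trans _ _ (\int[mu]_(r in `]s, t]) (a * k r + b))).
  apply: ae_le_Rintegral => //; [exact: ics|exact: ics|].
  by apply: aeS Gk => r H /sub; exact: H.
rewrite RintegralD//; [|exact: ics|exact: ics].
rewrite RintegralZl//; last exact: ics.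
rewrite Rintegral_cst//= lebesgue_measure_itv/= lte_fin st/= primitiveB// ?(ltW st)//.
have -> : \int[mu]_(r in `]s, t]) (k \_ I) r = \int[mu]_(r in `]s, t]) k r.
  by apply: eq_Rintegral => r /set_mem /sub Ir; rewrite patchE mem_set.
by rewrite mulrC (mulrC b).
Qed.

Variable U : R -> E -> R.
Hypothesis LU : forall t, `[0, T]%classic t -> L2 (U t).
Hypothesis cU : forall t0, `[0, T]%classic t0 ->
  normL Omega 2%:E (U t - U t0) @[t --> within `[0, T]%classic (nbhs t0)] --> 0%E.
Variables (u : R -> E -> R) (ut : R -> (E -> R) -> R).
Hypothesis tu : time_derivative Omega T u ut.
Hypothesis uU : \forall t \ae mu, I t -> u t = U t %[ae leb in Omega].
Hypothesis bu : bochner_L2 H10 normH1 I u.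

Lemma solution_majorant : exists k : R -> R, [/\ forall t, 0 <= k t,
  mu.-integrable I (EFin \o k)
  & \forall t \ae mu, I t -> (normH1 (u t) `^ 2 <= (k t)%:E)%E].
Proof.
have [uX [s su] iu] := bu.
have [||||||k [k0 ik H]] := @bochner_majorant _ _ H10 normH1 I mI
  (fun v => normH1 v `^ 2)%E u s; last by exists k; split => //; apply: aeS H => t Ht /Ht /andP[].
- by move=> l; exact: poweR_ge0.
- move=> a b [Ha _] [Hb _].
  have Hba : H1 Omega (b - a).
    by have [] := H1_lin oO bO (-1) Ha Hb; rewrite scaleN1r addrC.
  have := normH1_lin_le oO bO (-1) Hba Hb; have := normH1_lin_le oO bO 1 Hba Ha.
  rewrite scale1r subrK scaleN1r opprB subrK sqrrN expr1n mul1e.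
  by move=> H1 H2; split; rewrite addeC.
- exact: normH1_ge0.
- exact: uX.
- exact: su.
- by move=> l ml l0 lP; apply: (lower_integral_lty mI _ iu ml l0 lP) => t; exact: poweR_ge0.
Qed.

(** The upper bound by 4 ||ut - y||^2 matters: for y close to [ut t] it makes the derivative at t of
    the primitive of k small. *)
Lemma derivative_sub_majorant y : Hm1 y -> exists k : R -> R, [/\ forall t, 0 <= k t,
  mu.-integrable I (EFin \o k)
  & \forall t \ae mu, I t ->
    (normHm1 (ut t - y)%R `^ 2 <= (k t)%:E <= 4%:E * normHm1 (ut t - y)%R `^ 2)%E].
Proof.
move=> [_ Ny]; have [[uX [s su] iu] _] := tu.
have [K [K0 iK HK]] := derivative_majorant oO bO tu.
have subsub (a b : (E -> R) -> R) : (a - y) - (b - y) = a - b by rewrite opprB addrA subrK.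
have [||||||k [k0 ik H]] := @bochner_majorant _ _ Hm1 normHm1 I mI
  (fun l => normHm1 (l - y)%R `^ 2)%E ut s; last by exists k.
- by move=> l; exact: poweR_ge0.
- move=> a b _ _; have := Ntri (a - y) (b - y); have := Ntri (b - y) (a - y).
  by rewrite !subsub (normHm1N _ a b).
- exact: N0.
- exact: uX.
- exact: su.
- move=> l ml l0 lP; pose c := (fine (normHm1 y)) ^+ 2.
  have yE : (normHm1 y `^ 2 = c%:E)%E by rewrite poweR2_fin.
  (* From ||ut - y||^2 <= 2 ||ut||^2 + 2 ||y||^2, multiplied by the factor 4 of the majorant. *)
  have iKc : mu.-integrable I (EFin \o (fun t => 8 * K t + 8 * c)).
    rewrite (_ : EFin \o _ = (fun t => 8%:E * (K t)%:E) \+ (EFin \o (fun=> 8 * c)%R))%E//.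
    by apply: integrableD => //; [exact: integrableZl|exact: interval_cst_integrable].
  have /integrableP[mKc KcT] := iKc.
  apply: le_lt_trans KcT; apply: ae_ge0_le_integral => //.
    exact: measurableT_comp.
  apply: aeS2 lP HK => t + + It => /(_ It) lt /(_ It) Kt; apply: (le_trans lt).
  have := Ntri (ut t - y) (ut t).
  rewrite (_ : ut t - y - ut t = 0 - y); last by rewrite addrAC subrr.
  have two0 : (0 <= 2%:E :> \bar R)%E by rewrite lee_fin.
  rewrite (normHm1N _ 0 y) subr0 yE => /le_trans/(_ (leeD2r _ (lee_wpmul2l two0 Kt))).
  rewrite -!EFinM -EFinD => H4.
  have four0 : (0 <= 4%:E :> \bar R)%E by rewrite lee_fin.
  apply: (le_trans (lee_wpmul2l four0 H4)).
  rewrite -EFinM /= lee_fin; apply: le_trans (ler_norm _).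
  by rewrite le_eqVlt; apply/orP; left; apply/eqP; ring.
Qed.

Variables (M c : R).
Hypothesis M0 : 0 <= M.
Hypothesis dc : forall s, `|dexcess M s| <= c.
Hypothesis utle : \forall t \ae mu, I t -> ut t (excess M \o u t) <= 0.

(** The functional psi, taken along the continuous representative so that it is continuous and its
    value at 0 is controlled by the initial datum. *)
Definition lyapunov t : R := \int[leb]_(x in Omega) cost M (U (clamp T t) x).

Lemma cost_integrable a : L2 a -> leb.-integrable Omega (EFin \o (cost M \o a)).
Proof.
move=> La; have [C C0 HC] := cost_lipschitz M.
have ia := L2_integrable mO fO La.
have iCa : leb.-integrable Omega (fun x => C%:E * (`|a x|)%:E)%E.
  by apply: integrableZl => //; exact: integrable_norm.
apply: le_integrable iCa => //.
  apply/measurable_EFinP; apply: measurableT_comp La.1.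
  by apply: continuous_measurable_fun; exact: continuous_cost.
move=> x _; rewrite -EFinM /= lee_fin.
have := HC (a x) 0; rewrite (cost0 (M := M) (s := 0)) ?normr0// !subr0 => /le_trans; apply.
exact: ler_norm.
Qed.

Lemma continuous_lyapunov : continuous lyapunov.
Proof.
have [C C0 HC] := cost_lipschitz M.
have L1 : L2 (cst 1) by apply: (L2_bounded mO (c := 1)) => // x _; rewrite normr1.
pose q := C ^+ 2 * fine (sqint (cst 1)).
have q0 : 0 <= q by rewrite mulr_ge0 ?sqr_ge0// fine_ge0// sqint_ge0.
pose Phi (a : E -> R) := \int[leb]_(x in Omega) cost M (a x).
suff H : continuous (fun t => Phi (U (clamp T t))) by exact: H.
apply: (continuous_clamped oO T0 LU cU q0); rewrite /Phi.
move=> a b La Lb e e0; have Lab := L2B mO La Lb.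
have mc w : L2 w -> measurable_fun Omega (cost M \o w).
  move=> Lw; apply: measurableT_comp Lw.1.
  by apply: continuous_measurable_fun; exact: continuous_cost.
pose h x := cost M (a x) - cost M (b x).
have mh : measurable_fun Omega h by exact: (measurable_funB (mc _ La) (mc _ Lb)).
have hle x : Omega x -> `|h x| <= C * `|(a \- b) x| by move=> _; exact: HC.
have Lh : L2 h by exact: (L2_le mO Lab mh hle).
rewrite -RintegralB//; [|exact: cost_integrable|exact: cost_integrable].
have -> : \int[leb]_(x in Omega) (cost M (a x) - cost M (b x)) =
    \int[leb]_(x in Omega) (h x * cst 1 x).
  by apply: eq_Rintegral => x _; rewrite /= mulr1.
(* With weight e / C^2 the bound ||h||^2 <= C^2 ||a - b||^2 contributes e ||a - b||^2, and the
   inverse weight is absorbed into q. *)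
have eC0 : 0 < e / C ^+ 2 by rewrite divr_gt0// exprn_gt0.
apply: (le_trans (le_Rintegral_L2 mO eC0 Lh L1)).
have := le_sqint leb mO (ltW C0) mh (measurable_funB La.1 Lb.1) hle.
rewrite (sqint_fin Lh) (sqint_fin Lab) -EFinM lee_fin => H.
have s0 : 0 <= fine (sqint (a \- b)) by rewrite fine_ge0// sqint_ge0.
have H1 : e / C ^+ 2 * fine (sqint h) <= e * fine (sqint (a \- b)).
  apply: (le_trans (ler_wpM2l (ltW eC0) H)).
  by rewrite mulrA divfK// gt_eqF// exprn_gt0.
have H2 : (e / C ^+ 2)^-1 * fine (sqint (cst 1)) = e^-1 * q.
  by rewrite invf_div /q; ring.
have p1 : 0 <= e * fine (sqint (a \- b)) by rewrite mulr_ge0// ltW.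
have p2 : 0 <= e^-1 * q by rewrite mulr_ge0// invr_ge0 ltW.
by rewrite H2; lra.
Qed.

(** The tangent inequality is taken at the representative [w] of [U t], for which membership in
    H^1_0 is known. *)
Lemma lyapunov_step w (s t : R) : H10 w -> w = U t %[ae leb in Omega] ->
  0 < s -> s < t -> t < T ->
  lyapunov t - lyapunov s <= \int[leb]_(x in Omega) ((U t x - U s x) * (excess M \o w) x).
Proof.
move=> Hw wU s0 st tT.
have sT : `[0, T]%classic s by rewrite /= in_itv/=; apply/andP; split; lra.
have tT' : `[0, T]%classic t by rewrite /= in_itv/=; apply/andP; split; lra.
have [Lw _] := H1P oO Hw.1; have Ls := LU sT; have Lt := LU tT'.
have [K K0 HK] := excess_bounded M.
have Le : L2 (excess M \o w).
  apply: (L2_bounded mO (c := K)) => //; last by move=> x _; exact: HK.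
  apply: measurableT_comp Lw.1; apply: continuous_measurable_fun.
  exact: (Coo1_continuous (Coo1_excess M)).
rewrite /lyapunov (clamp_id sT) (clamp_id tT') -RintegralB//; [|exact: cost_integrable|exact: cost_integrable].
apply: ae_le_Rintegral => //.
- rewrite (_ : EFin \o _ = (EFin \o (cost M \o U t)) \- (EFin \o (cost M \o U s)))%E//.
  by apply: integrableB => //; exact: cost_integrable.
- exact: (L2_integrableM mO (L2B mO Lt Ls) Le).
- apply: filterS wU => x H Ox /=; rewrite (H Ox) mulrC; exact: cost_convex.
Qed.

(** Both conditions of [nonincreasing_backward] estimate the integral over ]s, t] of the pairing of
    [ut r] with the fixed function [v t]. They differ by the Young weight: 1 gives a bound
    integrable in t, a small eta gives the limit. *)
Lemma lyapunov_nonincreasing (a b : R) : 0 < a -> a < b -> b < T ->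
  lyapunov b <= lyapunov a.
Proof.
move=> a0 ab bT.
have [ku [ku0 iku Hku]] := solution_majorant.
have [kt [kt0 ikt Hkt]] := derivative_majorant oO bO tu.
have ckey (k : R -> R) : mu.-integrable I (EFin \o k) -> mu.-integrable setT (EFin \o (k \_ I)).
  by move=> ik; rewrite -restrict_EFin; apply/integrable_restrict => //=; rewrite setTI.
have pos (k : R -> R) : (forall t, 0 <= k t) -> forall t, 0 <= (k \_ I) t.
  by move=> k0 t; rewrite patchE; case: ifP.
(* A bound for the squared norm of [v t], from the chain rule with constant c; the shift by 1 gives
   the positivity that [le_dual_sq] asks for. *)
pose bb t := c ^+ 2 * ku t + 1.
have bb0 t : 0 < bb t by rewrite /bb ltr_wpDl// mulr_ge0// sqr_ge0.
have ibb : mu.-integrable I (EFin \o (fun t => bb t / 2)).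
  rewrite (_ : EFin \o _ = (fun t => (c ^+ 2 / 2)%:E * (ku t)%:E) \+ (EFin \o (fun=> 2^-1)%R))%E.
    by apply: integrableD => //; [exact: integrableZl|exact: interval_cst_integrable].
  by apply/funext => t; rewrite /= -EFinM -EFinD /bb; congr EFin; field.
have subI t : `[a, b]%classic t -> I t.
  by rewrite /= !in_itv/= => /andP[at_ tb]; apply/andP; split; lra.
have e0 : excess M 0 = 0 by apply: excess0; rewrite normr0.
have dc' s : `|(excess M)^`()%classic s| <= c by rewrite excess_derive1.
have [uX _ _] := bu; have [[utX [sn [ssn sut]] _] _] := tu.
pose v t := excess M \o u t.
have good : \forall t \ae mu, I t -> [/\ H10 (v t), (normH1 (v t) `^ 2 <= (bb t)%:E)%E,
    forall s, 0 < s < t -> lyapunov t - lyapunov s <=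
      \int[leb]_(x in Omega) ((U t x - U s x) * v t x)
    & H10 (u t)].
  apply: aeS3 uX uU Hku => t + + + It => /(_ It) Hu /(_ It) uUt /(_ It) Hk.
  have [Hv _ Nv] := chain_rule oO bO (Coo1_excess M) e0 dc' Hu.
  split => //.
    apply: (le_trans Nv); apply: (@le_trans _ _ ((c ^+ 2)%:E * (ku t)%:E)%E).
      by apply: lee_wpmul2l => //; rewrite lee_fin sqr_ge0.
    by rewrite -EFinM lee_fin lerDl.
  move=> s /andP[s0 st]; apply: lyapunov_step => //.
  by move: It; rewrite /= in_itv/= => /andP[].
have ener t : H10 (v t) -> exists G : R -> R,
    [/\ mu.-integrable I (EFin \o G), \forall r \ae mu, I r -> ut r (v t) = G r
      & forall s t', 0 < s -> s < t' -> t' < T ->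
        \int[leb]_(x in Omega) ((U t' x - U s x) * v t x) = \int[mu]_(r in `]s, t']) G r].
  by move=> Hv; apply: (energy_identity oO bO T0 LU cU tu uU _ Hv);
    apply: aeS uX => r H /H [/(H1P oO)[]].
apply: (@nonincreasing_backward _ lyapunov (kt \_ I) (fun t => bb t / 2) a b) => //.
- exact: continuous_lyapunov.
- exact: pos.
- by move=> t; rewrite divr_ge0// ltW.
- exact: ckey.
- by apply: integrableS ibb => //; exact: measurable_itv.
(* Weight 1 bounds the pairing by (kt r + bb t) / 2: the part in r goes into the primitive, the part
   in t is the correction [k]. *)
- apply: aeS good => t H /subI It s /andP[s0 st].
  have [Hv Nv step _] := H It; have [G [iG HG stepG]] := ener t Hv.
  have tT : t < T by move: It; rewrite /= in_itv/= => /andP[].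
  apply: le_trans (step s _) _; first by rewrite s0.
  rewrite stepG//; rewrite -[X in _ <= X + _]mul1r.
  apply: Rintegral_step_le => //.
  apply: aeS3 HG Hkt utX => r + + + Ir => /(_ Ir) <- /(_ Ir) kr /(_ Ir) [lr _].
  have := le_dual_sq oO bO lr Hv (bb0 t) Nv kr ltr01.
  rewrite invr1 !mul1r => H1; apply: (le_trans (ler_norm _)); apply: (le_trans H1).
  rewrite mulrDl lerD2r; have := kt0 r; lra.
(* For the upper limit at t, the pairing at time r is compared with its nonpositive value at time t
   through a simple value y close to [ut t]. *)
- have Hm1s n t : I t -> Hm1 (sn n t).
    by move=> It; have [_ sX _] := ssn n; apply: sX; exists t.
  have /choice[ky Hky] : forall y, exists k : R -> R, Hm1 y -> [/\ forall t, 0 <= k t,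
      mu.-integrable I (EFin \o k)
      & \forall t \ae mu, I t ->
        (normHm1 (ut t - y)%R `^ 2 <= (k t)%:E <= 4%:E * normHm1 (ut t - y)%R `^ 2)%E].
    move=> y; have [Hy|nHy] := pselect (Hm1 y); last by exists (cst 0).
    by have [k Hk] := derivative_sub_majorant Hy; exists k.
  (* The values of the simple approximations of [ut] are countably many, so
     that almost every [t] is a Lebesgue point of all [|| ut - y ||^2] at once. *)
  have leb_pt : \forall t \ae mu, forall n (y : (E -> R) -> R), (sn n @` I) y ->
      is_derive (t : R) 1 (primitive (ky y \_ I)) ((ky y \_ I) t) /\
      (I t -> ((ky y t)%:E <= 4%:E * normHm1 (ut t - y)%R `^ 2)%E).
    apply: ae_leb_forall => n; have [fs sX _] := ssn n.
    apply: (@ae_finite_set _ _ (sn n @` I)) => // y /sX Hy.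
    have [k0 ik Hk] := Hky y Hy.
    by apply: aeS2 (ae_derive_primitive (ckey _ ik)) Hk => t d1 d2; split => // /d2 /andP[].
  have utle' : \forall t \ae mu, I t -> ut t (v t) <= 0 /\ linear_form Omega (ut t).
    by apply: aeS2 utle utX => t H1 H2 It; split; [exact: H1|case: (H2 It)].
  have gd : \forall t \ae mu, I t -> [/\ H10 (v t), (normH1 (v t) `^ 2 <= (bb t)%:E)%E,
    forall s, 0 < s < t -> lyapunov t - lyapunov s <=
      \int[leb]_(x in Omega) ((U t x - U s x) * v t x)
    & ut t (v t) <= 0 /\ linear_form Omega (ut t)].
    by apply: aeS2 good utle' => t + + It => /(_ It) [? ? ? _] /(_ It) ?; split.
  apply: aeS3 gd leb_pt sut => t + Hd + /subI It => /(_ It) [Hv Nv step [le0 lt]] /(_ It) st e e_gt0.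
  have tI : 0 < t < T by move: It; rewrite /= in_itv.
  have /andP[t0 tT] := tI.
  have [G [iG HG stepG]] := ener t Hv.
  (* After division by t - s, the primitive of [ky y] costs 5/2 eta and the duality estimates cost
     (1/2 + bb t) eta, in total (3 + bb t) eta = e. *)
  pose eta := e / (3 + bb t).
  have den0 : 0 < 3 + bb t by rewrite addr_gt0.
  have eta0 : 0 < eta by rewrite divr_gt0.
  have N0s n : (0 <= normHm1 (sn n t - ut t)%R)%E by exact: N0.
  have [n _ /(_ n (leqnn n)) Nn] : \forall n \near \oo, (normHm1 (sn n t - ut t)%R <= eta%:E)%E.
    exact: (proj1 (cvge0P N0s) st _ eta0).
  pose y := sn n t.
  have Hy : Hm1 y by exact: Hm1s.
  have yI : (sn n @` I) y by exists t.
  have [d1 d2] := Hd n y yI; have [ky0 iky Hk] := Hky y Hy.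
  have Ny : (normHm1 (y - ut t)%R `^ 2 <= (eta ^+ 2)%:E)%E by rewrite (poweR2_le (N0 _) (ltW eta0)).
  have kyt : (ky y \_ I) t <= 4 * eta ^+ 2.
    rewrite patchE mem_set// -lee_fin; apply: (le_trans (d2 It)).
    by rewrite EFinM; apply: lee_wpmul2l => //; rewrite normHm1N.
  (* The constant 5 instead of 4 gives the strict inequality needed to bound the left quotients near
     t. *)
  have kyt5 : (ky y \_ I) t < 5 * eta ^+ 2.
    by apply: (le_lt_trans kyt); rewrite ltr_pM2r ?exprn_gt0// ltr_nat.
  have Hleft := is_derive_left_le d1 kyt5.
  have s_pos : \forall s \near t^'-, 0 < s by exact: nbhs_left_gt.
  have s_lt : \forall s \near t^'-, s < t by exact: nbhs_left_lt.
  apply: filterS3 Hleft s_pos s_lt => s Hs s0 st'.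
  apply: le_trans (step s _) _; first by rewrite s0.
  rewrite stepG//.
  (* Split [ut r] as (ut r - y) + (y - ut t) + ut t and pair with [v t]: Young with weight eta for
     the first two terms, the sign condition for the third. *)
  have GL : \forall r \ae mu, I r -> G r <= eta^-1 / 2 * ky y r + (eta * bb t + eta / 2).
    apply: aeS3 HG Hk utX => r + + + Ir => /(_ Ir) <- /(_ Ir) /andP[kr _] /(_ Ir) [lr _].
    have [ly _] := Hy.
    have B1 := le_dual_sq oO bO (linear_formB lr ly) Hv (bb0 t) Nv kr eta0.
    have B2 := le_dual_sq oO bO (linear_formB ly lt) Hv (bb0 t) Nv Ny eta0.
    have B1' := le_trans (ler_norm _) B1; have B2' := le_trans (ler_norm _) B2.
    move: B1' B2'; rewrite -[(ut r - y) (v t)]/(ut r (v t) - y (v t)).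
    rewrite -[(y - ut t) (v t)]/(y (v t) - ut t (v t)).
    have -> : eta^-1 * eta ^+ 2 = eta by rewrite expr2 mulrA mulVf ?mul1r// gt_eqF.
    lra.
  apply: (le_trans (Rintegral_step_le iG iky GL s0 st' tT)).
  have ei0 : 0 <= eta^-1 / 2 by rewrite divr_ge0// invr_ge0 ltW.
  have H5 := ler_wpM2l ei0 Hs.
  have E5 : eta^-1 / 2 * (5 * eta ^+ 2 * (t - s)) = eta * (5 / 2) * (t - s).
    by field; rewrite gt_eqF.
  have Ee : e = eta * (3 + bb t) by rewrite /eta divfK// gt_eqF.
  rewrite E5 in H5; rewrite [in leRHS]Ee.
  have -> : eta * (3 + bb t) * (t - s) = eta * (5 / 2) * (t - s) + (t - s) * (eta * bb t + eta / 2) by field.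
  by rewrite lerD2r.
Qed.

End maximum_principle.

Lemma normLoo_leP {R : realType} {d : nat} (Omega : set 'rV[R]_d) (v : 'rV[R]_d -> R) (C : R) :
  0 <= C -> (normL Omega +oo v <= C%:E)%E <->
    \forall x \ae (lebesgue_rV d : {measure set 'rV[R]_d -> \bar R}), Omega x -> `|v x| <= C.
Proof.
move=> C0; rewrite /normL unlock; set leb := (X in (0 < X _)%E).
(* If the whole space had measure zero, the norm would be 0 by convention and every almost
   everywhere statement would hold. *)
case: ifPn => [_|]; last first.
  rewrite -leNgt => le0; split => [_|]; last by rewrite lee_fin.
  exists setT; split => //; apply/eqP; rewrite eq_le le0; exact: measure_ge0.
split => [/ess_supP H|H].
  apply: filterS H => x /=; rewrite patchE lee_fin => H Ox.
  by move: H; rewrite mem_set.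
apply/ess_supP; apply: filterS H => x H /=; rewrite patchE lee_fin.
by case: ifPn => [/set_mem/H//|_]; rewrite normr0.
Qed.

Section conclusion.
Context {R : realType} {d : nat} (Omega : set 'rV[R]_d) (T : R).
Local Notation E := 'rV[R]_d.
Local Notation leb := (lebesgue_rV d : {measure set E -> \bar R}).
Local Notation mu := (@lebesgue_measure R).
Local Notation I := (`]0, T[%classic : set R).
Local Notation L2 := (L2 leb Omega).
Hypothesis oO : open Omega.
Hypothesis bO : bounded_set Omega.
Let mO : measurable Omega := open_measurable_rV oO.
Hypothesis T0 : 0 < T.
Variable U : R -> E -> R.
Hypothesis LU : forall t, `[0, T]%classic t -> L2 (U t).
Hypothesis cU : forall t0, `[0, T]%classic t0 ->
  normL Omega 2%:E (U t - U t0) @[t --> within `[0, T]%classic (nbhs t0)] --> 0%E.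
Variables (M : R).
Hypothesis M0 : 0 <= M.

Lemma lyapunov_ge0 t : 0 <= lyapunov Omega T U M t.
Proof. by apply: Rintegral_ge0 => x _; exact: cost_ge0. Qed.

Lemma lyapunov_eq0 t : `[0, T]%classic t -> lyapunov Omega T U M t = 0 <->
  \forall x \ae leb, Omega x -> `|U t x| <= M.
Proof.
move=> tT; rewrite /lyapunov (clamp_id tT).
have ic := cost_integrable oO bO M0 (LU tT).
have mc : measurable_fun Omega (EFin \o (cost M \o U t)) by exact: measurable_int ic.
have E1 : (\int[leb]_(x in Omega) `|(EFin \o (cost M \o U t)) x| =
    (\int[leb]_(x in Omega) cost M (U t x))%:E)%E.
  rewrite /Rintegral fineK; last exact: (integrable_fin_num mO ic).
  by apply: eq_integral => x _; rewrite gee0_abs// lee_fin cost_ge0.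
split => [H|H].
  have : ae_eq leb Omega (EFin \o (cost M \o U t)) (cst 0%E).
    by apply/(ae_eq_integral_abs _ mO mc); rewrite E1 H.
  by apply: filterS => x Hx Ox; apply: cost_eq0; apply: EFin_inj; exact: Hx.
apply: EFin_inj; rewrite -E1; apply/(ae_eq_integral_abs _ mO mc).
by apply: filterS H => x Hx Ox /=; rewrite cost0// Hx.
Qed.

(** Monotonicity is available only between interior times; continuity at 0 carries it down to the
    initial time, where the functional vanishes. *)
Lemma lyapunov_bound : continuous (lyapunov Omega T U M) ->
  (forall a b, 0 < a -> a < b -> b < T -> lyapunov Omega T U M b <= lyapunov Omega T U M a) ->
  (\forall x \ae leb, Omega x -> `|U 0 x| <= M) ->
  forall t, I t -> \forall x \ae leb, Omega x -> `|U t x| <= M.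
Proof.
move=> cl mono U0 t It.
have /andP[t0 tT] : 0 < t < T by move: It; rewrite /= in_itv.
have z : `[0, T]%classic 0 by rewrite /= in_itv/= lexx ltW.
have tI : `[0, T]%classic t by rewrite /= in_itv/= !ltW.
apply/(lyapunov_eq0 tI); apply/eqP; rewrite eq_le lyapunov_ge0 andbT.
have l0 : lyapunov Omega T U M 0 = 0 by apply/(lyapunov_eq0 z).
rewrite -l0; apply: (cvgr_to_ge (cvg_at_right_filter (cl 0))).
have a0 : \forall a \near (0 : R)^'+, 0 < a by exact: nbhs_right_gt.
have at_ : \forall a \near (0 : R)^'+, a < t by exact: nbhs_right_lt.
by apply: filterS2 a0 at_ => a ? ?; exact: mono.
Qed.

End conclusion.

Theorem theorem1p3 (R : realType) (d : nat) (hd : (0 < d)%N)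
  (Omega : set 'rV[R]_d) (hdomain : domain Omega) (hbounded : bounded_set Omega)
  (hboundary : smooth_boundary Omega)
  (T : R) (hT : 0 < T)
  (f : 'I_d -> R -> R) (hfC2 : forall i, C2 (f i))
  (hfLoo : forall i,
    (((f i)^`()%classic : measurableTypeR R -> R) \in Lfun lebesgue_measure +oo%E))
  (B : 'I_d -> 'I_d -> R -> R) (hBC2 : forall i j, C2 (B i j))
  (hBLoo : forall i j,
    ((B i j : measurableTypeR R -> R) \in Lfun lebesgue_measure +oo%E))
  (hBell : exists2 theta : R, 0 < theta & forall (s : R) (xi : 'rV[R]_d),
     theta * \sum_(i < d) xi 0 i ^+ 2
       <= \sum_(i < d) \sum_(j < d) B i j s * xi 0 i * xi 0 j)
  (u0 : 'rV[R]_d -> R) (hu0 : Lp Omega +oo%E u0)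
  (u : R -> 'rV[R]_d -> R) (hu : weak_solution Omega T f B u0 u) :
  \forall t \ae (@lebesgue_measure R), `]0, T[%classic t ->
    (normL Omega +oo (u t) <= normL Omega +oo u0)%E.
Proof.
have [_ oO _] := hdomain.
have mO := open_measurable_rV oO.
have [[bu _] [ut [tu weak]] [U [LU0 cU uU U0]]] := hu.
pose M := fine (normL Omega +oo u0).
have n0 : (0 <= normL Omega +oo u0)%E by exact: normL_ge0.
have M0 : 0 <= M by rewrite fine_ge0.
have nE : normL Omega +oo u0 = M%:E.
  rewrite fineK// ge0_fin_numE//.
  by case/andP: hu0 => _ /set_mem.
have LU t : `[0, T]%classic t -> L2 (lebesgue_rV d) Omega (U t) by move=> /LU0/(LpP oO).
have [c c0 dc] := dexcess_bounded M.
have [theta theta0 ell] := hBell.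
have cf i : continuous (f i)^`()%classic by have [_ df _] := hfC2 i; exact: derivable_continuous.
have cB i j : continuous (B i j) by have [dB _ _] := hBC2 i j; exact: derivable_continuous.
have bf i := continuous_Loo_bounded (cf i) (hfLoo i).
have bB i j := continuous_Loo_bounded (cB i j) (hBLoo i j).
have [uX _ _] := bu.
have e0 : excess M 0 = 0 by apply: excess0; rewrite normr0.
have dc' s : `|(excess M)^`()%classic s| <= c by rewrite excess_derive1.
have utle : \forall t \ae (@lebesgue_measure R), `]0, T[%classic t -> ut t (excess M \o u t) <= 0.
  apply: aeS2 uX weak => t + + It => /(_ It) Hu /(_ It) wk.
  have [Hv _ _] := chain_rule oO hbounded (Coo1_excess M) e0 dc' Hu.
  exact: (weak_form_le0 oO hbounded cf bf cB bB theta0 ell M0 dc Hu (wk _ Hv)).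
have mono a b := @lyapunov_nonincreasing _ _ _ _ oO hbounded hT U LU cU u ut tu uU bu M c M0 dc utle a b.
have cl := @continuous_lyapunov _ _ _ _ oO hbounded hT U LU cU M M0.
have U0M : \forall x \ae (lebesgue_rV d), Omega x -> `|U 0 x| <= M.
  have u0M : \forall x \ae (lebesgue_rV d), Omega x -> `|u0 x| <= M.
    by apply/normLoo_leP => //; rewrite nE.
  by apply: filterS2 U0 u0M => x H1 H2 Ox; rewrite (H1 Ox) H2.
have bnd := lyapunov_bound oO hbounded hT LU M0 cl mono U0M.
apply: aeS uU => t H It; rewrite nE; apply/normLoo_leP => //.
by apply: filterS2 (H It) (bnd t It) => x H1 H2 Ox; rewrite (H1 Ox) H2.
Qed.
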